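(* Let $f\in\mathcal{C}^\alpha(D^n)$ and let $\mu=(\mu_1,\dots,\mu_n)$, $\nu=(\nu_1,\dots,\nu_n)$ be vectors of positive integers. Then $T^\mu\overline{T}^\nu f\in\mathcal{C}^\alpha(D^n)$, and for $z=(z_1,\dots,z_n)\in D^n$ $$T^\mu\overline{T}^\nu f(z)=C_8(\mu,\nu)\int_D\cdots\int_D\prod_{j=1}^{n}C_3(z_j,\eta_j,\mu_j,\nu_j)\,f(\eta)\,d\bar\eta_1\wedge d\eta_1\cdots d\bar\eta_n\wedge d\eta_n,$$ where $\eta=(\eta_1,\dots,\eta_n)$ and $$C_8(\mu,\nu)=\frac{(-1)^{|\mu|}}{(\mu-\mathbf 1)!\,(\nu-\mathbf 1)!\cdot(2\pi i)^n}.$$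
   Context: Fix $R>0$, $0<\alpha<1$, $n\ge1$. $D=\{z\in\mathbb{C}: |z|\le R\}$ is the closed disk and $D^n$ its $n$-fold cartesian product. Functions are complex valued. $d\bar\zeta\wedge d\zeta=2i\,dx\,dy$ for $\zeta=x+iy$. For $f$ on $D^n$ define the difference $\Delta_if(z_1,\dots,(z_i,z_i'),\dots,z_n)=f(z_1,\dots,z_i,\dots,z_n)-f(z_1,\dots,z_i',\dots,z_n)$ for $z_i\ne z_i'$, and for distinct $i_1,\dots,i_k\in\{1,\dots,n\}$ let $\Delta_{i_1\cdots i_k}f=\Delta_{i_k}\Delta_{i_1\cdots i_{k-1}}f$. Put $$\delta_{i_1\cdots i_k}f=\frac{\Delta_{i_1\cdots i_k}f}{|z_{i_1}-z_{i_1}'|^\alpha\cdots|z_{i_k}-z_{i_k}'|^\alpha},$$ and let $H_\alpha^{(k)}[f]$ be the maximum over distinct $i_1,\dots,i_k$ of $\sup|\delta_{i_1\cdots i_k}f|$ (supremum over all points with $z_{i_j}\neq z'_{i_j}$), with $H_\alpha^{(0)}[f]=\sup_{D^n}|f|$. $\mathcal{C}^\alpha(D^n)$ is the set of $f$ with $H_\alpha^{(k)}[f]<\infty$ for all $k=0,\dots,n$. Operators: for $j=1,\dots,n$, $$T_jf(z)=\frac{-1}{2\pi i}\int_D\frac{f(z_1,\dots,z_{j-1},\zeta,z_{j+1},\dots,z_n)\,d\bar\zeta\wedge d\zeta}{\zeta-z_j},\quad \overline{T}_jf(z)=\frac{-1}{2\pi i}\int_D\frac{f(z_1,\dots,z_{j-1},\zeta,z_{j+1},\dots,z_n)\,d\bar\zeta\wedge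 d\zeta}{\bar\zeta-\bar z_j},$$ and $T^\mu\overline{T}^\nu f=T_1^{\mu_1}\cdots T_n^{\mu_n}\overline{T}_1^{\nu_1}\cdots\overline{T}_n^{\nu_n}f$ (iterated compositions). Also $|\mu|=\sum_j\mu_j$, $\mu!=\prod_j\mu_j!$, $\mathbf 1=(1,\dots,1)$. The kernel is defined for $a,b\in D$, $a\ne b$, and positive integers $\mu,\nu$ (scalars here), with $\ln$ the principal branch (there $R^2-a\bar b$ has positive real part) and $0^0=1$, by $$C_1(a,b,k)=\sum_{l=1}^{k-1}\Big(\frac{-b^l}{l}\Big)\Big(\sum_{j=0}^{k-1-l}\binom{k-1}{j}a^{k-1-j}(-b)^j\Big)\ (k>1),\qquad C_1(a,b,1)=0,$$ $$C_2(a,b,l,\nu)=\sum_{\substack{0\le p\le l,\ 0\le q\le \nu-1\\ p\le q}}\binom{l}{p}\binom{\nu-1}{q}R^{2p}(-\bar b)^{l-p}(-b)^{\nu-1-q}a^{q-p},$$ $$C_3(a,b,\mu,\nu)=(\bar b-\bar a)^{\mu-1}\Big(C_1(a,b,\nu)+(a-b)^{\nu-1}\ln\frac{R^2-a\bar b}{|a-b|^2}\Big)+\sum_{l=1}^{\mu-1}\binom{\mu-1}{l}(\bar b-\bar a)^{\mu-1-l}\Big(\frac{-1}{l}(\bar a-\bar b)^l(a-b)^{\nu-1}-\frac1l C_2(a,b,l,\nu)\Big)\ (\mu>1),$$ $$C_3(a,b,1,\nu)=C_1(a,b,\nu)+(a-b)^{\nu-1}\ln\frac{R^2-a\bar b}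{|a-b|^2}.$$
   Formalization: As printed the formula fails (e.g. n=1, μ=1, ν=2, f(z)=z̄ at z=0: 3R^4/4 versus R^4/4); the theorem proved uses a^{k-1-j-l} in place of a^{k-1-j} in C_1, and +(1/l)C_2 in place of -(1/l)C_2 in C_3. *)

(* Defs.v *)
From HB Require Import structures.
From mathcomp Require Import all_boot all_order all_algebra.
From mathcomp Require Import complex.
From mathcomp Require Import all_classical all_reals all_analysis.

Set Implicit Arguments.
Unset Strict Implicit.
Unset Printing Implicit Defensive.

Import Order.TTheory GRing.Theory Num.Theory.
Import Normc.

Local Open Scope classical_set_scope.
Local Open Scope complex_scope.
Local Open Scope ring_scope.

(* Functions on D^n are encoded as total functions on C^n = 'I_n -> R[i]; all
   the notions below only look at their values on D^n. *)

Section Kernel.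
Variables (R : realType) (r : R).
Implicit Types (a b z : R[i]) (k l mu nu : nat).

(* Principal argument, in ]-pi, pi] (meaningful for z != 0 only). *)
Definition Arg z : R :=
  if 0 <= complex.Im z then acos (complex.Re z / normc z)
  else - acos (complex.Re z / normc z).

(* Principal branch of the complex logarithm. *)
Definition Ln z : R[i] := ln (normc z) +i* Arg z.

(* C1 a b k is the polynomial part in a of
   (a - b)^(k-1) * sum_(l >= 1) (-1/l) (b/a)^l, so that the power of a is
   k - 1 - j - l.  The exponent k - 1 - j of the source is a
   misprint (the result would not be homogeneous); see C3 for its effect.
   The sum is empty for k = 1. *)
Definition C1 a b k : R[i] :=
  \sum_(1 <= l < k) (- b ^+ l / l%:R) *
    (\sum_(0 <= j < k - l)
       'C(k.-1, j)%:R * a ^+ (k.-1 - j - l) * (- b) ^+ j).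

Definition C2 a b l nu : R[i] :=
  \sum_(0 <= p < l.+1) \sum_(0 <= q < nu | (p <= q)%N)
    'C(l, p)%:R * 'C(nu.-1, q)%:R * (r%:C) ^+ (2 * p) *
    (- b^*) ^+ (l - p) * (- b) ^+ (nu.-1 - q) * a ^+ (q - p).

(* C2 a b l nu is the orthogonal projection on holomorphic functions of
   the boundary values (|a| = r) of (conj a - conj b)^l (a - b)^(nu-1); it has to
   cancel that term, hence the sign + before l^-1 * C2.  The sign - of the
   source is a misprint.  With n = 1, T^mu Tbar^nu f 0 is
   - 3/4 r^4 for mu = 1, nu = 2, f z = conj z (the misprinted C1 gives 1/4 r^4),
   - 1/4 r^4 for mu = 2, nu = 1, f z = z (the misprinted sign gives 5/4 r^4).
   The last sum is empty for mu = 1. *)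
Definition C3 a b mu nu : R[i] :=
  (b^* - a^*) ^+ mu.-1 *
    (C1 a b nu +
     (a - b) ^+ nu.-1 * Ln (((r ^+ 2)%:C - a * b^*) / (normc (a - b) ^+ 2)%:C))
  + \sum_(1 <= l < mu) 'C(mu.-1, l)%:R * (b^* - a^*) ^+ (mu.-1 - l) *
      (-1 / l%:R * (a^* - b^*) ^+ l * (a - b) ^+ nu.-1
       + 1 / l%:R * C2 a b l nu).

End Kernel.

Section Polydisk.
Variables (R : realType) (r : R) (n : nat).
Local Notation C := R[i].
Local Notation pt := ('I_n -> C).
Implicit Types (f : pt -> C) (z : pt) (mu nu : 'I_n -> nat).

Definition disk : set C := [set z | normc z <= r].

Definition polydisk : set pt := [set z | forall j, disk (z j)].

Definition Delta (z' : pt) (i : 'I_n) f : pt -> C :=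
  fun z => f z - f [eta z with i |-> z' i].

(* For s = [:: i_1; ...; i_k], this is Delta_{i_k} (... (Delta_{i_1} f)),
   evaluated at the points (z_i, z'_i), i in s, and z_i, i not in s. *)
Definition Deltas (s : seq 'I_n) f (z z' : pt) : C :=
  foldl (fun F i => Delta z' i F) f s z.

Definition delta (alpha : R) (s : seq 'I_n) f (z z' : pt) : C :=
  Deltas s f z z' / (\prod_(i <- s) normc (z i - z' i) `^ alpha)%:C.

Definition Hseminorm (alpha : R) (k : nat) f : \bar R :=
  \big[maxe/-oo%E]_(s : k.-tuple 'I_n | uniq s)
    ereal_sup [set x | exists z z', [/\ polydisk z, polydisk z',
      (forall i, i \in s -> z i != z' i) &
      x = (normc (delta alpha s f z z'))%:E]].

Definition Calpha (alpha : R) : set (pt -> C) :=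
  [set f | forall k, (k <= n)%N -> (Hseminorm alpha k f < +oo)%E].

(* Integral over D of g(zeta) d(conj zeta) /\ d(zeta) = 2 i g(x + i y) dx dy. *)
Definition diskint (g : C -> C) : C :=
  let D := [set p : R * R | disk (p.1 +i* p.2)] in
  let m := (lebesgue_measure \x lebesgue_measure)%E in
  2%:R * 'i%C * ((\int[m]_(p in D) complex.Re (g (p.1 +i* p.2)))
               +i* (\int[m]_(p in D) complex.Im (g (p.1 +i* p.2)))).

(* Iterated integral over D of f, the first variable being the innermost. *)
Definition polydiskint f : C :=
  foldl (fun F j z => diskint (fun w => F [eta z with j |-> w])) f
    (enum 'I_n) (fun=> 0).

Definition twopii : C := 2%:R * (pi : R)%:C * 'i%C.

Definition T (j : 'I_n) f : pt -> C := fun z =>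
  -1 / twopii *
  diskint (fun w => f [eta z with j |-> w] / (w - z j)).

Definition Tbar (j : 'I_n) f : pt -> C := fun z =>
  -1 / twopii *
  diskint (fun w => f [eta z with j |-> w] / (w^* - (z j)^*)).

(* S_1^(mu_1) (S_2^(mu_2) (... (S_n^(mu_n) f))) *)
Definition oppow (S : 'I_n -> (pt -> C) -> pt -> C) mu f : pt -> C :=
  foldr (fun j F => iter (mu j) (S j) F) f (enum 'I_n).

Definition C8 mu nu : C :=
  (-1) ^+ (\sum_j mu j) /
  ((\prod_j ((mu j).-1)`!)%:R * (\prod_j ((nu j).-1)`!)%:R * twopii ^+ n).

End Polydisk.

Arguments T {R} r {n} j f z.
Arguments Tbar {R} r {n} j f z.

(* Main.v *)
Require Import Defs.
From HB Require Import structures.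
From mathcomp Require Import all_boot all_order all_algebra.
From mathcomp Require Import complex.
From mathcomp Require Import all_classical all_reals all_analysis measurable_realfun.
From mathcomp Require Import ring lra zify.

Set Implicit Arguments.
Unset Strict Implicit.
Unset Printing Implicit Defensive.

Import Order.TTheory GRing.Theory Num.Theory numFieldNormedType.Exports.
Import Normc.

Local Open Scope classical_set_scope.
Local Open Scope complex_scope.
Local Open Scope ring_scope.

Local Notation Re := complex.Re.
Local Notation Im := complex.Im.

(** * The modulus on [R[i]] *)

Section Modulus.
Variable R : realType.
Implicit Types (x y z : R[i]).

Lemma normc_normr z : (normc z)%:C = `|z|.
Proof. by rewrite normc_def; case: z. Qed.

Lemma normc_ge0 z : 0 <= normc z.
Proof. by case: z => a b; rewrite /= sqrtr_ge0. Qed.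

Lemma normc_eq0 z : (normc z == 0) = (z == 0).
Proof.
apply/eqP/eqP => [/eq0_normc//|->]; exact: normc0.
Qed.

Lemma normc_gt0 z : (0 < normc z) = (z != 0).
Proof. by rewrite lt_def normc_ge0 andbT normc_eq0. Qed.

Lemma normc_sqr z : normc z ^+ 2 = Re z ^+ 2 + Im z ^+ 2.
Proof. by case: z => a b /=; rewrite sqr_sqrtr // addr_ge0 ?sqr_ge0. Qed.

Lemma normcB x y : normc (x - y) <= normc x + normc y.
Proof. by rewrite -(normcN y) le_normcD. Qed.

Lemma normc_distC x y : normc (x - y) = normc (y - x).
Proof. by rewrite -normcN opprB. Qed.

Lemma normc_dist_triangle x y z :
  normc (x - z) <= normc (x - y) + normc (y - z).
Proof. by rewrite (le_trans _ (le_normcD _ _))// addrA subrK. Qed.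

Lemma normc_conj z : normc z^* = normc z.
Proof. by case: z => a b; rewrite /= sqrrN. Qed.

Lemma normcX z n : normc (z ^+ n) = normc z ^+ n.
Proof. by elim: n => [|n IH]; rewrite ?normc1// !exprS normcM IH. Qed.

Lemma normc_real (x : R) : normc x%:C = `|x|.
Proof. by rewrite /= expr0n addr0 sqrtr_sqr. Qed.

Lemma normc_nat n : normc (n%:R : R[i]) = n%:R.
Proof. by rewrite -(rmorph_nat (real_complex R)) normc_real ger0_norm. Qed.

Lemma normr_Re_le z : `|Re z| <= normc z.
Proof. by rewrite -lecR normc_normr normc_ge_Re. Qed.

Lemma normr_Im_le z : `|Im z| <= normc z.
Proof.
by rewrite -sqrtr_sqr; case: z => a b /=; rewrite ler_wsqrtr// lerDr sqr_ge0.
Qed.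

Lemma normc_le_ReIm z : normc z <= `|Re z| + `|Im z|.
Proof.
rewrite -(ler_pXn2r (ltn0Sn 1)) ?nnegrE ?normc_ge0 ?addr_ge0//.
by rewrite normc_sqr sqrrD !real_normK ?num_real// addrAC lerDl mulrn_wge0 ?mulr_ge0.
Qed.

Lemma mulCJ z : z * z^* = (normc z ^+ 2)%:C.
Proof.
rewrite normc_sqr; case: z => a b; apply/eqP; rewrite eq_complex /=.
by apply/andP; split; apply/eqP; ring.
Qed.

Lemma Re_addc x y : Re (x + y) = Re x + Re y. Proof. by case: x; case: y. Qed.
Lemma Im_addc x y : Im (x + y) = Im x + Im y. Proof. by case: x; case: y. Qed.
Lemma Re_mulc x y : Re (x * y) = Re x * Re y - Im x * Im y.
Proof. by case: x; case: y. Qed.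
Lemma Im_mulc x y : Im (x * y) = Re x * Im y + Im x * Re y.
Proof. by case: x => a b; case: y => c d /=; rewrite addrC. Qed.
Lemma Re_oppc x : Re (- x) = - Re x. Proof. by case: x. Qed.
Lemma Im_oppc x : Im (- x) = - Im x. Proof. by case: x. Qed.
Lemma Re_conjc x : Re x^* = Re x. Proof. by case: x. Qed.
Lemma Im_conjc x : Im x^* = - Im x. Proof. by case: x. Qed.

End Modulus.

(** * Integration of complex-valued functions *)

Section ComplexMeasurable.
Variable R : realType.
Context d (X : measurableType d).
Implicit Types (g h : X -> R[i]).

Definition cmeasurable g :=
  measurable_fun setT (fun x => Re (g x)) /\
  measurable_fun setT (fun x => Im (g x)).

Lemma cmeasurable_cst c : cmeasurable (fun=> c).
Proof. by split; exact: measurable_cst. Qed.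

Lemma cmeasurable_real (f : X -> R) :
  measurable_fun setT f -> cmeasurable (fun x => (f x)%:C).
Proof. by move=> mf; split => //=; exact: measurable_cst. Qed.

Lemma cmeasurableD g h :
  cmeasurable g -> cmeasurable h -> cmeasurable (fun x => g x + h x).
Proof.
move=> [g1 g2] [h1 h2]; split.
  by under eq_fun do rewrite Re_addc; exact: measurable_funD.
by under eq_fun do rewrite Im_addc; exact: measurable_funD.
Qed.

Lemma cmeasurableN g : cmeasurable g -> cmeasurable (fun x => - g x).
Proof.
move=> [g1 g2]; split.
  by under eq_fun do rewrite Re_oppc; exact: measurable_funN.
by under eq_fun do rewrite Im_oppc; exact: measurable_funN.
Qed.

Lemma cmeasurableB g h :
  cmeasurable g -> cmeasurable h -> cmeasurable (fun x => g x - h x).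
Proof. by move=> mg mh; apply: cmeasurableD => //; exact: cmeasurableN. Qed.

Lemma cmeasurableM g h :
  cmeasurable g -> cmeasurable h -> cmeasurable (fun x => g x * h x).
Proof.
move=> [g1 g2] [h1 h2]; split.
  by under eq_fun do rewrite Re_mulc; apply: measurable_funB; exact: measurable_funM.
by under eq_fun do rewrite Im_mulc; apply: measurable_funD; exact: measurable_funM.
Qed.

Lemma cmeasurable_sum I (s : seq I) (P : pred I) (F : I -> X -> R[i]) :
  (forall i, cmeasurable (F i)) -> cmeasurable (fun x => \sum_(i <- s | P i) F i x).
Proof.
move=> mF; elim: s => [|i s IH].
  by under eq_fun do rewrite big_nil; exact: cmeasurable_cst.
under eq_fun do rewrite big_cons.
by case: (P i) => //; exact: cmeasurableD.
Qed.

Lemma cmeasurableX g n : cmeasurable g -> cmeasurable (fun x => g x ^+ n).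
Proof.
move=> mg; elim: n => [|n IH].
  by under eq_fun do rewrite expr0; exact: cmeasurable_cst.
by under eq_fun do rewrite exprS; exact: cmeasurableM.
Qed.

Lemma cmeasurable_conj g : cmeasurable g -> cmeasurable (fun x => (g x)^*).
Proof.
move=> [g1 g2]; split.
  by under eq_fun do rewrite Re_conjc.
by under eq_fun do rewrite Im_conjc; exact: measurable_funN.
Qed.

Lemma measurable_normc g : cmeasurable g -> measurable_fun setT (fun x => normc (g x)).
Proof.
move=> [g1 g2].
have -> : (fun x => normc (g x)) =
    (fun x => Num.sqrt (Re (g x) ^+ 2 + Im (g x) ^+ 2)).
  by apply/funext => x; case: (g x).
apply: (measurableT_comp (f := (@Num.sqrt R))).
  by apply: continuous_measurable_fun; exact: sqrt_continuous.
by apply: measurable_funD; exact: measurable_funX.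
Qed.

Lemma measurable_invr (f : X -> R) :
  measurable_fun setT f -> measurable_fun setT (fun x => (f x)^-1).
Proof.
move=> mf; apply: (measurableT_comp (f := (@GRing.inv R)) _ mf).
rewrite -(setvU [set (0:R)]); apply/measurable_funU => //; first exact: measurableC.
split; last exact: measurable_fun_set1.
apply: open_continuous_measurable_fun; first by rewrite openC; exact: closed_eq.
by move=> x /set_mem/eqP x0; exact: inv_continuous.
Qed.

Lemma cmeasurableV g : cmeasurable g -> cmeasurable (fun x => (g x)^-1).
Proof.
move=> mg.
have -> : (fun x => (g x)^-1) = (fun x => ((normc (g x) ^+ 2)^-1)%:C * (g x)^*).
  apply/funext => x; have [->|g0] := eqVneq (g x) 0.
    by rewrite invr0 conjC0 mulr0.
  rewrite rmorphV ?unitfE ?expf_neq0 ?normc_eq0 //= -mulCJ invfM -mulrA.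
  by rewrite mulVf ?mulr1// conjC_eq0.
apply: cmeasurableM; last exact: cmeasurable_conj.
by apply/cmeasurable_real/measurable_invr/measurable_funX/measurable_normc.
Qed.

Lemma cmeasurable_patch (A : set X) g h : measurable A ->
  cmeasurable g -> cmeasurable h -> cmeasurable (fun x => if x \in A then g x else h x).
Proof.
have mA1 : measurable A -> measurable_fun setT (fun x : X => x \in A).
  move=> mA; apply: (measurable_fun_bool true); rewrite setTI.
  by rewrite (_ : _ @^-1` _ = A)//; apply/seteqP; split => x /= => [/set_mem//|Ax]; exact/mem_set.
move=> mA [g1 g2] [h1 h2]; split.
  under eq_fun do rewrite (fun_if (@complex.Re _)).
  by apply: measurable_fun_ifT => //; exact: mA1.
under eq_fun do rewrite (fun_if (@complex.Im _)).
by apply: measurable_fun_ifT => //; exact: mA1.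
Qed.

End ComplexMeasurable.

Lemma cmeasurable_comp (R : realType) d d' (X : measurableType d)
    (Y : measurableType d') (phi : X -> Y) (g : Y -> R[i]) :
  measurable_fun setT phi -> cmeasurable g -> cmeasurable (fun x => g (phi x)).
Proof.
move=> mphi [g1 g2]; split.
  exact: (measurableT_comp g1 mphi).
exact: (measurableT_comp g2 mphi).
 Qed.

Section ComplexIntegral.
Variable R : realType.
Context d (X : measurableType d) (m : {measure set X -> \bar R}).
Implicit Types (g h : X -> R[i]) (f : X -> R).

Definition rintegrable f := m.-integrable setT (EFin \o f).

Definition cintegrable g :=
  rintegrable (fun x => Re (g x)) /\ rintegrable (fun x => Im (g x)).

Definition cint g : R[i] := (\int[m]_x Re (g x)) +i* (\int[m]_x Im (g x)).

Lemma rintegrable_measurable f : rintegrable f -> measurable_fun setT f.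
Proof. by move=> /measurable_int/measurable_EFinP. Qed.

Lemma rintegrable_le f (b : X -> R) : measurable_fun setT f -> rintegrable b ->
  (forall x, `|f x| <= b x) -> rintegrable f.
Proof.
move=> mf ib fb; apply: (le_integrable measurableT _ _ ib).
  exact/measurable_EFinP.
by move=> x _ /=; rewrite lee_fin (le_trans (fb x))// ler_norm.
Qed.

Lemma rintegrableD f (b : X -> R) : rintegrable f -> rintegrable b ->
  rintegrable (fun x => f x + b x).
Proof. by move=> i1 i2; have := integrableD measurableT i1 i2. Qed.

Lemma rintegrableB f (b : X -> R) : rintegrable f -> rintegrable b ->
  rintegrable (fun x => f x - b x).
Proof. by move=> i1 i2; have := integrableB measurableT i1 i2. Qed.

Lemma rintegrableZ k f : rintegrable f -> rintegrable (fun x => k * f x).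
Proof. by move=> i1; have := integrableZl measurableT k i1. Qed.

Lemma rintegrableN f : rintegrable f -> rintegrable (fun x => - f x).
Proof. by move=> i1; have := integrableN i1. Qed.

Lemma cintegrable_measurable g : cintegrable g -> cmeasurable g.
Proof. by move=> [/rintegrable_measurable ? /rintegrable_measurable ?]. Qed.

Lemma cintegrable_le g (b : X -> R) : cmeasurable g -> rintegrable b ->
  (forall x, normc (g x) <= b x) -> cintegrable g.
Proof.
move=> [g1 g2] ib gb; split; apply: (rintegrable_le _ ib) => // x.
  exact: le_trans (normr_Re_le _) (gb x).
exact: le_trans (normr_Im_le _) (gb x).
Qed.

Lemma rintegrable_normc g : cintegrable g -> rintegrable (fun x => normc (g x)).
Proof.
move=> ig; have mg := cintegrable_measurable ig; case: ig => i1 i2.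
apply: (@rintegrable_le _ (fun x => `|Re (g x)| + `|Im (g x)|)).
- exact: measurable_normc.
- by apply: rintegrableD; [have := integrable_norm i1|have := integrable_norm i2].
- by move=> x; rewrite ger0_norm ?normc_ge0// normc_le_ReIm.
Qed.

Lemma cintegrableD g h : cintegrable g -> cintegrable h ->
  cintegrable (fun x => g x + h x).
Proof.
move=> [g1 g2] [h1 h2]; split.
  by under eq_fun do rewrite Re_addc; exact: rintegrableD.
by under eq_fun do rewrite Im_addc; exact: rintegrableD.
Qed.

Lemma cintegrableZ c g : cintegrable g -> cintegrable (fun x => c * g x).
Proof.
move=> [g1 g2]; split.
  by under eq_fun do rewrite Re_mulc; apply: rintegrableB; exact: rintegrableZ.
by under eq_fun do rewrite Im_mulc; apply: rintegrableD; exact: rintegrableZ.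
Qed.

Lemma cintegrable0 : cintegrable (fun=> 0).
Proof. by split; exact: integrable0. Qed.

Lemma cintegrable_sum I (s : seq I) (P : pred I) (F : I -> X -> R[i]) :
  (forall i, cintegrable (F i)) -> cintegrable (fun x => \sum_(i <- s | P i) F i x).
Proof.
move=> iF; elim: s => [|i s IH].
  by under eq_fun do rewrite big_nil; exact: cintegrable0.
by under eq_fun do rewrite big_cons; case: (P i) => //; exact: cintegrableD.
Qed.

Lemma eq_cint g h : g =1 h -> cint g = cint h.
Proof. by move=> /funext ->. Qed.

Lemma cint0 : cint (fun=> 0) = 0.
Proof. by rewrite /cint /Rintegral /= integral0. Qed.

Lemma cintD g h : cintegrable g -> cintegrable h ->
  cint (fun x => g x + h x) = cint g + cint h.
Proof.
move=> [g1 g2] [h1 h2]; rewrite /cint; apply/eqP; rewrite eq_complex /=.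
under eq_Rintegral do rewrite Re_addc.
under [in X in _ && X]eq_Rintegral do rewrite Im_addc.
by rewrite !RintegralD ?eqxx.
Qed.

Lemma cintZ c g : cintegrable g -> cint (fun x => c * g x) = c * cint g.
Proof.
move=> [g1 g2]; rewrite /cint; apply/eqP; rewrite eq_complex Re_mulc Im_mulc /=.
under eq_Rintegral do rewrite Re_mulc.
under [in X in _ && X]eq_Rintegral do rewrite Im_mulc.
rewrite RintegralB//; [|exact: rintegrableZ|exact: rintegrableZ].
rewrite RintegralD//; [|exact: rintegrableZ|exact: rintegrableZ].
by rewrite !RintegralZl// !eqxx.
Qed.

Lemma cintN g : cintegrable g -> cint (fun x => - g x) = - cint g.
Proof.
by move=> ig; rewrite -mulN1r -cintZ//; apply: eq_cint => x; rewrite mulN1r.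
Qed.

Lemma cintegrableN g : cintegrable g -> cintegrable (fun x => - g x).
Proof.
by move=> /(cintegrableZ (-1)); under eq_fun do rewrite mulN1r.
Qed.

Lemma cintegrableB g h : cintegrable g -> cintegrable h ->
  cintegrable (fun x => g x - h x).
Proof. by move=> ig ih; apply: cintegrableD => //; exact: cintegrableN. Qed.

Lemma cintB g h : cintegrable g -> cintegrable h ->
  cint (fun x => g x - h x) = cint g - cint h.
Proof. by move=> ig ih; rewrite cintD ?cintN//; exact: cintegrableN. Qed.

Lemma cint_sum I (s : seq I) (P : pred I) (F : I -> X -> R[i]) :
  (forall i, cintegrable (F i)) ->
  cint (fun x => \sum_(i <- s | P i) F i x) = \sum_(i <- s | P i) cint (F i).
Proof.
move=> iF; elim: s => [|i s IH].
  by under eq_cint do rewrite big_nil; rewrite big_nil cint0.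
under eq_cint do rewrite big_cons; rewrite big_cons.
by case: (P i) => //; rewrite cintD ?IH//; exact: cintegrable_sum.
Qed.

Lemma cint_conj g : cintegrable g -> cint (fun x => (g x)^*) = (cint g)^*.
Proof.
move=> [g1 g2]; rewrite /cint; apply/eqP; rewrite eq_complex Re_conjc Im_conjc /=.
under eq_Rintegral do rewrite Re_conjc.
under [in X in _ && X]eq_Rintegral do rewrite Im_conjc -mulN1r.
by rewrite RintegralZl// mulN1r !eqxx.
Qed.

(** The constant 2 comes from bounding real and imaginary parts separately. *)
Lemma normc_cint_le g (b : X -> R) : cintegrable g -> rintegrable b ->
  (forall x, normc (g x) <= b x) -> normc (cint g) <= 2 * \int[m]_x b x.
Proof.
move=> [g1 g2] ib gb; rewrite (le_trans (normc_le_ReIm _))//= mulr_natl mulr2n.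
have aux f : rintegrable f -> (forall x, `|f x| <= b x) ->
    `|\int[m]_x f x| <= \int[m]_x b x.
  move=> fi fb; rewrite (le_trans (le_normr_Rintegral _ fi))// le_Rintegral//.
  by have := integrable_norm fi.
apply: lerD; apply: aux => // x; apply: le_trans (gb x).
  exact: normr_Re_le.
exact: normr_Im_le.
Qed.

Lemma cint_ae_eq (N : set X) g h : measurable N -> m N = 0%E ->
  cmeasurable g -> cmeasurable h -> (forall x, ~ N x -> g x = h x) ->
  cint g = cint h.
Proof.
move=> mN N0 [g1 g2] [h1 h2] gh.
have aux (f k : X -> R) : measurable_fun setT f -> measurable_fun setT k ->
    (forall x, ~ N x -> f x = k x) -> \int[m]_x f x = \int[m]_x k x.
  move=> mf mk fk; congr fine; apply: ae_eq_integral => //.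
  - exact/measurable_EFinP.
  - exact/measurable_EFinP.
  - exists N; split => // x /=; apply: contra_notP => Nx _ /=.
    by rewrite fk.
by rewrite /cint; congr Complex; apply: aux => // x Nx; rewrite gh.
Qed.

Lemma cintegrable_ae_eq (N : set X) g h : measurable N -> m N = 0%E ->
  cintegrable g -> cmeasurable h -> (forall x, ~ N x -> g x = h x) ->
  cintegrable h.
Proof.
move=> mN N0 [g1 g2] [h1 h2] gh.
have aux (f k : X -> R) : rintegrable f -> measurable_fun setT k ->
    (forall x, ~ N x -> f x = k x) -> rintegrable k.
  move=> /integrableP[mf fi] mk fk; apply/integrableP; split; first exact/measurable_EFinP.
  move: fi; congr (_ < _)%E; apply: ae_eq_integral => //.
  - exact: (measurableT_comp (@abse_measurable R setT) mf).
  - by apply: (measurableT_comp (@abse_measurable R setT)); exact/measurable_EFinP.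
  - exists N; split => // x /=; apply: contra_notP => Nx _ /=.
    by rewrite fk.
by split; apply: aux; [exact: g1| |move=> x /gh ->|exact: g2| |move=> x /gh ->].
Qed.

Lemma cint_dominated_cvg (G : nat -> X -> R[i]) g (b : X -> R) :
  (forall n, cmeasurable (G n)) -> cmeasurable g -> rintegrable b ->
  (forall n x, normc (G n x) <= b x) ->
  (forall x, (fun n => normc (G n x - g x)) @ \oo --> (0:R)) ->
  (fun n => normc (cint (G n) - cint g)) @ \oo --> (0:R).
Proof.
move=> mG mg ib Gb Gg.
have gb x : normc (g x) <= b x.
  apply/ler_addgt0Pr => e e0.
  have /cvgr0_norm_lt/(_ _ e0)[N _ /(_ N (leqnn N))] := Gg x.
  rewrite ger0_norm ?normc_ge0// => /ltW h.
  rewrite -(subKr (G N x) (g x)) (le_trans (normcB _ _))// lerD//.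
have aux (F : nat -> X -> R) f : (forall n, measurable_fun setT (F n)) ->
    measurable_fun setT f -> (forall n x, `|F n x| <= b x) ->
    (forall n x, `|F n x - f x| <= normc (G n x - g x)) ->
    (fun n => \int[m]_x F n x) @ \oo --> \int[m]_x f x.
  move=> mF mf Fb Ff.
  have [] := @dominated_convergence _ _ _ m setT measurableT
    (fun n => EFin \o F n) (EFin \o f) (EFin \o b).
  - by move=> n; exact/measurable_EFinP.
  - exact/measurable_EFinP.
  - apply: aeW => x _; apply: cvg_EFin; first exact: nearW.
    apply/subr_cvg0/cvgr0Pnorm_lt => e e0.
    have /cvgr0_norm_lt/(_ _ e0) := Gg x; apply: filterS => n /=.
    by rewrite [X in X < _ -> _]ger0_norm ?normc_ge0//; exact: le_lt_trans.
  - exact: ib.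
  - by apply: aeW => x n _ /=; rewrite lee_fin.
  move=> fi _ cv.
  have fE : (\int[m]_x (EFin \o f) x = (\int[m]_x f x)%:E)%E.
    by rewrite fineK//; exact: integrable_fin_num.
  by move: cv; rewrite fE => /fine_cvg.
have h1 : (fun n => \int[m]_x Re (G n x)) @ \oo --> \int[m]_x Re (g x).
  apply: aux; [by move=> n; case: (mG n)|by case: mg| |].
    by move=> n x; exact: le_trans (normr_Re_le _) (Gb n x).
  by move=> n x; rewrite -Re_oppc -Re_addc normr_Re_le.
have h2 : (fun n => \int[m]_x Im (G n x)) @ \oo --> \int[m]_x Im (g x).
  apply: aux; [by move=> n; case: (mG n)|by case: mg| |].
    by move=> n x; exact: le_trans (normr_Im_le _) (Gb n x).
  by move=> n x; rewrite -Im_oppc -Im_addc normr_Im_le.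
apply: (@squeeze_cvgr _ _ _ _ (fun=> 0)
  (fun n => `|\int[m]_x Re (G n x) - \int[m]_x Re (g x)| +
            `|\int[m]_x Im (G n x) - \int[m]_x Im (g x)|)).
- by apply: nearW => n; rewrite normc_ge0; exact: (normc_le_ReIm (cint (G n) - cint g)).
- exact: cvg_cst.
- rewrite -[X in _ --> X](addr0 (0:R)); apply: cvgD.
    by rewrite -(normr0 R); apply: cvg_norm; exact/subr_cvg0.
  by rewrite -(normr0 R); apply: cvg_norm; exact/subr_cvg0.
Qed.

End ComplexIntegral.

Section ComplexFubini.
Variable R : realType.
Context d1 d2 (X : measurableType d1) (Y : measurableType d2).
Variables (m1 : {sigma_finite_measure set X -> \bar R})
  (m2 : {sigma_finite_measure set Y -> \bar R}).

Let Rfubini (f : X * Y -> R) : rintegrable (m1 \x m2)%E f ->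
  [/\ measurable_fun setT (fun x => \int[m2]_y f (x, y)),
      rintegrable m2 (fun y => \int[m1]_x f (x, y)) &
   \int[m1]_x \int[m2]_y f (x, y) = \int[m2]_y \int[m1]_x f (x, y)].
Proof.
move=> fi.
have mF := measurable_fubini_F fi; have mG := measurable_fubini_G fi.
have mF' : measurable_fun setT (fun x => \int[m2]_y f (x, y)).
  exact: (measurableT_comp (fine_measurable measurableT) mF).
have mG' : measurable_fun setT (fun y => \int[m1]_x f (x, y)).
  exact: (measurableT_comp (fine_measurable measurableT) mG).
have iF := integrable_fubini_F fi.
have iG : m2.-integrable setT (fubini_G m1 (EFin \o f)).
  have mf := measurable_int _ fi.
  have maf : measurable_fun setT (abse \o (EFin \o f)) by exact: measurableT_comp.
  apply/integrableP; split => //; have := (integrable21ltyP m1 m2 mf).1 fi.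
  apply: le_lt_trans; apply: ge0_le_integral => //.
  - exact: measurableT_comp.
  - by apply: (measurable_fun_fubini_tonelli_G (abse \o (EFin \o f))) => //= x.
  - move=> y _; apply: le_abse_integral => //.
    exact: (measurableT_comp mf (pair2_measurable y)).
split => //.
  apply/integrableP; split; first exact/measurable_EFinP.
  have /integrableP[_] := iG; apply: le_lt_trans; apply: ge0_le_integral => //.
  - by apply: (measurableT_comp (@abse_measurable R setT)); exact/measurable_EFinP.
  - by apply: (measurableT_comp (@abse_measurable R setT)).
  by move=> y _ /=; rewrite -/(fubini_G m1 (EFin \o f) y) /Rintegral /=;
    rewrite -/(fubini_G m1 (EFin \o f) y); case: (fubini_G _ _ y); rewrite ?leey.
congr fine; transitivity (\int[m1]_x fubini_F m2 (EFin \o f) x)%E.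
  apply: ae_eq_integral => //; first exact/measurable_EFinP.
  have := integrable_ae measurableT iF; apply: filterS => x /= + _.
  by move=> /(_ I) ?; rewrite fineK.
transitivity (\int[m2]_x fubini_G m1 (EFin \o f) x)%E; last first.
  apply/esym; apply: ae_eq_integral => //; first exact/measurable_EFinP.
  have := integrable_ae measurableT iG; apply: filterS => x /= + _.
  by move=> /(_ I) ?; rewrite fineK.
exact: Fubini.
Qed.

Lemma cint_fubini (g : X * Y -> R[i]) : cintegrable (m1 \x m2)%E g ->
  [/\ cmeasurable (fun x => cint m2 (fun y => g (x, y))),
      cintegrable m2 (fun y => cint m1 (fun x => g (x, y))) &
  cint m1 (fun x => cint m2 (fun y => g (x, y))) =
  cint m2 (fun y => cint m1 (fun x => g (x, y)))].
Proof.
by move=> [/Rfubini[a1 b1 c1] /Rfubini[a2 b2 c2]]; split=> //; rewrite /cint c1 c2.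
Qed.

End ComplexFubini.

(** * Plane Lebesgue measure: translations, rotations and polar integration *)

Section RealLine.
Variable R : realType.
Local Notation mu := (@lebesgue_measure R).

Lemma FTC2_closed (f F : R -> R) (a b : R) : a < b ->
  {in `[a, b], forall x, {for x, continuous f}} ->
  {in `[a, b], forall x, is_derive x (1 : R) F (f x)} ->
  (\int[mu]_(x in `[a, b]) (f x)%:E = (F b - F a)%:E)%E.
Proof.
move=> ab cf dF; rewrite EFinB.
have Fc x : x \in `[a, b] -> {for x, continuous F}.
  move=> xab; have [dx _] := dF _ xab.
  exact/differentiable_continuous/derivable1_diffP.
apply: continuous_FTC2 => //.
- by apply: continuous_in_subspaceT => x /set_mem/=; exact: cf.
- split.
  + by move=> x /subset_itv_oo_cc/dF[].
  + by apply: cvg_at_right_filter; apply: Fc; rewrite in_itv /= lexx ltW.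
  + by apply: cvg_at_left_filter; apply: Fc; rewrite in_itv /= lexx ltW.
- by move=> x /subset_itv_oo_cc/dF dx; rewrite derive1E; case: dx.
Qed.

Lemma lebesgue_measure_translation (c : R) (A : set R) : measurable A ->
  mu ((fun x => x + c) @^-1` A) = mu A.
Proof.
move=> mA; have ms : measurable_fun setT (fun x : R => x + c : measurableTypeR R).
  by apply: measurable_funD => //; exact: measurable_cst.
change (pushforward mu (fun x => x + c : measurableTypeR R) A = mu A).
apply/esym/lebesgue_measure_unique => //= _ [[a b]] _ <-.
rewrite /pushforward (_ : _ @^-1` _ = `]a - c, b - c]%classic).
  by rewrite !lebesgue_measure_itv/= !lte_fin ltrD2r -!EFinB opprB addrA subrK.
by apply/seteqP; split => x /=; rewrite !in_itv /= ltrBlDr lerBrDr.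
Qed.

End RealLine.

Section Plane.
Variable R : realType.
Local Notation mu := (@lebesgue_measure R).
Local Notation TR := (measurableTypeR R).
Local Notation RR := (TR * TR)%type.

Definition plane : set RR -> \bar R := (mu \x mu)%E.

HB.instance Definition _ := Measure.copy plane (mu \x mu)%E.

Lemma plane_sigma_finite : sigma_finite setT plane.
Proof.
have /sigma_finiteP[F [TF ndF Foo]] := sigma_finiteT mu.
exists (fun n => F n `*` F n).
  rewrite predeqE => -[x y]; split => // _.
  have : setT x by []. have : setT y by [].
  rewrite TF => -[k _ Gky] [n _ Fnx]; exists (maxn n k) => //; split.
    by move: Fnx; apply/subsetPset/ndF/leq_maxl.
  by move: Gky; apply/subsetPset/ndF/leq_maxr.
move=> k; have [? ?] := Foo k; split; first exact: measurableX.
by rewrite /plane product_measure1E// lte_mul_pinfty// ge0_fin_numE.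
Qed.

HB.instance Definition _ :=
  Measure_isSigmaFinite.Build _ _ _ plane plane_sigma_finite.

Definition toC (p : RR) : R[i] := p.1 +i* p.2.
Definition ofC (z : R[i]) : RR := (Re z, Im z).

Lemma cmeasurable_toC : cmeasurable toC.
Proof. by split => /=; [exact: measurable_fst|exact: measurable_snd]. Qed.

Definition preserves (phi : RR -> RR) :=
  measurable_fun setT phi /\
  forall A, measurable A -> plane (phi @^-1` A) = plane A.

Lemma preserves_comp (phi psi : RR -> RR) :
  preserves phi -> preserves psi -> preserves (phi \o psi).
Proof.
move=> [m1 p1] [m2 p2]; split; first exact: measurableT_comp.
move=> A mA; rewrite comp_preimage p2 ?p1//.
by rewrite -[X in measurable X]setTI; exact: m1.
Qed.

Lemma preserves_shear (g : R -> R) : measurable_fun setT g ->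
  preserves (fun p => (p.1, p.2 + g p.1)).
Proof.
move=> mg.
have mphi : measurable_fun setT (fun p : RR => (p.1, p.2 + g p.1) : RR).
  apply: measurable_fun_pair => //=.
  apply: measurable_funD; first exact: measurable_snd.
  exact: (measurableT_comp mg measurable_fst).
split => // A mA; apply: eq_integral => x _ /=.
rewrite (_ : xsection _ x = (fun y => y + g x) @^-1` xsection A x).
  by rewrite lebesgue_measure_translation//; exact: measurable_xsection.
by apply/seteqP; split => y /=; rewrite /xsection /= !inE.
Qed.

Lemma preserves_swap : preserves (fun p => (p.2, p.1)).
Proof.
have mphi : measurable_fun [set: TR * TR] (fun p : TR * TR => (p.2, p.1)).
  by apply: measurable_fun_pair; [exact: measurable_snd|exact: measurable_fst].
split=> // A mA; apply/esym.
pose nu := measure_function_pushforward__canonical__measure_function_Measure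
  plane mphi.
have U := @product_measure_unique _ _ _ _ _ mu mu nu.
transitivity (nu A); last by [].
apply: U => [B C mB mC|//].
rewrite /nu /= /pushforward (_ : _ @^-1` _ = C `*` B).
  by rewrite /plane product_measure1E// muleC.
by apply/seteqP; split => -[x y] /=; rewrite /setX /= => -[].
Qed.


Lemma preserves_translation (c : RR) : preserves (fun p => (p.1 + c.1, p.2 + c.2)).
Proof.
have h1 := preserves_shear (measurable_cst c.2).
have h2 := preserves_shear (measurable_cst c.1).
exact: preserves_comp preserves_swap (preserves_comp h2 (preserves_comp preserves_swap h1)).
Qed.

(** A rotation other than the half turn is a product of three shears. *)
Lemma preserves_rotation (u : R[i]) : normc u = 1 -> Re u != - 1 ->
  preserves (fun p => ofC (u * toC p)).
Proof.
case: u => c s /(congr1 (fun x => x ^+ 2)); rewrite normc_sqr expr1n /= => cs cN1.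
have c1 : 1 + c != 0 by rewrite addrC addr_eq0.
pose t := s / (1 + c).
have mt (k : R) : measurable_fun setT (fun x : R => k * x).
  exact: mulrl_measurable.
have h1 := preserves_shear (mt (- t)).
have h2 := preserves_shear (mt s).
have h1' := preserves_comp preserves_swap (preserves_comp h1 preserves_swap).
have := preserves_comp h1' (preserves_comp h2 h1').
set phi := (X in preserves X -> _); set psi := (X in _ -> preserves X).
suff -> : phi = psi by [].
have ts : t * s = 1 - c.
  rewrite /t mulrAC -expr2; apply: (mulIf c1); rewrite divfK//.
  by rewrite (_ : s ^+ 2 = 1 - c ^+ 2); [ring|rewrite -cs; ring].
have tc : t * (1 + c) = s by rewrite divfK.
apply/funext => -[x y]; rewrite /phi /psi /ofC /toC /=; congr pair.
  transitivity (x * (1 - t * s) - y * (t + t * (1 - t * s))); first by ring.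
  by rewrite ts subKr -tc; ring.
transitivity (s * x + y * (1 - t * s)); first by ring.
by rewrite ts subKr; ring.
Qed.

Lemma preserves_integral (phi : RR -> RR) (f : RR -> \bar R) : preserves phi ->
  measurable_fun setT f -> (forall p, 0 <= f p)%E ->
  (\int[plane]_p f (phi p) = \int[plane]_p f p)%E.
Proof.
move=> [mphi pphi] mf f0.
have := ge0_integral_pushforward mphi plane measurableT mf (fun p _ => f0 p).
rewrite preimage_setT => <-.
by apply: eq_measure_integral => //= A mA _; exact: pphi.
Qed.

Lemma preserves_rintegrable (phi : RR -> RR) (f : RR -> R) : preserves phi ->
  rintegrable plane f -> rintegrable plane (fun p => f (phi p)) /\
  \int[plane]_p f (phi p) = \int[plane]_p f p.
Proof.
move=> pphi fi; have mf := measurable_int _ fi; have [mphi _] := pphi.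
have ifp : rintegrable plane (fun p => f (phi p)).
  apply/integrableP; split; first exact: measurableT_comp mf mphi.
  have := preserves_integral pphi (measurableT_comp (@abse_measurable R setT) mf)
    (fun p => abse_ge0 _).
  by move=> /= ->; case/integrableP : fi.
split=> //; congr fine.
have := @integral_pushforward _ _ _ _ _ _ mphi plane setT (EFin \o f) mf.
rewrite preimage_setT => /(_ ifp measurableT) <-.
by apply: eq_measure_integral => //= A mA _; case: pphi => _; exact.
Qed.

Lemma cint_preserves (phi : RR -> RR) (g : RR -> R[i]) : preserves phi ->
  cintegrable plane g -> cintegrable plane (fun p => g (phi p)) /\
  cint plane (fun p => g (phi p)) = cint plane g.
Proof.
move=> pphi [g1 g2].
have [i1 e1] := preserves_rintegrable pphi g1.
have [i2 e2] := preserves_rintegrable pphi g2.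
by split => //; rewrite /cint e1 e2.
Qed.

End Plane.

Section PolarIntegration.
Variable R : realType.
Local Notation mu := (@lebesgue_measure R).
Local Notation TR := (measurableTypeR R).
Local Notation RR := (TR * TR)%type.
Local Notation plane := (@plane R).

Definition sqmod (p : RR) : TR := p.1 ^+ 2 + p.2 ^+ 2 :> R.

Lemma measurable_sqmod : measurable_fun setT sqmod.
Proof.
by apply: measurable_funD; apply: measurable_funX;
  [exact: measurable_fst|exact: measurable_snd].
Qed.

Lemma sqmod_ge0 p : 0 <= sqmod p :> R.
Proof. by rewrite /sqmod addr_ge0 ?sqr_ge0. Qed.

Lemma integral_half_chord (t : R) : 0 < t ->
  (\int[mu]_(x in `[(- Num.sqrt t)%R, Num.sqrt t])
     (2 * Num.sqrt (t - x ^+ 2))%:E = (pi * t)%:E)%E.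
Proof.
move=> t0; pose rho : R := Num.sqrt t.
have rho0 : 0 < rho by rewrite sqrtr_gt0.
have rho2 : rho ^+ 2 = t by rewrite sqr_sqrtr // ltW.
have pi2 : - (pi / 2) < pi / 2 :> R by rewrite -subr_gt0 opprK addr_gt0 ?divr_gt0 ?pi_gt0.
pose F (x : R) : R := rho * sin x.
have dF x : is_derive x (1:R) F (rho * cos x).
  by apply: is_deriveZ.
have F'E : (derive1 F) = (fun x => rho * cos x).
  by apply/funext => x; rewrite derive1E; case: (dF x).
have cF' : continuous (derive1 F).
  rewrite F'E => x; apply: cvgM; first exact: cvg_cst.
  exact: continuous_cos.
have cF : continuous F.
  by move=> x; apply: cvgM; [exact: cvg_cst|exact: continuous_sin].
have := @integration_by_substitution_increasing R F
  (fun x => 2 * Num.sqrt (t - x ^+ 2)) (- (pi / 2)) (pi / 2) (ltW pi2).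
have -> : F (pi / 2) = rho by rewrite /F sin_pihalf mulr1.
have -> : F (- (pi / 2)) = - rho by rewrite /F sinN sin_pihalf mulrN mulr1.
move=> ->.
- transitivity (\int[mu]_(x in `[(- (pi / 2))%R, (pi / 2)%R]) (2 * t * cos x ^+ 2)%:E)%E.
    apply: eq_integral => x /set_mem/=; rewrite in_itv /= => xpi.
    rewrite F'E /= /F; congr EFin.
    transitivity (2 * Num.sqrt (t - (rho * sin x) ^+ 2) * (rho * cos x)) => //.
    rewrite exprMn rho2 -{1}(mulr1 t) -mulrBr -(cos2Dsin2 x) addrK.
    rewrite sqrtrM ?(ltW t0)// sqrtr_sqr ger0_norm ?cos_ge0_pihalf// -/rho.
    by rewrite -[in RHS]rho2; ring.
  pose H (x : R) : R := t * (x + sin x * cos x).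
  have dH x : is_derive x (1:R) H (2 * t * cos x ^+ 2).
    apply: is_derive_eq.
    rewrite /GRing.scale /= [X in X + (_ + _)](_ : _ = cos x ^+ 2 + sin x ^+ 2).
      by ring.
    by rewrite cos2Dsin2.
  have cH x : {for x, continuous (fun x : R => 2 * t * cos x ^+ 2)}.
    apply: cvgM; first exact: cvg_cst.
    apply: (@cvg_comp _ _ _ _ (fun y : R => y ^+ 2)); last exact: exprn_continuous.
    exact: continuous_cos.
  rewrite (FTC2_closed pi2 (fun x _ => cH x) (fun x _ => dH x)).
  by rewrite /H sinN cosN cos_pihalf !mulr0 !addr0; congr EFin; field.
- by move=> x y xi yi xy; rewrite /F ltr_pM2l// ltr_sin.
- by move=> x _; exact: cF'.
- by apply/cvg_ex; eexists; apply: cvg_at_right_filter; exact: cF'.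
- by apply/cvg_ex; eexists; apply: cvg_at_left_filter; exact: cF'.
- split.
  + by move=> x _; have [] := dF x.
  + by apply: cvg_at_right_filter; exact: cF.
  + by apply: cvg_at_left_filter; exact: cF.
- apply: continuous_subspaceT => x; apply: cvgM; first exact: cvg_cst.
  apply: (@cvg_comp _ _ _ _ (@Num.sqrt R)); last exact: sqrt_continuous.
  by apply: cvgB; [exact: cvg_cst|exact: exprn_continuous].
Qed.

Lemma measure_disk_sqmod (t : R) :
  plane [set p | sqmod p <= t] = (pi * Num.max t 0)%:E.
Proof.
rewrite (_ : plane _ = \int[mu]_x (2 * Num.sqrt (t - x ^+ 2))%:E)%E; last first.
  apply: eq_integral => x _ /=.
  have [tx|tx] := ltP t (x ^+ 2).
    rewrite ler0_sqrtr ?subr_le0 ?ltW// mulr0.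
    rewrite (_ : xsection _ x = set0) ?measure0//.
    apply/seteqP; split => // y; rewrite /xsection /= inE /sqmod /=.
    by rewrite leNgt (lt_le_trans tx)// lerDl sqr_ge0.
  pose s := Num.sqrt (t - x ^+ 2).
  have s2 : s ^+ 2 = t - x ^+ 2 by rewrite sqr_sqrtr// subr_ge0.
  rewrite (_ : xsection _ x = `[- s, s]%classic).
    rewrite lebesgue_measure_itv /= lte_fin -/s.
    have := sqrtr_ge0 (t - x ^+ 2); rewrite -/s le_eqVlt => /predU1P[<-|s0].
      by rewrite oppr0 ltxx mulr0.
    by rewrite gtrN// -EFinB opprK mulr_natl mulr2n.
  apply/seteqP; split => y; rewrite /xsection /= inE /sqmod /= in_itv /= -ler_norml -lerBrDl -s2.
    by rewrite -[`|y| <= s]ler_sqr ?nnegrE// ?sqrtr_ge0// real_normK ?num_real.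
  by rewrite -[`|y| <= s]ler_sqr ?nnegrE// ?sqrtr_ge0// real_normK ?num_real.
have [t0|t0] := leP t 0.
  rewrite integral0_eq ?mulr0// => x _; rewrite ler0_sqrtr ?mulr0//.
  by rewrite subr_le0 (le_trans t0)// sqr_ge0.
rewrite -integral_half_chord// [RHS]integral_mkcond; apply: eq_integral => x _.
rewrite patchE; case: ifPn => //; rewrite notin_setE /= in_itv /= -ler_norml => /negP.
rewrite -ltNge => h; rewrite ler0_sqrtr ?mulr0// subr_le0 -(sqr_sqrtr (ltW t0)).
by rewrite -(real_normK (num_real x)) ler_sqr ?nnegrE ?sqrtr_ge0// ltW.
Qed.


Lemma measure_annulus_sqmod (a b : R) : a <= b ->
  plane (sqmod @^-1` `]a, b]) = (pi * (Num.max b 0 - Num.max a 0))%:E.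
Proof.
move=> ab; rewrite (_ : _ @^-1` _ = [set p | sqmod p <= b] `\` [set p | sqmod p <= a]).
  have m1 (t : R) : measurable [set p | sqmod p <= t].
    have -> : [set p | sqmod p <= t] = sqmod @^-1` `]-oo, t].
      by apply/seteqP; split => p /=; rewrite in_itv.
    by rewrite -[X in measurable X]setTI; apply: measurable_sqmod.
  rewrite measureD//; last by rewrite [X in (X < _)%E]measure_disk_sqmod ltry.
  rewrite setIidr; last by move=> p /= /le_trans; apply.
  by rewrite [X in (X - _)%E]measure_disk_sqmod [X in (_ - X)%E]measure_disk_sqmod mulrBr.
apply/seteqP; split => p /=; rewrite in_itv /=.
  by move=> /andP[h ->]; split => //; apply/negP; rewrite -ltNge.
by move=> [-> /negP]; rewrite -ltNge => ->.
Qed.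

(** Push-forward of plane measure by the squared modulus.  Adding Lebesgue
    measure on the negative half-line turns this into an identity between measures
    on the whole line, where they are determined by intervals. *)
Lemma pushforward_sqmod (A : set TR) : measurable A -> A `<=` `[0, +oo[ ->
  plane (sqmod @^-1` A) = (pi%:E * mu A)%E.
Proof.
move=> mA A0.
have ppi : 0 <= (pi : R)^-1 by rewrite invr_ge0 pi_ge0.
pose nu1 := mscale (NngNum ppi)
  (measure_function_pushforward__canonical__measure_function_Measure plane measurable_sqmod).
pose nu2 := mrestr mu (measurable_itv `]-oo, (0:R)[).
have : mu A = measure_add nu1 nu2 A.
  apply: lebesgue_measure_unique mA => _ [[a b]] _ <-.
  rewrite -[RHS]/(measure_add nu1 nu2 _) measure_addE.
  change (mu `]a, b] = (pi^-1%:E * plane (sqmod @^-1` `]a, b]) +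
    mu (`]a, b] `&` `]-oo, 0%R[))%E).
  have [ba|ab] := leP b a.
    by rewrite set_itv_ge -?leNgt// preimage_set0 set0I !measure0 mule0 add0e.
  rewrite measure_annulus_sqmod ?ltW// -EFinM mulKf ?gt_eqF ?pi_gt0//.
  rewrite lebesgue_measure_itv /= lte_fin ab.
  have [b0|b0] := ltP b 0.
    rewrite setIidl; last first.
      by move=> x /=; rewrite !in_itv /= => /andP[_ xb]; exact: le_lt_trans xb b0.
    rewrite lebesgue_measure_itv /= lte_fin ab.
    by rewrite (max_r (ltW (lt_trans ab b0))) subr0 add0e -EFinB.
  rewrite (_ : _ `&` _ = `]a, 0[%classic); last first.
    apply/seteqP; split => x /=; rewrite !in_itv /=.
      by move=> [/andP[-> _] ->].
    by move=> /andP[-> x0]; rewrite x0 (le_trans (ltW x0)).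
  rewrite lebesgue_measure_itv /= lte_fin; case: ltP => a0.
    by rewrite -!EFinB -EFinD; congr EFin; ring.
  by rewrite adde0 EFinB.
rewrite measure_addE.
change (mu A = (pi^-1%:E * plane (sqmod @^-1` A) +
    mu (A `&` `]-oo, 0%R[))%E -> plane (sqmod @^-1` A) = (pi%:E * mu A)%E).
rewrite (_ : A `&` _ = set0) ?measure0 ?adde0; last first.
  by apply/seteqP; split => // x [/A0] /=; rewrite !in_itv /= andbT => x0; rewrite ltNge x0.
by move=> ->; rewrite muleA -EFinM divff ?mul1e// gt_eqF// pi_gt0.
Qed.

(** Polar coordinates for radial functions, with the squared radius as variable. *)
Lemma integral_radial (E : set TR) (f : R -> R) : measurable E ->
  E `<=` `[0, +oo[ -> measurable_fun setT f -> (forall t, E t -> 0 <= f t) ->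
  (\int[plane]_(p in sqmod @^-1` E) (f (sqmod p))%:E =
   pi%:E * \int[mu]_(t in E) (f t)%:E)%E.
Proof.
move=> mE E0 mf f0.
pose nu := measure_function_pushforward__canonical__measure_function_Measure
  plane measurable_sqmod.
pose nu1 := mscale (NngNum (pi_ge0 R)) mu.
have mfE : measurable_fun E (EFin \o f).
  by apply/measurable_EFinP; exact: measurable_funTS.
have := @ge0_integral_pushforward _ _ _ _ _ sqmod measurable_sqmod plane
  E (EFin \o f) mE mfE.
move=> <-; last by move=> t /set_mem; rewrite lee_fin; exact: f0.
have -> : (\int[pushforward plane sqmod]_(y in E) (EFin \o f) y =
    \int[nu1]_(t in E) (f t)%:E)%E.
  apply: (@eq_measure_integral _ _ _ _ nu1 nu) => A mA AE.
  by apply: pushforward_sqmod => // x /AE /E0.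
by rewrite ge0_integral_mscale//= => t tab; rewrite lee_fin f0.
Qed.

End PolarIntegration.

(** * Radial integrals and integrability of the singularities *)

Section PowerIntegrals.
Variable R : realType.
Local Notation mu := (@lebesgue_measure R).

Lemma is_derive_expn (t : R) n :
  is_derive t (1:R) (fun t : R => t ^+ n.+1) (n.+1%:R * t ^+ n).
Proof.
have -> : (fun t : R => t ^+ n.+1) = (@id R) ^+ n.+1.
  by apply/funext => x; rewrite exprfctE.
have := is_deriveX n.+1 (is_derive_id t (1 : R)).
by rewrite /GRing.scale /= mulr1.
Qed.

Lemma integral_expn (a b : R) n : a < b ->
  (\int[mu]_(t in `[a, b]) (t ^+ n)%:E =
   ((b ^+ n.+1 - a ^+ n.+1) / n.+1%:R)%:E)%E.
Proof.
move=> ab; pose F (t : R) : R := n.+1%:R^-1 * t ^+ n.+1.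
have dF t : is_derive t (1:R) F (t ^+ n).
  have := is_deriveZ n.+1%:R^-1 (is_derive_expn t n).
  by rewrite /GRing.scale /= mulrA mulVf ?mul1r// pnatr_eq0.
have cF t : {for t, continuous (fun t : R => t ^+ n)} by exact: exprn_continuous.
rewrite (FTC2_closed ab (fun x _ => cF x) (fun x _ => dF x)).
by rewrite /F -mulrBr mulrC.
Qed.

Lemma integral_inv (a b : R) : 0 < a -> a < b ->
  (\int[mu]_(t in `[a, b]) (t ^- 1)%:E = (ln b - ln a)%:E)%E.
Proof.
move=> a0 ab.
have pos t : t \in `[a, b] -> 0 < t by rewrite in_itv /= => /andP[/(lt_le_trans a0)].
rewrite (FTC2_closed (F := @ln R) ab)// => t /pos t0.
  by apply: inv_continuous; rewrite gt_eqF.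
by rewrite expr1; exact: is_derive1_ln.
Qed.

Lemma integral_invn (a b : R) n : 0 < a -> a < b ->
  (\int[mu]_(t in `[a, b]) (t ^- n.+2)%:E =
   ((a ^- n.+1 - b ^- n.+1) / n.+1%:R)%:E)%E.
Proof.
move=> a0 ab.
have pos t : t \in `[a, b] -> t != 0.
  by rewrite in_itv /= => /andP[/(lt_le_trans a0) t0 _]; rewrite gt_eqF.
pose F (t : R) : R := - n.+1%:R^-1 * (t ^- n.+1).
have dF t : t != 0 -> is_derive t (1:R) F (t ^- n.+2).
  move=> t0; have tn0 : t ^+ n.+1 != 0 by rewrite expf_neq0.
  have dV := is_deriveV (f := fun t : R => t ^+ n.+1) tn0 (is_derive_expn t n).
  have := is_deriveZ (- n.+1%:R^-1) dV.
  rewrite /GRing.scale /= => /is_derive_eq; apply; rewrite !exprS.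
  by field; rewrite expf_neq0 // t0 /= nat1r pnatr_eq0.
have cF t : t \in `[a, b] -> {for t, continuous (fun t : R => t ^- n.+2)}.
  move=> /pos t0; apply: (@cvg_comp _ _ _ _ (@GRing.inv R)) => /=.
    exact: exprn_continuous.
  by apply: inv_continuous; rewrite expf_neq0.
rewrite (FTC2_closed ab cF (fun x h => dF x (pos x h))).
by rewrite /F !mulNr opprK addrC -mulrBr mulrC.
Qed.

(** Exhaustion of [0, b] by [b / (n + 1), b]: the antiderivative is a positive
    power, hence bounded. *)
Lemma integral_powR_lty (s b : R) : 0 < s < 1 -> 0 < b ->
  (\int[mu]_(t in `[0%R, b]) (t `^ (- s))%:E < +oo)%E.
Proof.
move=> /andP[s0 s1] b0.
rewrite -integral_itv_obnd_cbnd; last first.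
  by apply/measurable_EFinP/measurable_funTS; exact: measurable_powR.
pose F n := `[(b / n.+1%:R), b]%classic : set (measurableTypeR R).
have an n : 0 < b / n.+1%:R by rewrite divr_gt0.
have UF : \bigcup_n F n = `]0, b]%classic.
  apply/seteqP; split => t.
    move=> [n _]; rewrite /F /= !in_itv /= => /andP[h ->]; rewrite andbT.
    exact: lt_le_trans h.
  rewrite /= in_itv /= => /andP[t0 tb]; exists (Num.truncn (b / t)) => //.
  rewrite /F /= in_itv /= tb andbT ler_pdivrMr// mulrC -ler_pdivrMr//.
  by rewrite ltW// truncnS_gt.
have ndF : nondecreasing_seq F.
  move=> m n mn; apply/subsetPset => t; rewrite /F /= !in_itv /= => /andP[h ->].
  rewrite andbT (le_trans _ h)// ler_pM2l// lef_pV2 ?posrE// ler_nat.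
  exact: leq_trans mn _.
have mf i : measurable_fun (F i) (fun t : R => (t `^ (- s))%:E).
  by apply/measurable_EFinP/measurable_funTS; exact: measurable_powR.
have := @ge0_nondecreasing_set_cvg_integral _ _ _ F (fun t => (t `^ (- s))%:E) mu
  ndF (fun i => measurable_itv _) mf (fun i x _ => powR_ge0 _ _).
rewrite UF => cv; apply: le_lt_trans (ltry (b `^ (1 - s) / (1 - s))).
apply: (cvge_le _ cv); apply: nearW => n.
have := an n; rewrite /F; set a := b / _ => a0.
have [ab|ba] := ltP a b; last first.
  have [->|nab] := eqVneq a b.
    by rewrite set_itv1 integral_set1 lee_fin divr_ge0 ?powR_ge0// subr_ge0 ltW.
  rewrite set_itv_ge ?integral_set0 ?lee_fin ?divr_ge0 ?powR_ge0// ?subr_ge0 ?ltW//.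
  by rewrite -ltNge lt_neqAle eq_sym nab.
have pos t : t \in `[a, b] -> 0 < t by rewrite in_itv /= => /andP[/(lt_le_trans a0)].
pose G (t : R) : R := (1 - s)^-1 * t `^ (1 - s).
have dG (t : R) : 0 < t -> is_derive t (1:R) G (t `^ (- s)).
  move=> t0; have := is_deriveZ (1 - s)^-1 (is_derive1_powR (1 - s) t0).
  rewrite /GRing.scale /= mulrA mulVf ?mul1r ?gt_eqF ?subr_gt0//.
  by rewrite addrAC subrr add0r.
have cG (t : R) : 0 < t -> {for t, continuous (fun t : R => t `^ (- s))}.
  move=> t0; have [h _] := is_derive1_powR (- s) t0.
  exact/differentiable_continuous/derivable1_diffP.
rewrite (FTC2_closed ab (fun x h => cG x (pos x h)) (fun x h => dG x (pos x h))).
rewrite lee_fin /G -mulrBr mulrC ler_wpM2r ?invr_ge0 ?subr_ge0 ?(ltW s1)//.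
by rewrite gerBl powR_ge0.
Qed.

End PowerIntegrals.

Section RadialIntegrals.
Variable R : realType.
Local Notation mu := (@lebesgue_measure R).
Local Notation TR := (measurableTypeR R).
Local Notation RR := (TR * TR)%type.
Local Notation plane := (@plane R).
Local Notation sqmod := (@sqmod R).
Local Notation toC := (@toC R).

Lemma sqmodE p : sqmod p = normc (toC p) ^+ 2.
Proof. by rewrite normc_sqr. Qed.

Lemma measurable_sqmod_preimage (E : set TR) : measurable E ->
  measurable (sqmod @^-1` E).
Proof.
by move=> mE; rewrite -[X in measurable X]setTI; exact: measurable_sqmod.
Qed.

Lemma measurable_ring (E : set TR) : measurable E ->
  measurable_fun setT (fun p : RR => (sqmod p \in E)%:R : R).
Proof.
move=> mE; have := @measurable_indic _ _ R setT _ (measurable_sqmod_preimage mE).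
congr measurable_fun; apply/funext => p; rewrite indicE; congr (_%:R).
Qed.

Lemma rintegrable_radial (E : set TR) (f : R -> R) : measurable E ->
  E `<=` `[0, +oo[ -> measurable_fun setT f -> (forall t, E t -> 0 <= f t) ->
  (\int[mu]_(t in E) (f t)%:E < +oo)%E ->
  rintegrable plane (fun p => (sqmod p \in E)%:R * f (sqmod p)) /\
  (\int[plane]_p ((sqmod p \in E)%:R * f (sqmod p)))%:E =
    (pi%:E * \int[mu]_(t in E) (f t)%:E)%E.
Proof.
move=> mE E0 mf f0 foo.
have I : (\int[plane]_p ((sqmod p \in E)%:R * f (sqmod p))%:E =
    pi%:E * \int[mu]_(t in E) (f t)%:E)%E.
  rewrite -integral_radial// [RHS]integral_mkcond; apply: eq_integral => p _.
  rewrite patchE (_ : (p \in _) = (sqmod p \in E)); last first.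
    by apply/idP/idP => /set_mem h; exact/mem_set.
  by case: ifP => _; rewrite ?mul1r ?mul0r.
have f0' p : 0 <= (sqmod p \in E)%:R * f (sqmod p).
  by case: (boolP (sqmod p \in E)) => [/set_mem/f0 h|_]; rewrite ?mul1r ?mul0r.
have ri : rintegrable plane (fun p => (sqmod p \in E)%:R * f (sqmod p)).
  apply/integrableP; split.
    apply/measurable_EFinP/measurable_funM; first exact: measurable_ring.
    by apply: measurableT_comp => //; exact: measurable_sqmod.
  rewrite (eq_integral (fun p => ((sqmod p \in E)%:R * f (sqmod p))%:E)).
    by rewrite I lte_mul_pinfty// lee_fin pi_ge0.
  by move=> p _ /=; rewrite ger0_norm.
split => //; rewrite fineK -?I//.
by apply: integrable_fin_num ri.
Qed.

End RadialIntegrals.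

Section Singularities.
Variables (R : realType) (r : R).
Hypothesis r0 : 0 < r.
Local Notation mu := (@lebesgue_measure R).
Local Notation TR := (measurableTypeR R).
Local Notation RR := (TR * TR)%type.
Local Notation plane := (@plane R).
Local Notation sqmod := (@sqmod R).
Local Notation toC := (@toC R).

Definition inD (p : RR) : R := (normc (toC p) <= r)%R%:R.

Lemma inDE p : inD p = (sqmod p \in `[0%R, (r ^+ 2)]%classic)%:R.
Proof.
rewrite /inD; congr (nat_of_bool _)%:R; apply/idP/idP => [h|].
  by apply/mem_set; rewrite /= in_itv /= sqmod_ge0 sqmodE ler_sqr ?nnegrE ?normc_ge0// ltW.
move=> /set_mem; rewrite /= in_itv /= => /andP[_].
by rewrite sqmodE ler_sqr ?nnegrE ?normc_ge0// ltW.
Qed.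

Lemma measurable_inD : measurable_fun setT inD.
Proof.
have -> : inD = (fun p => (sqmod p \in `[0%R, (r ^+ 2)]%classic)%:R).
  by apply/funext => p; exact: inDE.
by apply: measurable_ring; exact: measurable_itv.
Qed.

Lemma inD_ge0 p : 0 <= inD p. Proof. exact: ler0n. Qed.

Lemma rintegrable_inD : rintegrable plane inD.
Proof.
have -> : inD = (fun p => (sqmod p \in `[0%R, (r ^+ 2)]%classic)%:R * sqmod p ^+ 0).
  by apply/funext => p; rewrite inDE expr0 mulr1.
have [|||||//] := @rintegrable_radial R `[0%R, (r ^+ 2)]%classic (fun t => t ^+ 0).
- exact: measurable_itv.
- by move=> t /=; rewrite !in_itv /= andbT => /andP[].
- exact: exprn_measurable.
- by move=> t _; rewrite expr0.
- by rewrite integral_expn ?ltry// exprn_gt0.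
Qed.

Lemma measurable_sing (s : R) (z : R[i]) :
  measurable_fun setT (fun p : RR => (normc (toC p - z) `^ s)^-1).
Proof.
apply: measurable_invr.
apply: (measurableT_comp (@measurable_powR R s)).
apply: measurable_normc; apply: cmeasurableB; last exact: cmeasurable_cst.
exact: cmeasurable_toC.
Qed.

(** Uniformly in the centre [z], the disk lies in the disk of radius [2 r] about [z],
    and there the integral of [|w - z|^-s] does not depend on [z]. *)
Lemma sing_integrable (s : R) : 0 < s < 2 -> exists2 B : R, 0 <= B &
  forall z, normc z <= r ->
    rintegrable plane (fun p => inD p * (normc (toC p - z) `^ s)^-1) /\
    \int[plane]_p (inD p * (normc (toC p - z) `^ s)^-1) <= B.
Proof.
move=> /andP[s0 s2]; pose E : set TR := `[0%R, ((2 * r) ^+ 2)]%classic.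
pose H (p : RR) : R := (sqmod p \in E)%:R * (sqmod p) `^ (- (s / 2)).
have [iH _] : rintegrable plane H /\
  (\int[plane]_p H p)%:E = (pi%:E * \int[mu]_(t in E) (t `^ (- (s / 2)))%:E)%E.
  apply: (@rintegrable_radial _ E (fun t => t `^ (- (s / 2)))).
  - exact: measurable_itv.
  - by move=> t; rewrite /E /= !in_itv /= andbT => /andP[].
  - exact: measurable_powR.
  - by move=> t _; exact: powR_ge0.
  - apply: integral_powR_lty; last by rewrite exprn_gt0// mulr_gt0.
    by rewrite divr_gt0//= ltr_pdivrMr// mul1r.
have H0 p : 0 <= H p by rewrite mulr_ge0 ?powR_ge0.
exists (\int[plane]_p H p); first exact: Rintegral_ge0.
move=> z zr.
pose tr (p : RR) : RR := (p.1 + (ofC (- z)).1, p.2 + (ofC (- z)).2).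
have [iT eT] := preserves_rintegrable (preserves_translation (ofC (- z))) iH.
have le p : inD p * (normc (toC p - z) `^ s)^-1 <= H (tr p).
  rewrite {1}/inD; have [pr|_] := leP (normc (toC p)) r; last by rewrite mul0r.
  have E1 : sqmod (tr p) = normc (toC p - z) ^+ 2.
    by rewrite sqmodE; congr (normc _ ^+ 2); rewrite /tr /toC; case: (z).
  rewrite mul1r /H E1; have wz2 : normc (toC p - z) <= 2 * r.
    by apply: le_trans (normcB _ _) _; rewrite mulr_natl mulr2n; apply: lerD.
  have n0 := normc_ge0 (toC p - z); move: (normc _) n0 wz2 => x x0 x2r.
  rewrite mem_set ?mul1r; last first.
    by rewrite /E /= in_itv /= sqr_ge0 ler_sqr ?nnegrE ?(le_trans x0).
  rewrite powRN -(powR_mulrn 2 x0) -powRrM.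
  by rewrite mulrCA divff ?mulr1 ?pnatr_eq0.
have i1 : rintegrable plane (fun p => inD p * (normc (toC p - z) `^ s)^-1).
  apply: rintegrable_le iT _; last first.
    move=> p; rewrite ger0_norm; first exact: le.
    by apply: mulr_ge0; rewrite ?inD_ge0 ?invr_ge0 ?powR_ge0.
  by apply: measurable_funM; [exact: measurable_inD|exact: measurable_sing].
split; first exact: i1.
by rewrite -eT; apply: le_Rintegral => // p _; exact: le.
Qed.

Lemma inv_integrable : exists2 B : R, 0 <= B &
  forall z, normc z <= r ->
    rintegrable plane (fun p => inD p * (normc (toC p - z))^-1) /\
    \int[plane]_p (inD p * (normc (toC p - z))^-1) <= B.
Proof.
have [|B B0 BP] := @sing_integrable 1; first by rewrite ltr01 ltr1n.
have E z : (fun p => inD p * (normc (toC p - z) `^ 1)^-1) =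
    (fun p => inD p * (normc (toC p - z))^-1).
  by apply/funext => p; rewrite powRr1 ?normc_ge0.
by exists B => // z /BP; rewrite E.
Qed.

(** Away from the diagonal the product of two first-order singularities is a
    multiple of their sum. *)
Lemma inv_inv_le (z e w : R[i]) : z != e ->
  (normc (w - z))^-1 * (normc (w - e))^-1 <=
  (normc (z - e))^-1 * ((normc (w - z))^-1 + (normc (w - e))^-1).
Proof.
move=> ze; have d0 : 0 < normc (z - e) by rewrite normc_gt0 subr_eq0.
have [->|wz] := eqVneq w z.
  by rewrite subrr normc0 invr0 mul0r add0r mulr_ge0 ?invr_ge0 ?normc_ge0.
have [->|we] := eqVneq w e.
  by rewrite subrr normc0 invr0 mulr0 addr0 mulr_ge0 ?invr_ge0 ?normc_ge0.
have a0 : 0 < normc (w - z) by rewrite normc_gt0 subr_eq0.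
have b0 : 0 < normc (w - e) by rewrite normc_gt0 subr_eq0.
have tri : normc (z - e) <= normc (w - z) + normc (w - e).
  by rewrite (normc_distC w z) normc_dist_triangle.
set A := normc (w - z) in a0 tri *; set B := normc (w - e) in b0 tri *.
set d := normc (z - e) in d0 tri *.
have -> : d^-1 * (A^-1 + B^-1) = (A + B) * (d^-1 * (A^-1 * B^-1)).
  by field; rewrite !gt_eqF.
rewrite [X in X <= _](_ : _ = d * (d^-1 * (A^-1 * B^-1))); last first.
  by field; rewrite !gt_eqF.
by apply: ler_wpM2r => //; rewrite !mulr_ge0 ?invr_ge0 ?ltW.
Qed.

Lemma inv_inv_integrable (z e : R[i]) : normc z <= r -> normc e <= r -> z != e ->
  rintegrable plane
    (fun p => inD p * ((normc (toC p - z))^-1 * (normc (toC p - e))^-1)).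
Proof.
move=> zr er ze; have [B _ BP] := inv_integrable.
have [iz _] := BP z zr; have [ie _] := BP e er.
have ib := rintegrableZ (normc (z - e))^-1 (rintegrableD iz ie).
apply: (rintegrable_le _ ib).
  apply: measurable_funM; first exact: measurable_inD.
  have ms u : measurable_fun setT (fun p : RR => (normc (toC p - u))^-1).
    apply: measurable_invr; apply: measurable_normc.
    by apply: cmeasurableB; [exact: cmeasurable_toC|exact: cmeasurable_cst].
  by apply: measurable_funM; exact: ms.
move=> p; rewrite ger0_norm; last by rewrite !mulr_ge0 ?invr_ge0 ?normc_ge0 ?inD_ge0.
rewrite -mulrDr [X in _ <= X]mulrCA.
by apply: ler_wpM2l; [exact: inD_ge0|exact: inv_inv_le].
Qed.

End Singularities.

(** * Angular averages and geometric expansions *)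

Arguments normc : simpl never.
Arguments toC : simpl never.
Arguments sqmod : simpl never.

Section NormcLimits.
Variable R : realType.
Implicit Types (s : nat -> R[i]) (l : R[i]).

Definition ctends s l := (fun n => normc (s n - l)) @ \oo --> (0 : R).

Lemma ctends_unique s l l' : ctends s l -> ctends s l' -> l = l'.
Proof.
move=> h h'; apply/eqP; rewrite -subr_eq0 -normc_eq0.
have h3 : (fun n : nat => normc (l - l')) @ \oo --> (0 : R).
  apply: (@squeeze_cvgr _ _ _ _ (fun=> 0)
    (fun n => normc (s n - l) + normc (s n - l'))).
  - apply: nearW => n; rewrite normc_ge0 /= (normc_distC (s n) l).
    exact: normc_dist_triangle.
  - exact: cvg_cst.
  - by rewrite -[X in _ --> X](addr0 (0 : R)); exact: cvgD.
by apply/eqP; apply: (@cvg_unique _ _ (nbhs _) _ (normc (l - l')) 0) h3 => //; exact: cvg_cst.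
Qed.

Lemma ctends_near s l c : ctends s l -> (\forall n \near \oo, s n = c) -> l = c.
Proof.
move=> h nc; apply: (ctends_unique h); apply: cvg_near_cst.
by apply: filterS nc => n ->; rewrite subrr normc0.
Qed.

Lemma ctends_cst c : ctends (fun=> c) c.
Proof. by rewrite /ctends subrr normc0; exact: cvg_cst. Qed.

Lemma ctendsD s s' l l' : ctends s l -> ctends s' l' ->
  ctends (fun n => s n + s' n) (l + l').
Proof.
move=> h h'; apply: (@squeeze_cvgr _ _ _ _ (fun=> 0)
  (fun n => normc (s n - l) + normc (s' n - l'))).
- apply: nearW => n; rewrite normc_ge0 /=.
  by rewrite opprD addrACA le_normcD.
- exact: cvg_cst.
- by rewrite -[X in _ --> X](addr0 (0 : R)); exact: cvgD.
Qed.

Lemma ctendsZ c s l : ctends s l -> ctends (fun n => c * s n) (c * l).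
Proof.
move=> h; rewrite /ctends.
have -> : (fun n => normc (c * s n - c * l)) = (fun n => normc c * normc (s n - l)).
  by apply/funext => n; rewrite -mulrBr normcM.
by rewrite -(mulr0 (normc c)); apply: cvgM => //; exact: cvg_cst.
Qed.

Lemma ctendsN s l : ctends s l -> ctends (fun n => - s n) (- l).
Proof.
rewrite /ctends; have -> // : (fun n => normc (- s n - - l)) = (fun n => normc (s n - l)).
by apply/funext => n; rewrite -opprD normcN.
Qed.

End NormcLimits.

Section Expansions.
Variable R : realType.
Local Notation mu := (@lebesgue_measure R).
Local Notation TR := (measurableTypeR R).
Local Notation RR := (TR * TR)%type.
Local Notation plane := (@plane R).
Local Notation sqmod := (@sqmod R).
Local Notation toC := (@toC R).

(** A multiplier [g] is the sum of the geometric series of ratio [q] and first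
    term [g * (1 - q)], whose partial sums are bounded by [2 * |g|]. *)
Lemma geometric_dominated_cvg (g q : RR -> R[i]) :
  cintegrable plane g -> cmeasurable q ->
  (forall p, g p != 0 -> normc (q p) < 1) ->
  (forall k, cintegrable plane (fun p => g p * (1 - q p) * q p ^+ k)) /\
  ctends (fun N => \sum_(k < N) cint plane (fun p => g p * (1 - q p) * q p ^+ k))
    (cint plane g).
Proof.
move=> ig mq q1; have mg := cintegrable_measurable ig.
have i2g : rintegrable plane (fun p => 2 * normc (g p)).
  by apply: rintegrableZ; exact: rintegrable_normc.
have qn p n : g p != 0 -> normc (q p ^+ n) <= 1.
  by move=> /q1 h; rewrite normcX exprn_ile1 ?normc_ge0// ltW.
have it k : cintegrable plane (fun p => g p * (1 - q p) * q p ^+ k).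
  apply: (cintegrable_le _ i2g).
    apply: cmeasurableM; last exact: cmeasurableX.
    by apply: cmeasurableM => //; apply: cmeasurableB => //; exact: cmeasurable_cst.
  move=> p; have [->|g0] := eqVneq (g p) 0; first by rewrite !mul0r normc0 mulr0.
  rewrite -mulrA normcM mulrC ler_wpM2r ?normc_ge0//.
  rewrite mulrBl mul1r -exprS (le_trans (normcB _ _))//.
  by rewrite -[leRHS]/(1 + 1) lerD// qn.
split => //.
have tele N p : \sum_(k < N) g p * (1 - q p) * q p ^+ k = g p * (1 - q p ^+ N).
  rewrite -mulr_sumr -mulrA; congr (_ * _).
  rewrite -[in RHS](expr1n _ N) subrXX; congr (_ * _).
  by apply: eq_bigr => i _; rewrite expr1n mul1r.
have -> : (fun N => \sum_(k < N) cint plane (fun p => g p * (1 - q p) * q p ^+ k)) =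
    (fun N => cint plane (fun p => g p * (1 - q p ^+ N))).
  apply/funext => N; rewrite -cint_sum//; apply: eq_cint => p; exact: tele.
apply: (cint_dominated_cvg _ mg i2g).
- move=> n; apply: cmeasurableM => //; apply: cmeasurableB; first exact: cmeasurable_cst.
  exact: cmeasurableX.
- move=> n p; have [->|g0] := eqVneq (g p) 0; first by rewrite !mul0r normc0 mulr0.
  rewrite normcM mulrC ler_wpM2r ?normc_ge0//.
  by rewrite (le_trans (normcB _ _))// normc1 -[leRHS]/(1 + 1) lerD2l qn.
- move=> p; have [->|g0] := eqVneq (g p) 0.
    rewrite (_ : (fun _ => _) = fun=> 0); first exact: cvg_cst.
    by apply/funext => n; rewrite mul0r subrr normc0.
  rewrite (_ : (fun _ => _) = (fun n => normc (g p) * normc (q p) ^+ n)); last first.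
    by apply/funext => n; rewrite mulrBr mulr1 addrAC subrr add0r normcN normcM normcX.
  rewrite -(mulr0 (normc (g p))); apply: cvgM; first exact: cvg_cst.
  by apply: cvg_expr; rewrite ger0_norm ?normc_ge0 ?q1.
Qed.

Lemma toC_ofC (z : R[i]) : toC (ofC z) = z. Proof. by case: z. Qed.

Lemma rotation_eq0 (g : R[i] -> R[i]) n c : (0 < n)%N ->
  cintegrable plane (fun p => g (toC p)) -> c != 1 ->
  (forall u w, normc u = 1 -> u ^+ n = 'i%C -> g (u * w) = c * g w) ->
  cint plane (fun p => g (toC p)) = 0.
Proof.
move=> n0 ig c1 gu; pose u : R[i] := n.-root 'i%C.
have un : u ^+ n = 'i%C by rewrite rootCK.
have u1 : normc u = 1.
  apply/eqP; rewrite -(pexpr_eq1 n0) ?normc_ge0// -normcX un.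
  by rewrite /normc expr0n expr1n add0r sqrtr1.
have uN1 : Re u != - 1.
  apply/eqP => h; have := congr1 (fun x => x ^+ 2) u1; rewrite normc_sqr h sqrrN expr1n.
  move=> /eqP; rewrite -[X in _ == X]addr0 (inj_eq (addrI _)) sqrf_eq0 => /eqP h'.
  have uE : u = -1 by apply/eqP; rewrite eq_complex h h' /= oppr0 !eqxx.
  move: un; rewrite uE -signr_odd; case: (odd n); rewrite ?expr1 ?expr0;
    move=> /(congr1 (@complex.Im R)) /= /eqP;
    by rewrite ?oppr0 eq_sym oner_eq0.
have [_] := cint_preserves (preserves_rotation u1 uN1) ig.
under eq_cint do rewrite toC_ofC gu//.
rewrite cintZ// => /eqP; rewrite -subr_eq0 -{2}(mul1r (cint _ _)) -mulrBl mulf_eq0.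
by rewrite subr_eq0 (negbTE c1) => /eqP.
Qed.

Definition chi (E : set TR) (w : R[i]) : R[i] := ((normc w ^+ 2 : TR) \in E)%:R.

Lemma chi_toC E p : chi E (toC p) = ((sqmod p \in E)%:R : R)%:C.
Proof. by rewrite /chi sqmodE; case: (_ \in E). Qed.

Lemma cmeasurable_chi E : measurable E -> cmeasurable (fun p => chi E (toC p)).
Proof.
move=> mE; under eq_fun do rewrite chi_toC.
by apply: cmeasurable_real; exact: measurable_ring.
Qed.

Lemma conj_chi E w : (chi E w)^* = chi E w.
Proof. by rewrite /chi; case: (_ \in E); rewrite ?conjC1 ?conjC0. Qed.

Lemma cint_real (h : RR -> R) : cint plane (fun p => (h p)%:C) = (\int[plane]_p h p)%:C.
Proof. by rewrite /cint /=; congr Complex; rewrite /Rintegral integral0. Qed.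

Lemma radial_moment (E : set TR) (f : R -> R) c : measurable E ->
  E `<=` `[0, +oo[ -> measurable_fun setT f -> (forall t, E t -> 0 <= f t) ->
  (\int[mu]_(t in E) (f t)%:E = c%:E)%E ->
  cintegrable plane (fun p => chi E (toC p) * (f (sqmod p))%:C) /\
  cint plane (fun p => chi E (toC p) * (f (sqmod p))%:C) = (pi * c)%:C.
Proof.
move=> mE E0 mf f0 fc.
have [|ri ei] := rintegrable_radial mE E0 mf f0; first by rewrite fc ltry.
have -> : (fun p => chi E (toC p) * (f (sqmod p))%:C) =
    (fun p => ((sqmod p \in E)%:R * f (sqmod p))%:C).
  by apply/funext => p; rewrite chi_toC -rmorphM.
split; first by split => //; exact: integrable0.
by rewrite cint_real; congr _%:C; move: ei; rewrite fc -EFinM => -[].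
Qed.

(** Rotating by a suitable root of [i] multiplies the monomial by [i] or [-i]. *)
Lemma moment_off_diagonal (E : set TR) (m n : int) : m != n ->
  cintegrable plane (fun p => chi E (toC p) * (toC p ^ m * (toC p)^* ^ n)) ->
  cint plane (fun p => chi E (toC p) * (toC p ^ m * (toC p)^* ^ n)) = 0.
Proof.
move=> mn ig; have d0 : (0 < `|m - n|)%N by rewrite absz_gt0 subr_eq0.
have uc (u : R[i]) : normc u = 1 -> u^* = u^-1.
  move=> u1; have u0 : u != 0 by rewrite -normc_eq0 u1 oner_eq0.
  by apply: (mulfI u0); rewrite mulCJ u1 expr1n divff.
have key u (w : R[i]) : normc u = 1 ->
    chi E (u * w) * ((u * w) ^ m * (u * w)^* ^ n) =
    u ^ (m - n) * (chi E w * (w ^ m * w^* ^ n)).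
  move=> u1; have u0 : u != 0 by rewrite -normc_eq0 u1 oner_eq0.
  rewrite {1}/chi normcM u1 mul1r -/(chi E w).
  have [->|w0] := eqVneq w 0.
    rewrite mulr0 conjC0 !exp0rz.
    have -> : (m == 0)%:R * (n == 0)%:R = 0 :> R[i].
      case: (eqVneq m 0) mn => [->|_ _]; last by rewrite mul0r.
      by rewrite eq_sym => /negbTE ->; rewrite mulr0.
    by rewrite !mulr0.
  have wc0 : w^* != 0 by rewrite conjC_eq0.
  rewrite rmorphM /= uc// !exprzMl ?unitfE ?invr_eq0//.
  by rewrite exprz_inv expfzDr//; ring.
pose g (w : R[i]) := chi E w * (w ^ m * w^* ^ n).
have i1 : 'i%C != 1 :> R[i] by rewrite eq_complex /= eq_sym oner_eq0.
have [mn0|mn0] := leP 0 (m - n).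
  refine (@rotation_eq0 g _ _ d0 ig i1 _) => u w u1 un.
  by rewrite /g key// -{1}(gez0_abs mn0) -un.
refine (@rotation_eq0 g _ 'i%C^-1 d0 ig _ _); first by rewrite invr_eq1.
move=> u w u1 un; rewrite /g key//; congr (_ * _).
by rewrite -[m - n]opprK -(ltz0_abs mn0) -exprnN un.
Qed.

Lemma moment_off_diagonalZ (E : set TR) (m n : int) (c : R[i]) : m != n ->
  cintegrable plane (fun p => c * (chi E (toC p) * (toC p ^ m * (toC p)^* ^ n))) ->
  cint plane (fun p => c * (chi E (toC p) * (toC p ^ m * (toC p)^* ^ n))) = 0.
Proof.
move=> mn; have [->|c0] := eqVneq c 0.
  by under eq_cint do rewrite mul0r; rewrite cint0.
move=> ig; have ig' : cintegrable plane
    (fun p => chi E (toC p) * (toC p ^ m * (toC p)^* ^ n)).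
  have := cintegrableZ c^-1 ig; congr cintegrable; apply/funext => p.
  by rewrite mulKf.
by rewrite cintZ// moment_off_diagonal// mulr0.
Qed.

End Expansions.

Section DiskTransforms.
Variable R : realType.
Local Notation mu := (@lebesgue_measure R).
Local Notation TR := (measurableTypeR R).
Local Notation RR := (TR * TR)%type.
Local Notation plane := (@plane R).
Local Notation sqmod := (@sqmod R).
Local Notation toC := (@toC R).
Local Notation chi := (@chi R).

Lemma measure_circle (c : R) : 0 <= c -> plane (sqmod @^-1` [set c]) = 0%E.
Proof.
move=> c0; rewrite pushforward_sqmod; last by move=> x /= ->; rewrite in_itv /= c0.
  by rewrite lebesgue_measure_set1 mule0.
exact: measurable_set1.
Qed.

Lemma cmeasurable_toC_sub (z : R[i]) : cmeasurable (fun p => toC p - z).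
Proof. by apply: cmeasurableB; [exact: cmeasurable_toC|exact: cmeasurable_cst]. Qed.

Lemma chi_bound (E : set TR) (rho : R) p : 0 < rho ->
  E `<=` `[0, (rho ^+ 2)] -> normc (chi E (toC p)) <= inD rho p.
Proof.
move=> rho0 Er; rewrite inDE// chi_toC normc_real.
case: (boolP (sqmod p \in E)) => [/set_mem/Er/mem_set ->|_].
  by rewrite normr1.
by rewrite normr0 ler0n.
Qed.

Lemma chi_div_integrable (E : set TR) (phi : R[i] -> R[i]) (rho K : R) (z : R[i]) :
  0 < rho -> measurable E -> E `<=` `[0, (rho ^+ 2)] -> normc z <= rho ->
  cmeasurable (fun p => phi (toC p)) ->
  (forall w, chi E w != 0 -> normc (phi w) <= K) ->
  cintegrable plane (fun p => chi E (toC p) * (phi (toC p) / (toC p - z))).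
Proof.
move=> rho0 mE Er zr mphi phiK; have [B _ BP] := inv_integrable rho0.
have [iz _] := BP z zr.
apply: (cintegrable_le _ (rintegrableZ `|K| iz)).
  apply: cmeasurableM; first exact: cmeasurable_chi.
  by apply: cmeasurableM => //; apply: cmeasurableV; exact: cmeasurable_toC_sub.
move=> p; have [->|cE] := eqVneq (chi E (toC p)) 0.
  by rewrite mul0r normc0 !mulr_ge0 ?invr_ge0 ?normc_ge0 ?inD_ge0.
rewrite !normcM normcV mulrCA; apply: ler_pM; rewrite ?normc_ge0 ?mulr_ge0 ?invr_ge0 ?normc_ge0//.
  by rewrite (le_trans (phiK _ cE))// ler_norm.
by apply: ler_wpM2r; [rewrite invr_ge0 normc_ge0|exact: chi_bound].
Qed.

(** The circle through [z] is negligible. *)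
Lemma cint_split_circle (g : R[i] -> R[i]) (m b : R) : 0 <= m <= b ->
  cintegrable plane (fun p => chi `[0, b]%classic (toC p) * g (toC p)) ->
  cintegrable plane (fun p => chi `[0, m[%classic (toC p) * g (toC p)) ->
  cintegrable plane (fun p => chi `]m, b]%classic (toC p) * g (toC p)) ->
  cint plane (fun p => chi `[0, b]%classic (toC p) * g (toC p)) =
  cint plane (fun p => chi `[0, m[%classic (toC p) * g (toC p)) +
  cint plane (fun p => chi `]m, b]%classic (toC p) * g (toC p)).
Proof.
move=> /andP[m0 mb] i0 i1 i2; rewrite -cintD//.
apply: (@cint_ae_eq _ _ _ _ (sqmod @^-1` [set m])).
- by apply: measurable_sqmod_preimage; exact: measurable_set1.
- exact: (measure_circle m0).
- exact: (cintegrable_measurable i0).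
- exact: (cintegrable_measurable (cintegrableD i1 i2)).
move=> p /= /eqP pm; rewrite -mulrDl; congr (_ * _); rewrite !chi_toC -rmorphD /=.
congr (_ %:C); rewrite !mem_setE !in_itv /= sqmod_ge0 /=.
case: (ltgtP (sqmod p) m) pm => [pm _|pm _|->]; rewrite ?eqxx//.
  by rewrite (le_trans (ltW pm) mb) /= addr0.
by rewrite add0r.
Qed.

Lemma chi_neq0 E w : chi E w != 0 -> E (normc w ^+ 2).
Proof. by rewrite /chi; case: (boolP (_ \in E)) => [/set_mem//|_]; rewrite eqxx. Qed.

(** Only the diagonal term of the expansion of the Cauchy kernel in powers of
    [w / z] or [z / w] survives the angular integration. *)
Lemma disk_conj_power (rho : R) (z : R[i]) b : 0 < rho -> normc z <= rho ->
  cint plane (fun p => chi `[0%R, (rho ^+ 2)]%classic (toC p) *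
                         ((toC p)^* ^+ b / (toC p - z))) =
  - (pi : R)%:C * (z^* ^+ b.+1 / b.+1%:R).
Proof.
move=> rho0 zr; set m := normc z ^+ 2.
have m0 : 0 <= m by rewrite sqr_ge0.
have mr : m <= rho ^+ 2 by rewrite ler_sqr ?nnegrE ?normc_ge0// ltW.
have mphi n : cmeasurable (fun p => (toC p)^* ^+ n).
  by apply: cmeasurableX; apply: cmeasurable_conj; exact: cmeasurable_toC.
have ii (E : set TR) : measurable E -> E `<=` `[0, (rho ^+ 2)] ->
    cintegrable plane (fun p => chi E (toC p) * ((toC p)^* ^+ b / (toC p - z))).
  move=> mE Er; apply: (chi_div_integrable (phi := fun w => w^* ^+ b) (K := rho ^+ b) rho0) => //.
  move=> w /chi_neq0/Er /=; rewrite in_itv /= => /andP[_ h].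
  rewrite normcX normc_conj lerXn2r ?nnegrE ?normc_ge0 ?(ltW rho0)//.
  by rewrite -ler_sqr ?nnegrE ?normc_ge0 ?(ltW rho0).
pose E1 : set TR := `[0%R, m[%classic.
pose E2 : set TR := `]m, (rho ^+ 2)]%classic.
have mE1 : measurable E1 by exact: measurable_itv.
have mE2 : measurable E2 by exact: measurable_itv.
have E1r : E1 `<=` `[0, (rho ^+ 2)].
  by move=> t; rewrite /E1 /= !in_itv /= => /andP[-> /ltW/le_trans]; apply.
have E2r : E2 `<=` `[0, (rho ^+ 2)].
  by move=> t; rewrite /E2 /= !in_itv /= => /andP[/ltW/(le_trans m0) -> ->].
rewrite (@cint_split_circle (fun w => w^* ^+ b / (w - z)) m); last first.
- exact: ii.
- exact: ii.
- by apply: ii => //; exact: measurable_itv.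
- by rewrite m0.
have -> : cint plane (fun p => chi E2 (toC p) * ((toC p)^* ^+ b / (toC p - z))) = 0.
  pose q p := z / toC p.
  have mq : cmeasurable q.
    apply: cmeasurableM; first exact: cmeasurable_cst.
    by apply: cmeasurableV; exact: cmeasurable_toC.
  have [|it cv] := geometric_dominated_cvg (ii E2 mE2 E2r) mq.
    move=> p; rewrite mulf_eq0 negb_or => /andP[/chi_neq0].
    rewrite /E2 /= in_itv /= => /andP[h _] _; rewrite /q normcM normcV ltr_pdivrMr ?mul1r.
      by rewrite -ltr_sqr ?nnegrE ?normc_ge0.
    by rewrite -ltr_sqr ?nnegrE ?normc_ge0// expr0n /= (le_lt_trans m0).
  apply: (ctends_near cv); apply: nearW => N; rewrite big1// => k _.
  have tE : (fun p => chi E2 (toC p) * ((toC p)^* ^+ b / (toC p - z)) *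
      (1 - q p) * q p ^+ k) =
      (fun p => z ^+ k * (chi E2 (toC p) * (toC p ^ (- k.+1%:Z) * (toC p)^* ^ b%:Z))).
    apply/funext => p; have [->|cE] := eqVneq (chi E2 (toC p)) 0.
      by rewrite !mul0r mulr0.
    have := chi_neq0 cE; rewrite /E2 /= in_itv /= => /andP[h _].
    have w0 : toC p != 0.
      by apply: contraTneq h => ->; rewrite normc0 expr0n /= -leNgt.
    have wz : toC p - z != 0.
      by rewrite subr_eq0; apply: contraTneq h => ->; rewrite ltxx.
    rewrite /q -exprnN -exprnP exprMn exprVn (exprS (toC p)); field.
    by rewrite w0 wz expf_neq0.
  by rewrite tE; apply: moment_off_diagonalZ => //; rewrite -tE; exact: it.
rewrite addr0; have [z0|z0] := eqVneq z 0.
  have E10 : E1 = set0.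
    by rewrite /E1 /m z0 normc0 expr0n /= set_itv_ge ?bnd_simp ?ltxx.
  rewrite z0 conjC0 exprS !mul0r mulr0.
  under eq_cint do rewrite (E10 : `[0%R, m[%classic = set0) /chi in_set0 mul0r.
  by rewrite cint0.
pose q p := toC p / z.
have mq : cmeasurable q.
  by apply: cmeasurableM; [exact: cmeasurable_toC|exact: cmeasurable_cst].
have [|it cv] := geometric_dominated_cvg (ii E1 mE1 E1r) mq.
  move=> p; rewrite mulf_eq0 negb_or => /andP[/chi_neq0].
  rewrite /E1 /= in_itv /= => /andP[_ h] _; rewrite /q normcM normcV ltr_pdivrMr ?normc_gt0// mul1r.
  by rewrite -ltr_sqr ?nnegrE ?normc_ge0.
have tE k : (fun p => chi E1 (toC p) * ((toC p)^* ^+ b / (toC p - z)) *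
    (1 - q p) * q p ^+ k) =
    (fun p => - z ^- k.+1 * (chi E1 (toC p) * (toC p ^ k%:Z * (toC p)^* ^ b%:Z))).
  apply/funext => p; have [->|cE] := eqVneq (chi E1 (toC p)) 0.
    by rewrite !mul0r mulr0.
  have := chi_neq0 cE; rewrite /E1 /= in_itv /= => /andP[_ h].
  have wz : toC p - z != 0.
    by rewrite subr_eq0; apply: contraTneq h => ->; rewrite ltxx.
  rewrite /q -!exprnP exprMn exprVn (exprS z); field.
  by rewrite z0 wz expf_neq0.
have off k : k != b -> cint plane (fun p => chi E1 (toC p) *
    ((toC p)^* ^+ b / (toC p - z)) * (1 - q p) * q p ^+ k) = 0.
  move=> kb; rewrite tE; apply: moment_off_diagonalZ => //.
  by rewrite -tE; exact: it.
have m_gt0 : 0 < m by rewrite exprn_gt0// normc_gt0.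
have [||||i1 c1] := @radial_moment _ E1 (fun t => t ^+ b) (m ^+ b.+1 / b.+1%:R) mE1.
- by move=> t; rewrite /E1 /= !in_itv /= andbT => /andP[].
- exact: exprn_measurable.
- by move=> t; rewrite /E1 /= in_itv /= => /andP[t0 _]; exact: exprn_ge0.
- rewrite integral_itv_bndo_bndc.
    by rewrite integral_expn// expr0n /= subr0.
  by apply/measurable_EFinP/measurable_funTS; exact: exprn_measurable.
have diag : cint plane (fun p => chi E1 (toC p) *
    ((toC p)^* ^+ b / (toC p - z)) * (1 - q p) * q p ^+ b) =
    - (pi : R)%:C * (z^* ^+ b.+1 / b.+1%:R).
  rewrite tE.
  have -> : (fun p => - z ^- b.+1 * (chi E1 (toC p) * (toC p ^ b%:Z * (toC p)^* ^ b%:Z))) =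
      (fun p => - z ^- b.+1 * (chi E1 (toC p) * ((sqmod p ^+ b) : R)%:C)).
    by apply/funext => p; rewrite -!exprnP -exprMn mulCJ -sqmodE rmorphXn.
  rewrite cintZ// c1 rmorphM /= rmorphM /= rmorphV ?unitfE ?pnatr_eq0// rmorphXn /= -mulCJ.
  rewrite rmorph_nat exprMn; field.
  by rewrite nat1r pnatr_eq0 expf_neq0.
apply: (ctends_near cv); exists b.+1 => // N /= bN.
rewrite (bigD1 (Ordinal bN)) //= diag big1 ?addr0// => k kb.
by apply: off; apply: contraNneq kb => kb; apply/eqP/val_inj.
Qed.

End DiskTransforms.

(** * The principal logarithm *)

Section Logarithm.
Variable R : realType.
Implicit Types (w x z : R[i]).

Lemma Arg_atan z : 0 < Re z -> Arg z = atan (Im z / Re z).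
Proof.
case: z => x y /= x0; rewrite /Arg /=.
set th := atan (y / x).
have x2 : 0 < x ^+ 2 by rewrite exprn_gt0.
have cth : x / normc (x +i* y) = cos th.
  have nE : normc (x +i* y) = x * Num.sqrt (1 + (y / x) ^+ 2).
    transitivity (Num.sqrt (x ^+ 2) * Num.sqrt (1 + (y / x) ^+ 2)); last first.
      by rewrite sqrtr_sqr gtr0_norm.
    rewrite -sqrtrM ?sqr_ge0// /normc; congr Num.sqrt.
    by field; rewrite gt_eqF.
  by rewrite cos_atan nE invfM mulrA divff ?mul1r ?gt_eqF.
have pi2 : (pi : R) / 2 <= pi.
  by rewrite ler_pdivrMr// ler_peMr ?pi_ge0// ler1n.
rewrite cth; have [y0|y0] := leP 0 y.
  have th0 : 0 <= th.
    by rewrite /th -(atan0 R) le_atan// divr_ge0// ltW.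
  by rewrite cosK// in_itv /= th0 (le_trans _ pi2)// ltW// atan_ltpi2.
have th0 : th <= 0.
  rewrite /th -(atan0 R) le_atan//; apply: mulr_le0_ge0; first exact: ltW.
  by rewrite invr_ge0 ltW.
rewrite cosKN ?opprK// th0 andbT (le_trans _ (ltW (atan_gtNpi2 _)))//.
by rewrite lerN2.
Qed.

Lemma LnE w : 0 < Re w -> Ln w = ln (normc w) +i* atan (Im w / Re w).
Proof. by move=> w0; rewrite /Ln Arg_atan. Qed.

Lemma Ln_conj w : 0 < Re w -> Ln w^* = (Ln w)^*.
Proof.
move=> w0; rewrite !LnE ?Re_conjc// normc_conj Im_conjc mulNr atanN.
by [].
Qed.

Lemma Ln_scale (c : R) w : 0 < c -> 0 < Re w -> Ln (c%:C * w) = (ln c)%:C + Ln w.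
Proof.
move=> c0 w0; have n0 : 0 < normc w.
  by rewrite normc_gt0; apply: contraTneq w0 => ->; rewrite ltxx.
have E1 : Re (c%:C * w) = c * Re w by rewrite Re_mulc /= mul0r subr0.
have E2 : Im (c%:C * w) = c * Im w by rewrite Im_mulc /= mul0r addr0.
rewrite !LnE ?E1 ?mulr_gt0// normcM normc_real gtr0_norm// lnM ?posrE// E2.
rewrite -mulf_div divff ?gt_eqF// mul1r.
by apply/eqP; rewrite eq_complex /= add0r !eqxx.
Qed.

Lemma LnD_conj w : 0 < Re w -> Ln w + Ln w^* = (2 * ln (normc w))%:C.
Proof.
move=> w0; rewrite Ln_conj// LnE//; apply/eqP; rewrite eq_complex /=.
by rewrite subrr eqxx andbT mulr_natl mulr2n.
Qed.

Lemma Re_1B x : normc x < 1 -> 0 < Re (1 - x).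
Proof.
move=> x1; rewrite Re_addc Re_oppc subr_gt0 /=.
by rewrite (le_lt_trans (ler_norm _))// (le_lt_trans (normr_Re_le _)).
Qed.

(** Along the ray [t x], the derivative of the [N]-th Taylor remainder is
    [- x (t x)^N / (1 - t x)]. *)
Lemma ray_remainder (P : R[i] -> R) (L : R -> R) x N :
  (forall y z, P (y + z) = P y + P z) -> (forall c z, P (c%:C * z) = c * P z) ->
  (forall z, `|P z| <= normc z) -> normc x < 1 ->
  (forall t : R, t \in `[0, 1] -> is_derive t (1 : R) L (P (- x / (1 - t%:C * x)))) ->
  `|P (\sum_(k < N) x ^+ k.+1 / k.+1%:R) + L 1 - L 0| <=
  normc x ^+ N.+1 / (1 - normc x).
Proof.
move=> PD PZ Pn x1 dL.
have P0 : P 0 = 0 by have := PZ 0 0; rewrite mul0r => ->; rewrite mul0r.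
have Psum (F : 'I_N -> R[i]) : P (\sum_(k < N) F k) = \sum_(k < N) P (F k).
  by apply: (big_morph P) => //; move=> a b; exact: PD.
pose S (t : R) : R := \sum_(k < N) (P (x ^+ k.+1) / k.+1%:R) * t ^+ k.+1.
pose F (t : R) : R := S t + L t.
have dS (t : R) : is_derive t (1 : R) S (\sum_(k < N) P (x ^+ k.+1) * t ^+ k).
  have -> : S = \sum_(k < N) (fun t => (P (x ^+ k.+1) / k.+1%:R) * t ^+ k.+1).
    by apply/funext => u; rewrite /S fct_sumE.
  have dk (k : 'I_N) : is_derive t (1 : R)
      (fun t => (P (x ^+ k.+1) / k.+1%:R) * t ^+ k.+1) (P (x ^+ k.+1) * t ^+ k).
    have := is_deriveZ (P (x ^+ k.+1) / k.+1%:R) (is_derive_expn t k).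
    by rewrite /GRing.scale /= mulrA divfK// pnatr_eq0.
  exact: is_derive_sum.
have n1 (t : R) : t \in `[0, 1] -> normc (t%:C * x) <= normc x.
  rewrite in_itv /= => /andP[t0 t1]; rewrite normcM normc_real ger0_norm//.
  by rewrite ler_piMl ?normc_ge0.
have nz (t : R) : t \in `[0, 1] -> 1 - t%:C * x != 0.
  move=> t01; rewrite subr_eq0; apply: contraTneq (le_lt_trans (n1 _ t01) x1) => <-.
  by rewrite normc1 ltxx.
have sumE (t : R) : t \in `[0, 1] ->
    \sum_(k < N) P (x ^+ k.+1) * t ^+ k + P (- x / (1 - t%:C * x)) =
    P (- x * (t%:C * x) ^+ N / (1 - t%:C * x)).
  move=> t01; have -> : \sum_(k < N) P (x ^+ k.+1) * t ^+ k =
      P (\sum_(k < N) x * (t%:C * x) ^+ k).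
    rewrite Psum; apply: eq_bigr => k _; rewrite mulrC -PZ; congr P.
    by rewrite exprMn exprS -rmorphXn /=; ring.
  rewrite -PD -mulr_sumr; congr P; apply: (mulIf (nz t t01)).
  rewrite mulrDl !divfK ?nz// -mulrA [X in x * X]mulrC.
  have := subrXX 1 (t%:C * x) N; rewrite expr1n.
  under eq_bigr do rewrite expr1n mul1r.
  by move=> <-; ring.
have dF (t : R) : t \in `[0, 1] ->
    is_derive t (1 : R) F (P (- x * (t%:C * x) ^+ N / (1 - t%:C * x))).
  by move=> t01; rewrite -sumE//; exact: (is_deriveD (dS t) (dL t t01)).
have FE : P (\sum_(k < N) x ^+ k.+1 / k.+1%:R) + L 1 - L 0 = F 1 - F 0.
  rewrite /F /S Psum; under [in RHS]eq_bigr do rewrite expr1n mulr1.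
  rewrite [X in _ - (X + _)]big1; last by move=> k _; rewrite expr0n mulr0.
  rewrite add0r; congr (_ + _ - _); apply: eq_bigr => k _.
  by rewrite mulrC -(rmorph_nat (real_complex R)) -fmorphV PZ mulrC.
rewrite FE.
have dF' (t : R) : t \in `]0, 1[ ->
    is_derive t (1 : R) F (P (- x * (t%:C * x) ^+ N / (1 - t%:C * x))).
  by move=> t01; apply: dF; exact: subset_itv_oo_cc.
have cF : {within `[0, 1], continuous F}.
  by apply: derivable_within_continuous => t t01; have [] := dF t t01.
have [c c01] := MVT ltr01 dF' cF.
rewrite subr0 mulr1 => ->; have c01' : c \in `[0, 1] by exact: subset_itv_oo_cc.
rewrite (le_trans (Pn _))// normcM normcV normcM normcN normcX exprS -!mulrA.
apply: ler_wpM2l; first exact: normc_ge0.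
apply: ler_pM; rewrite ?invr_ge0 ?exprn_ge0 ?normc_ge0//.
  by rewrite lerXn2r ?nnegrE ?normc_ge0// n1.
rewrite lef_pV2 ?posrE ?subr_gt0//; last by rewrite normc_gt0 nz.
rewrite lerBlDr -[X in X <= _](normc1 R) -{1}(subrK (c%:C * x) 1).
by rewrite (le_trans (le_normcD _ _))// lerD2l n1.
Qed.

Lemma is_derive_aff (c d t : R) : is_derive t (1 : R) (fun t => c + t * d) d.
Proof.
have -> : (fun t : R => c + t * d) = (cst c + d \*: id).
  by apply/funext => u; rewrite /= /GRing.scale /= mulrC.
have := is_deriveD (is_derive_cst c t (1 : R)) (is_deriveZ d (is_derive_id t (1 : R))).
by rewrite add0r /GRing.scale /= mulr1.
Qed.

Lemma ln_normc (z : R[i]) : ln (normc z) = 2^-1 * ln (normc z ^+ 2).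
Proof.
have [->|z0] := eqVneq z 0; first by rewrite normc0 expr0n /= ln0 ?mulr0.
by rewrite lnXn ?normc_gt0// mulr2n; field.
Qed.

Section Ray.
Variables (x : R[i]) (t : R).
Hypothesis pos : 0 < Re (1 - t%:C * x).

Let ReE u : Re (1 - u%:C * x) = 1 + u * - Re x.
Proof. by case: x => a b /=; ring. Qed.

Let ImE u : Im (1 - u%:C * x) = 0 + u * - Im x.
Proof. by case: x => a b /=; ring. Qed.

Let D := (1 + t * - Re x) ^+ 2 + (0 + t * - Im x) ^+ 2.

Let D0 : 0 < D.
Proof. by rewrite /D ltr_wpDr ?sqr_ge0// exprn_gt0// -ReE. Qed.

Let derE : - x / (1 - t%:C * x) =
  ((- Re x * (1 + t * - Re x) + Im x * (t * Im x)) / D) +i* (- Im x / D).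
Proof.
have z0 : 1 - t%:C * x != 0.
  by apply: contraTneq pos => ->; rewrite ltxx.
apply: (mulIf z0); rewrite divfK//; apply/eqP; rewrite eq_complex.
rewrite Re_mulc Im_mulc ReE ImE Re_oppc Im_oppc /=.
have Dn : D != 0 by rewrite gt_eqF.
by apply/andP; split; apply/eqP; rewrite /D; field;
  apply: contra_neq Dn => h; apply: etrans h; rewrite /D; ring.
Qed.

Lemma is_derive_ln_ray :
  is_derive t (1 : R) (fun u => ln (normc (1 - u%:C * x))) (Re (- x / (1 - t%:C * x))).
Proof.
rewrite derE /=.
pose g := (fun u : R => 1 + u * - Re x) ^+ 2 + (fun u : R => 0 + u * - Im x) ^+ 2.
have -> : (fun u => ln (normc (1 - u%:C * x))) = 2^-1 \*: (@ln R \o g).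
  by apply/funext => u; rewrite ln_normc normc_sqr ReE ImE.
have d2 := is_deriveD (is_deriveX 2 (is_derive_aff 1 (- Re x) t))
  (is_deriveX 2 (is_derive_aff 0 (- Im x) t)).
have := is_deriveZ 2^-1 (is_derive1_comp (g := g) (is_derive1_ln D0) d2).
move=> /is_derive_eq; apply; rewrite /GRing.scale /= /D.
have Dn : D != 0 by rewrite gt_eqF.
rewrite /D; field.
by apply: contra_neq Dn => h; apply: etrans h; rewrite /D; ring.
Qed.

Lemma is_derive_atan_ray :
  is_derive t (1 : R) (fun u => atan (Im (1 - u%:C * x) / Re (1 - u%:C * x)))
    (Im (- x / (1 - t%:C * x))).
Proof.
have p0 : 1 + t * - Re x != 0 by rewrite -ReE gt_eqF.
rewrite derE /=.
pose g := (fun u : R => 0 + u * - Im x) * (fun u : R => (1 + u * - Re x)^-1).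
have -> : (fun u => atan (Im (1 - u%:C * x) / Re (1 - u%:C * x))) = @atan R \o g.
  by apply/funext => u; rewrite /= ReE ImE.
have d2 := is_deriveM (is_derive_aff 0 (- Im x) t)
  (is_deriveV (f := fun u => 1 + u * - Re x) p0 (is_derive_aff 1 (- Re x) t)).
have := is_derive1_comp (g := g) (is_derive1_atan _) d2.
move=> /is_derive_eq; apply; rewrite /GRing.scale /=.
have Dn : D != 0 by rewrite gt_eqF.
have -> : g t = (0 + t * - Im x) * (1 + t * - Re x)^-1 by [].
rewrite /D; field; apply/andP; split; last exact: p0.
by apply: contra_neq Dn => h; apply: etrans h; rewrite /D; ring.
Qed.

End Ray.

Lemma Ln_series x : normc x < 1 ->
  ctends (fun N => \sum_(k < N) x ^+ k.+1 / k.+1%:R) (- Ln (1 - x)).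
Proof.
move=> x1.
have pos (t : R) : t \in `[0, 1] -> 0 < Re (1 - t%:C * x).
  rewrite in_itv /= => /andP[t0 t1]; apply: Re_1B; rewrite normcM normc_real ger0_norm//.
  by apply: le_lt_trans x1; rewrite ler_piMl ?normc_ge0.
have ReZ (c : R) z : Re (c%:C * z) = c * Re z by rewrite Re_mulc /= mul0r subr0.
have ImZ (c : R) z : Im (c%:C * z) = c * Im z by rewrite Im_mulc /= mul0r addr0.
have hR N := @ray_remainder (@complex.Re R) _ x N (@Re_addc R)
  ReZ (@normr_Re_le R) x1 (fun t t01 => is_derive_ln_ray (pos t t01)).
have hI N := @ray_remainder (@complex.Im R) _ x N (@Im_addc R)
  ImZ (@normr_Im_le R) x1 (fun t t01 => is_derive_atan_ray (pos t t01)).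
have LE : Ln (1 - x) = ln (normc (1 - x)) +i* atan (Im (1 - x) / Re (1 - x)).
  by rewrite LnE// Re_1B.
pose e N := normc x ^+ N.+1 / (1 - normc x).
apply: (@squeeze_cvgr _ _ _ _ (fun=> 0) (fun N => e N + e N)).
- apply: nearW => N; rewrite normc_ge0 opprK /= LE.
  rewrite (le_trans (normc_le_ReIm _))//.
  rewrite (Re_addc (\sum_(k < N) _)) (Im_addc (\sum_(k < N) _)).
  have := hR N; have := hI N; rewrite !mul1r !mul0r subr0 normc1 ln1 subr0.
  rewrite [Im 1]/= [Re 1]/= mul0r atan0 subr0 => h1 h2.
  exact: lerD.
- exact: cvg_cst.
- have e0 : e @ \oo --> (0 : R).
    rewrite -(mul0r (1 - normc x)^-1); apply: cvgM; last exact: cvg_cst.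
    rewrite (cvg_shiftS (fun n => normc x ^+ n)).
    by apply: cvg_expr; rewrite ger0_norm ?normc_ge0.
  by rewrite -[X in _ --> X](addr0 (0 : R)); exact: cvgD.
Qed.

End Logarithm.

(** * The logarithmic kernel *)

Section LogKernel.
Variable R : realType.
Local Notation mu := (@lebesgue_measure R).
Local Notation TR := (measurableTypeR R).
Local Notation RR := (TR * TR)%type.
Local Notation plane := (@plane R).
Local Notation sqmod := (@sqmod R).
Local Notation toC := (@toC R).
Local Notation chi := (@chi R).

Lemma normc_sqr_itv (w : R[i]) (i : interval R) :
  chi [set` i] w != 0 -> normc w ^+ 2 \in i.
Proof. by move=> /chi_neq0. Qed.

Lemma itv_oc_sub_disk (a b : R) : 0 <= a -> `]a, b]%classic `<=` (`[0, b]%classic : set TR).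
Proof.
by move=> a0 t /=; rewrite !in_itv /= => /andP[/ltW/(le_trans a0) -> ->].
Qed.

(** On a ring around [z] the only surviving term is [z^j (w * w^* )^-(j + 1)]. *)
Lemma ring_conj_invn (rho a c : R) (z : R[i]) j : 0 < rho -> 0 < a ->
  normc z ^+ 2 <= a -> normc z <= rho ->
  (\int[mu]_(t in `]a, (rho ^+ 2)%R]) (t ^- j.+1)%:E = c%:E)%E ->
  cint plane (fun p => chi `]a, (rho ^+ 2)]%classic (toC p) *
                         ((toC p)^* ^- j.+1 / (toC p - z))) =
  z ^+ j * (pi * c)%:C.
Proof.
move=> rho0 a0 za zr ic; pose E : set TR := `]a, (rho ^+ 2)]%classic.
have mE : measurable E by exact: measurable_itv.
have Er : E `<=` `[0, (rho ^+ 2)] by apply: itv_oc_sub_disk; exact: ltW.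
have Ea w : chi E w != 0 -> a < normc w ^+ 2.
  by move=> /normc_sqr_itv; rewrite in_itv /= => /andP[].
have Ew w : chi E w != 0 -> w != 0.
  by move=> /Ea; apply: contraTneq => ->; rewrite normc0 expr0n /= -leNgt ltW.
have mphi : cmeasurable (fun p => (toC p)^* ^- j.+1).
  apply: cmeasurableV; apply: cmeasurableX; apply: cmeasurable_conj.
  exact: cmeasurable_toC.
have ii : cintegrable plane
    (fun p => chi E (toC p) * ((toC p)^* ^- j.+1 / (toC p - z))).
  apply: (chi_div_integrable (phi := fun w => w^* ^- j.+1)
    (K := (Num.sqrt a) ^- j.+1) rho0) => // w cE.
  have sa : 0 < Num.sqrt a by rewrite sqrtr_gt0.
  have nw : 0 < normc w by rewrite normc_gt0; exact: Ew cE.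
  rewrite normcV normcX normc_conj lef_pV2 ?posrE ?exprn_gt0//.
  rewrite lerXn2r ?nnegrE ?ltW//.
  rewrite -ltr_sqr ?nnegrE ?ltW// sqr_sqrtr ?ltW//; exact: Ea.
pose q p := z / toC p.
have mq : cmeasurable q.
  apply: cmeasurableM; first exact: cmeasurable_cst.
  by apply: cmeasurableV; exact: cmeasurable_toC.
have [|it cv] := geometric_dominated_cvg ii mq.
  move=> p; rewrite mulf_eq0 negb_or => /andP[cE _].
  rewrite /q normcM normcV ltr_pdivrMr; last by rewrite normc_gt0; exact: Ew cE.
  rewrite mul1r -ltr_sqr ?nnegrE ?normc_ge0//.
  exact: le_lt_trans za (Ea _ cE).
have tE k : (fun p => chi E (toC p) * ((toC p)^* ^- j.+1 / (toC p - z)) *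
    (1 - q p) * q p ^+ k) =
    (fun p => z ^+ k * (chi E (toC p) * (toC p ^ (- k.+1%:Z) * (toC p)^* ^ (- j.+1%:Z)))).
  apply/funext => p; have [->|cE] := eqVneq (chi E (toC p)) 0.
    by rewrite !mul0r mulr0.
  have w0 := Ew _ cE.
  have wz : toC p - z != 0.
    rewrite subr_eq0; apply: contraTneq (Ea _ cE) => ->.
    by rewrite -leNgt.
  have wc0 : (toC p)^* ^+ j.+1 != 0 by rewrite expf_neq0// conjC_eq0.
  rewrite /q -!exprnN exprMn exprVn (exprS (toC p)); field.
  by rewrite wc0 w0 wz expf_neq0.
have off k : k != j -> cint plane (fun p => chi E (toC p) *
    ((toC p)^* ^- j.+1 / (toC p - z)) * (1 - q p) * q p ^+ k) = 0.
  move=> kj; rewrite tE; apply: moment_off_diagonalZ.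
    by rewrite eqr_opp.
  by rewrite -tE; exact: it.
have mf : measurable_fun setT (fun t : R => t ^- j.+1).
  by apply: measurable_invr; exact: exprn_measurable.
have [||||i1 c1] := @radial_moment _ E (fun t => t ^- j.+1) c mE.
- by move=> t /Er /=; rewrite !in_itv /= andbT => /andP[].
- exact: mf.
- by move=> t /Er /=; rewrite in_itv /= => /andP[t0 _]; rewrite invr_ge0 exprn_ge0.
- exact: ic.
have diag : cint plane (fun p => chi E (toC p) *
    ((toC p)^* ^- j.+1 / (toC p - z)) * (1 - q p) * q p ^+ j) = z ^+ j * (pi * c)%:C.
  rewrite tE.
  have -> : (fun p => z ^+ j * (chi E (toC p) * (toC p ^ (- j.+1%:Z) * (toC p)^* ^ (- j.+1%:Z)))) =
      (fun p => z ^+ j * (chi E (toC p) * ((sqmod p ^- j.+1) : R)%:C)).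
    apply/funext => p; rewrite -!exprnN -invfM -exprMn mulCJ -sqmodE.
    by rewrite -rmorphXn /= fmorphV.
  by rewrite cintZ// c1.
apply: (ctends_near cv); exists j.+1 => // N /= jN.
rewrite (bigD1 (Ordinal jN)) //= diag big1 ?addr0// => k kj.
by apply: off; apply: contraNneq kj => kj; apply/eqP/val_inj.
Qed.

Lemma integral_inv_oc (a b : R) : 0 < a -> a <= b ->
  (\int[mu]_(t in `]a, b]) (t ^- 1)%:E = (ln b - ln a)%:E)%E.
Proof.
move=> a0; rewrite le_eqVlt => /predU1P[<-|ab].
  by rewrite subrr set_itvoc0 integral_set0.
rewrite integral_itv_obnd_cbnd ?integral_inv//.
by apply/measurable_EFinP/measurable_funTS/measurable_invr; exact: exprn_measurable.
Qed.

Lemma integral_invn_oc (a b : R) n : 0 < a -> a <= b ->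
  (\int[mu]_(t in `]a, b]) (t ^- n.+2)%:E = ((a ^- n.+1 - b ^- n.+1) / n.+1%:R)%:E)%E.
Proof.
move=> a0; rewrite le_eqVlt => /predU1P[<-|ab].
  by rewrite subrr mul0r set_itvoc0 integral_set0.
rewrite integral_itv_obnd_cbnd ?integral_invn//.
by apply/measurable_EFinP/measurable_funTS/measurable_invr; exact: exprn_measurable.
Qed.

Section Kernel.
Variables (r : R) (z e : R[i]).
Hypotheses (r0 : 0 < r) (ze : normc z < normc e) (er : normc e <= r).

Let m : R := normc e ^+ 2.
Let g (w : R[i]) := (w - z)^-1 * (w^* - e^*)^-1.

Let e0 : e != 0.
Proof. by rewrite -normc_gt0 (le_lt_trans (normc_ge0 z)). Qed.
Let m0 : 0 < m. Proof. by rewrite exprn_gt0// normc_gt0. Qed.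
Let zr : normc z <= r. Proof. exact: le_trans (ltW ze) er. Qed.
Let zm : normc z ^+ 2 <= m.
Proof. by rewrite ler_sqr ?nnegrE ?normc_ge0// ltW. Qed.
Let mr : m <= r ^+ 2.
Proof. by rewrite ler_sqr ?nnegrE ?normc_ge0// ltW. Qed.

Let gi (E : set TR) : measurable E -> E `<=` `[0, (r ^+ 2)] ->
  cintegrable plane (fun p => chi E (toC p) * g (toC p)).
Proof.
move=> mE Er; have zne : z != e by apply: contraTneq ze => ->; rewrite ltxx.
apply: (cintegrable_le _ (inv_inv_integrable r0 zr er zne)).
  apply: cmeasurableM; first exact: cmeasurable_chi.
  apply: cmeasurableM; apply: cmeasurableV; first exact: cmeasurable_toC_sub.
  apply: cmeasurableB; last exact: cmeasurable_cst.
  by apply: cmeasurable_conj; exact: cmeasurable_toC.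
move=> p; rewrite /g normcM normcM !normcV -rmorphB normc_conj.
apply: ler_wpM2r; first by rewrite mulr_ge0 ?invr_ge0 ?normc_ge0.
exact: chi_bound.
Qed.

Let inner : cint plane (fun p => chi `[0%R, m[%classic (toC p) * g (toC p)) =
  - (pi : R)%:C * Ln (1 - z^* / e^*).
Proof.
pose E : set TR := `[0%R, m[%classic.
have mE : measurable E by exact: measurable_itv.
have Er : E `<=` `[0, (r ^+ 2)].
  by move=> t; rewrite /E /= !in_itv /= => /andP[-> /ltW/le_trans]; apply.
have ec0 : e^* != 0 by rewrite conjC_eq0.
pose q p := (toC p)^* / e^*.
have mq : cmeasurable q.
  apply: cmeasurableM; last exact: cmeasurable_cst.
  by apply: cmeasurable_conj; exact: cmeasurable_toC.
have Em w : chi E w != 0 -> normc w < normc e.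
  move=> /normc_sqr_itv; rewrite in_itv /= => /andP[_].
  by rewrite ltr_sqr ?nnegrE ?normc_ge0.
have [|it cv] := geometric_dominated_cvg (gi mE Er) mq.
  move=> p; rewrite mulf_eq0 negb_or => /andP[/Em h _].
  by rewrite /q normcM normcV !normc_conj ltr_pdivrMr ?normc_gt0// mul1r.
have term k : cint plane (fun p => chi E (toC p) * g (toC p) * (1 - q p) * q p ^+ k) =
    (pi : R)%:C * ((z^* / e^*) ^+ k.+1 / k.+1%:R).
  have ik : cintegrable plane (fun p => chi `[0%R, m]%classic (toC p) *
      ((toC p)^* ^+ k / (toC p - z))).
    apply: (chi_div_integrable (phi := fun w => w^* ^+ k) (rho := normc e)
      (K := normc e ^+ k)).
    - by rewrite normc_gt0.
    - exact: measurable_itv.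
    - by [].
    - exact: ltW.
    - by apply: cmeasurableX; apply: cmeasurable_conj; exact: cmeasurable_toC.
    move=> w /normc_sqr_itv; rewrite in_itv /= => /andP[_ h].
    by rewrite normcX normc_conj lerXn2r ?nnegrE ?normc_ge0// -ler_sqr ?nnegrE ?normc_ge0.
  have -> : cint plane (fun p => chi E (toC p) * g (toC p) * (1 - q p) * q p ^+ k) =
      cint plane (fun p => - e^* ^- k.+1 * (chi `[0%R, m]%classic (toC p) *
        ((toC p)^* ^+ k / (toC p - z)))).
    apply: (@cint_ae_eq _ _ _ _ (sqmod @^-1` [set m])).
    - by apply: measurable_sqmod_preimage; exact: measurable_set1.
    - exact: (measure_circle (ltW m0)).
    - exact: (cintegrable_measurable (it k)).
    - exact: (cintegrable_measurable (cintegrableZ _ ik)).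
    move=> p /= /eqP pm.
    have -> : chi `[0%R, m]%classic (toC p) = chi E (toC p).
      rewrite !chi_toC; congr (_ %:C); rewrite !mem_setE !in_itv /= sqmod_ge0 /=.
      by rewrite le_eqVlt (negbTE pm).
    have [->|cE] := eqVneq (chi E (toC p)) 0; first by rewrite !mul0r mulr0.
    have [wz|wz] := eqVneq (toC p) z.
      by rewrite /g wz subrr invr0 !(mul0r, mulr0).
    have wz' : toC p - z != 0 by rewrite subr_eq0.
    have we : (toC p)^* - e^* != 0.
      by rewrite -rmorphB conjC_eq0 subr_eq0; apply: contraTneq (Em _ cE) => ->; rewrite ltxx.
    rewrite /g /q exprMn exprVn (exprS e^*); field.
    by rewrite wz' we ec0 expf_neq0.
  rewrite cintZ// disk_conj_power ?normc_gt0//; last exact: ltW.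
  by rewrite exprMn exprVn; field; rewrite expf_neq0// nat1r pnatr_eq0.
apply: (ctends_unique cv).
have zq : normc (z^* / e^*) < 1.
  by rewrite normcM normcV !normc_conj ltr_pdivrMr ?mul1r ?normc_gt0.
rewrite (_ : (fun N => _) =
  (fun N => (pi : R)%:C * \sum_(k < N) (z^* / e^*) ^+ k.+1 / k.+1%:R)); last first.
  by apply/funext => N; rewrite mulr_sumr; apply: eq_bigr => k _; exact: term.
by rewrite mulNr -mulrN; apply: ctendsZ; exact: Ln_series.
Qed.

Let outer : cint plane (fun p => chi `]m, (r ^+ 2)]%classic (toC p) * g (toC p)) =
  (pi : R)%:C * ((ln (r ^+ 2 / m))%:C - Ln (1 - z / e) + Ln (1 - z * e^* / (r ^+ 2)%:C)).
Proof.
pose E : set TR := `]m, (r ^+ 2)]%classic.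
have mE : measurable E by exact: measurable_itv.
have Er : E `<=` `[0, (r ^+ 2)] by apply: itv_oc_sub_disk; exact: ltW.
have ec0 : e^* != 0 by rewrite conjC_eq0.
have Em w : chi E w != 0 -> normc e < normc w.
  move=> /normc_sqr_itv; rewrite in_itv /= => /andP[+ _].
  by rewrite ltr_sqr ?nnegrE ?normc_ge0.
pose q p := e^* / (toC p)^*.
have mq : cmeasurable q.
  apply: cmeasurableM; first exact: cmeasurable_cst.
  by apply: cmeasurableV; apply: cmeasurable_conj; exact: cmeasurable_toC.
have [|it cv] := geometric_dominated_cvg (gi mE Er) mq.
  move=> p; rewrite mulf_eq0 negb_or => /andP[/Em h _].
  rewrite /q normcM normcV !normc_conj ltr_pdivrMr ?mul1r//.
  exact: le_lt_trans (normc_ge0 e) h.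
pose c k : R := if k is k'.+1 then (m ^- k'.+1 - (r ^+ 2) ^- k'.+1) / k'.+1%:R
  else ln (r ^+ 2) - ln m.
have term k : cint plane (fun p => chi E (toC p) * g (toC p) * (1 - q p) * q p ^+ k) =
    (pi : R)%:C * ((z * e^*) ^+ k * (c k)%:C).
  have gE : (fun p => chi E (toC p) * g (toC p) * (1 - q p) * q p ^+ k) =
      (fun p => e^* ^+ k * (chi E (toC p) * ((toC p)^* ^- k.+1 / (toC p - z)))).
    apply/funext => p.
    have [->|cE] := eqVneq (chi E (toC p)) 0; first by rewrite !mul0r mulr0.
    have h := Em _ cE.
    have wz : toC p - z != 0.
      rewrite subr_eq0; apply: contraTneq h => ->.
      by rewrite -leNgt ltW.
    have we : (toC p)^* - e^* != 0.
      by rewrite -rmorphB conjC_eq0 subr_eq0; apply: contraTneq h => ->; rewrite ltxx.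
    have w0 : (toC p)^* != 0.
      by rewrite conjC_eq0 -normc_gt0; exact: le_lt_trans (normc_ge0 e) h.
    rewrite /g /q exprMn exprVn (exprS (toC p)^*); field.
    by rewrite wz we w0 expf_neq0.
  have ik : cintegrable plane (fun p => chi E (toC p) *
      ((toC p)^* ^- k.+1 / (toC p - z))).
    have := cintegrableZ (e^* ^- k) (it k); congr cintegrable.
    by apply/funext => p; rewrite (congr1 (fun F => F p) gE) mulKf// expf_neq0.
  rewrite gE.
  rewrite cintZ// (@ring_conj_invn _ _ (c k)) //; last first.
    case: k {ik it gE} => [|k]; first exact: integral_inv_oc.
    exact: integral_invn_oc.
  by rewrite exprMn rmorphM /=; ring.
apply: (ctends_unique cv).
have cvS s l : ctends (fun N => s N.+1 : R[i]) l -> ctends s l.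
  by rewrite /ctends (cvg_shiftS (fun n => normc (s n - l))).
apply: cvS.
have mE' : (m : R)%:C = e * e^* by rewrite mulCJ.
have ne : normc (z / e) < 1.
  by rewrite normcM normcV ltr_pdivrMr ?mul1r ?normc_gt0.
have nr : normc (z * e^* / (r ^+ 2)%:C) < 1.
  rewrite normcM normcV normc_real ger0_norm ?sqr_ge0// ltr_pdivrMr ?exprn_gt0// mul1r.
  rewrite normcM normc_conj expr2; apply: (lt_le_trans (y := normc e * normc e)).
    by rewrite ltr_pM2r// normc_gt0.
  by rewrite ler_pM ?normc_ge0.
have r20 : (r ^+ 2)%:C != 0 :> R[i] by rewrite -(rmorph0 (real_complex R)) (inj_eq (@complexI R)) gt_eqF ?exprn_gt0.
rewrite (_ : (fun N => _) = (fun N => (pi : R)%:C * ((ln (r ^+ 2 / m))%:C +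
    \sum_(k < N) (z / e) ^+ k.+1 / k.+1%:R -
    \sum_(k < N) (z * e^* / (r ^+ 2)%:C) ^+ k.+1 / k.+1%:R))).
  apply: ctendsZ; rewrite -[X in _ + X]opprK.
  apply: ctendsD; first by apply: ctendsD; [exact: ctends_cst|exact: Ln_series].
  by apply: ctendsN; exact: Ln_series.
apply/funext => N; rewrite big_ord_recl term expr0 mul1r /= ln_div ?posrE ?exprn_gt0 ?normc_gt0//.
rewrite -addrA mulrDr; congr (_ + _); rewrite -sumrB mulr_sumr.
apply: eq_bigr => k _; rewrite /bump /= add1n term /=.
have -> : ((m ^- k.+1 - (r ^+ 2) ^- k.+1) / k.+1%:R)%:C =
    ((e * e^*) ^- k.+1 - (r ^+ 2)%:C ^- k.+1) / k.+1%:R.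
  by rewrite -mE' -!rmorphXn -!fmorphV -rmorphB -(rmorph_nat (real_complex R)) -fmorphV -rmorphM.
rewrite !exprMn !exprVn; field.
by rewrite nat1r pnatr_eq0 !expf_neq0.
Qed.

Lemma log_kernel_lt :
  cint plane (fun p => chi `[0%R, (r ^+ 2)]%classic (toC p) * g (toC p)) =
  (pi : R)%:C * Ln (((r ^+ 2)%:C - z * e^*) / (normc (z - e) ^+ 2)%:C).
Proof.
rewrite (@cint_split_circle _ _ m); last first.
- by apply: gi; [exact: measurable_itv|apply: itv_oc_sub_disk; exact: ltW].
- apply: gi; first exact: measurable_itv.
  by move=> t; rewrite /= !in_itv /= => /andP[-> /ltW/le_trans]; apply.
- by apply: gi; first exact: measurable_itv.
- by rewrite (ltW m0) mr.
rewrite inner outer mulNr -mulrN -mulrDr; congr (_ * _).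
have ne : normc (z / e) < 1.
  by rewrite normcM normcV ltr_pdivrMr ?mul1r ?normc_gt0.
have nr : normc (z * e^* / (r ^+ 2)%:C) < 1.
  rewrite normcM normcV normc_real ger0_norm ?sqr_ge0// ltr_pdivrMr ?exprn_gt0// mul1r.
  rewrite normcM normc_conj expr2; apply: (lt_le_trans (y := normc e * normc e)).
    by rewrite ltr_pM2r// normc_gt0.
  by rewrite ler_pM ?normc_ge0.
have r20 : (r ^+ 2)%:C != 0 :> R[i].
  by rewrite -(rmorph0 (real_complex R)) (inj_eq (@complexI R)) gt_eqF ?exprn_gt0.
set w := 1 - z / e; have w0 : 0 < Re w by exact: Re_1B.
have nw : 0 < normc w.
  by rewrite normc_gt0; apply: contraTneq w0 => ->; rewrite ltxx.
have zew : normc (z - e) = normc e * normc w.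
  rewrite -normcM normc_distC /w mulrBr mulr1 mulrCA divff ?mulr1//.
have -> : 1 - z^* / e^* = w^* by rewrite rmorphB rmorph1 rmorphM /= fmorphV.
have c0 : 0 < r ^+ 2 / normc (z - e) ^+ 2.
  by rewrite divr_gt0 ?exprn_gt0// zew mulr_gt0// normc_gt0.
have -> : ((r ^+ 2)%:C - z * e^*) / (normc (z - e) ^+ 2)%:C =
    (r ^+ 2 / normc (z - e) ^+ 2)%:C * (1 - z * e^* / (r ^+ 2)%:C).
  rewrite [in RHS]rmorphM fmorphV /= mulrAC mulrBr mulr1; congr (_ / _).
  by rewrite mulrCA divff ?mulr1.
rewrite Ln_scale//; last exact: Re_1B.
rewrite !addrA; congr (_ + _).
rewrite (addrC (- Ln w^*)) -addrA -opprD (addrC (Ln w^*)) LnD_conj// -rmorphB /=.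
congr (_ %:C).
have ne0 : 0 < normc e by rewrite normc_gt0.
rewrite zew /m !ln_div ?posrE ?exprn_gt0 ?mulr_gt0// !lnXn ?mulr_gt0//.
by rewrite lnM ?posrE// !mulr2n; ring.
Qed.

End Kernel.

Lemma log_kernel (r : R) (z e : R[i]) : 0 < r -> normc z <= r -> normc e <= r ->
  normc z != normc e ->
  cint plane (fun p => chi `[0%R, (r ^+ 2)]%classic (toC p) *
                         ((toC p - z)^-1 * ((toC p)^* - e^*)^-1)) =
  (pi : R)%:C * Ln (((r ^+ 2)%:C - z * e^*) / (normc (z - e) ^+ 2)%:C).
Proof.
move=> r0 zr er; rewrite neq_lt => /orP[ze|ez]; first exact: log_kernel_lt.
have h := log_kernel_lt r0 ez zr.
have ze : e != z by apply: contraTneq ez => ->; rewrite ltxx.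
have i1 : cintegrable plane (fun p => chi `[0%R, (r ^+ 2)]%classic (toC p) *
    ((toC p - e)^-1 * ((toC p)^* - z^*)^-1)).
  apply: (cintegrable_le _ (inv_inv_integrable r0 er zr ze)).
    apply: cmeasurableM; first by apply: cmeasurable_chi; exact: measurable_itv.
    apply: cmeasurableM; apply: cmeasurableV; first exact: cmeasurable_toC_sub.
    apply: cmeasurableB; last exact: cmeasurable_cst.
    by apply: cmeasurable_conj; exact: cmeasurable_toC.
  move=> p; rewrite normcM normcM !normcV -rmorphB normc_conj.
  apply: ler_wpM2r; first by rewrite mulr_ge0 ?invr_ge0 ?normc_ge0.
  exact: chi_bound.
transitivity ((cint plane (fun p => chi `[0%R, (r ^+ 2)]%classic (toC p) *
    ((toC p - e)^-1 * ((toC p)^* - z^*)^-1)))^*).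
  rewrite -cint_conj//; apply: eq_cint => p.
  rewrite rmorphM /= conj_chi rmorphM /= !fmorphV /= !rmorphB /= [(toC p)^*^*]conjCK [z^*^*]conjCK.
  by congr (_ * _); rewrite mulrC.
rewrite h rmorphM /=; congr (_ * _); first by apply/eqP; rewrite eq_complex /= oppr0 !eqxx.
rewrite -Ln_conj.
  congr Ln; rewrite rmorphM /= fmorphV /= (normc_distC e z).
  have ezE : (e * z^*)^* = z * e^* by rewrite rmorphM /= [z^*^*]conjCK mulrC.
  rewrite rmorphB /= ezE.
  have cr (x : R) : (x%:C)^* = x%:C by apply/eqP; rewrite eq_complex /= oppr0 !eqxx.
  by rewrite !cr.
have d0 : 0 < normc (e - z) ^+ 2 by rewrite exprn_gt0// normc_gt0 subr_eq0.
rewrite -fmorphV mulrC Re_mulc /= mul0r subr0 mulr_gt0 ?invr_gt0//.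
rewrite Re_addc Re_oppc subr_gt0 /=.
apply: (le_lt_trans (ler_norm _)); apply: (le_lt_trans (normr_Re_le _)).
rewrite normcM normc_conj expr2; apply: (lt_le_trans (y := normc z * normc z)).
  rewrite ltr_pM2r// (le_lt_trans (normc_ge0 e) ez)//.
by rewrite ler_pM ?normc_ge0.
Qed.

End LogKernel.

(** * The kernel as an integral *)

Section KernelFormula.
Variables (R : realType) (r : R).
Hypothesis r0 : 0 < r.
Local Notation mu := (@lebesgue_measure R).
Local Notation TR := (measurableTypeR R).
Local Notation RR := (TR * TR)%type.
Local Notation plane := (@plane R).
Local Notation sqmod := (@sqmod R).
Local Notation toC := (@toC R).
Local Notation DD := (`[0%R, (r ^+ 2)%R]%classic : set TR).
Local Notation chiD := (chi DD).

Lemma cmeasurable_chiD : cmeasurable (fun p => chiD (toC p)).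
Proof. by apply: cmeasurable_chi; exact: measurable_itv. Qed.

Lemma chiD_le w : chiD w != 0 -> normc w <= r.
Proof.
move=> /normc_sqr_itv; rewrite in_itv /= => /andP[_].
by rewrite ler_sqr ?nnegrE ?normc_ge0// ltW.
Qed.

Lemma chiD_bounded_integrable (g : R[i] -> R[i]) K :
  cmeasurable (fun p => g (toC p)) -> (forall w, normc w <= r -> normc (g w) <= K) ->
  cintegrable plane (fun p => chiD (toC p) * g (toC p)).
Proof.
move=> mg gK; apply: (cintegrable_le _ (rintegrableZ `|K| (rintegrable_inD r0))).
  by apply: cmeasurableM => //; exact: cmeasurable_chiD.
move=> p; have [->|cD] := eqVneq (chiD (toC p)) 0.
  by rewrite mul0r normc0 mulr_ge0 ?inD_ge0.
rewrite normcM mulrC; apply: ler_pM; rewrite ?normc_ge0//; last exact: chi_bound.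
by apply: le_trans (gK _ (chiD_le cD)) (ler_norm _).
Qed.

Lemma cmeasurable_toCX a : cmeasurable (fun p => toC p ^+ a).
Proof. by apply: cmeasurableX; exact: cmeasurable_toC. Qed.

Lemma cmeasurable_toCJX b : cmeasurable (fun p => (toC p)^* ^+ b).
Proof. by apply: cmeasurableX; apply: cmeasurable_conj; exact: cmeasurable_toC. Qed.

Lemma normc_monomial_le w a b : normc w <= r -> normc (w ^+ a * w^* ^+ b) <= r ^+ a * r ^+ b.
Proof.
move=> wr; rewrite normcM !normcX normc_conj.
by apply: ler_pM; rewrite ?exprn_ge0 ?normc_ge0// lerXn2r ?nnegrE ?normc_ge0 ?(ltW r0).
Qed.

Lemma monomial_integrable a b :
  cintegrable plane (fun p => chiD (toC p) * (toC p ^+ a * (toC p)^* ^+ b)).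
Proof.
apply: (chiD_bounded_integrable (g := fun w => w ^+ a * w^* ^+ b) (K := r ^+ a * r ^+ b)).
  by apply: cmeasurableM; [exact: cmeasurable_toCX|exact: cmeasurable_toCJX].
by move=> w; exact: normc_monomial_le.
Qed.

Lemma disk_moment a b :
  cint plane (fun p => chiD (toC p) * (toC p ^+ a * (toC p)^* ^+ b)) =
  if a == b then (pi * ((r ^+ 2) ^+ b.+1 / b.+1%:R))%:C else 0.
Proof.
case: eqVneq => [->|ab]; last first.
  by apply: (@moment_off_diagonal _ DD a%:Z b%:Z) => //; exact: monomial_integrable.
have mD : measurable DD by exact: measurable_itv.
have [||||_ <-] := @radial_moment _ DD (fun t => t ^+ b) ((r ^+ 2) ^+ b.+1 / b.+1%:R) mD.
- by move=> t /=; rewrite !in_itv /= andbT => /andP[].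
- exact: exprn_measurable.
- by move=> t /=; rewrite in_itv /= => /andP[t0 _]; exact: exprn_ge0.
- by rewrite integral_expn ?exprn_gt0// expr0n /= subr0.
by apply: eq_cint => p; rewrite -exprMn mulCJ -sqmodE rmorphXn.
Qed.

(** Cauchy transform of a monomial.  The subtracted term is the Cauchy integral of
    the boundary values of the primitive [w^a (w^* )^(b + 1) / (b + 1)]. *)
Lemma monomial_transform (z : R[i]) a b : normc z <= r ->
  cint plane (fun p => chiD (toC p) * (toC p ^+ a * (toC p)^* ^+ b / (toC p - z))) =
  - (pi : R)%:C / b.+1%:R *
    (z ^+ a * z^* ^+ b.+1 -
     (if (b < a)%N then (r%:C) ^+ (2 * b.+1) * z ^+ (a - b.+1) else 0)).
Proof.
move=> zr.
have i0 : cintegrable plane (fun p => chiD (toC p) * ((toC p)^* ^+ b / (toC p - z))).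
  apply: (chi_div_integrable (phi := fun w => w^* ^+ b) (K := r ^+ b) r0).
  - exact: measurable_itv.
  - by [].
  - exact: zr.
  - exact: cmeasurable_toCJX.
  - by move=> w /chiD_le wr; rewrite normcX normc_conj lerXn2r ?nnegrE ?normc_ge0 ?(ltW r0).
have i1 : cintegrable plane (fun p => z ^+ a * (chiD (toC p) * ((toC p)^* ^+ b / (toC p - z))) +
   \sum_(i < a) z ^+ i * (chiD (toC p) * (toC p ^+ (a.-1 - i) * (toC p)^* ^+ b))).
  apply: cintegrableD; first exact: cintegrableZ.
  by apply: cintegrable_sum => i; apply: cintegrableZ; exact: monomial_integrable.
have -> : cint plane (fun p => chiD (toC p) * (toC p ^+ a * (toC p)^* ^+ b / (toC p - z))) =
    cint plane (fun p => z ^+ a * (chiD (toC p) * ((toC p)^* ^+ b / (toC p - z))) +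
   \sum_(i < a) z ^+ i * (chiD (toC p) * (toC p ^+ (a.-1 - i) * (toC p)^* ^+ b))).
  apply: (@cint_ae_eq _ _ _ _ (sqmod @^-1` [set normc z ^+ 2])).
  - by apply: measurable_sqmod_preimage; exact: measurable_set1.
  - exact: (measure_circle (sqr_ge0 _)).
  - apply: cmeasurableM; first exact: cmeasurable_chiD.
    apply: cmeasurableM; last by apply: cmeasurableV; exact: cmeasurable_toC_sub.
    by apply: cmeasurableM; [exact: cmeasurable_toCX|exact: cmeasurable_toCJX].
  - exact: (cintegrable_measurable i1).
  move=> p /= pz; have wz : toC p - z != 0.
    by rewrite subr_eq0; apply/eqP => h; apply: pz; rewrite sqmodE h.
  apply: (mulIf wz); rewrite mulrDl.
  have -> : \sum_(i < a) z ^+ i * (chiD (toC p) * (toC p ^+ (a.-1 - i) * (toC p)^* ^+ b)) =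
      chiD (toC p) * (toC p)^* ^+ b * \sum_(i < a) toC p ^+ (a.-1 - i) * z ^+ i.
    by rewrite mulr_sumr; apply: eq_bigr => i _; ring.
  have := subrXX (toC p) z a; set S := \sum_(i < a) _ => SE.
  have -> : chiD (toC p) * (toC p)^* ^+ b * S * (toC p - z) =
      chiD (toC p) * (toC p)^* ^+ b * ((toC p - z) * S) by ring.
  by rewrite -SE; field.
rewrite cintD; [|exact: cintegrableZ|]; last first.
  by apply: cintegrable_sum => i; apply: cintegrableZ; exact: monomial_integrable.
rewrite cintZ// disk_conj_power// cint_sum; last first.
  by move=> i; apply: cintegrableZ; exact: monomial_integrable.
rewrite (eq_bigr (fun i : 'I_a => z ^+ i * (if (a.-1 - i == b)%N
    then (pi * ((r ^+ 2) ^+ b.+1 / b.+1%:R))%:C else 0))); last first.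
  by move=> i _; rewrite cintZ ?disk_moment//; exact: monomial_integrable.
have b1 : b.+1%:R != 0 :> R[i] by rewrite pnatr_eq0.
case: ltnP => ba; last first.
  rewrite big1 ?addr0 ?subr0; first by field.
  by move=> i _; have ia := ltn_ord i; rewrite ifN ?mulr0//; apply/eqP; lia.
have jP : (a - b.+1 < a)%N by rewrite ltn_subrL (leq_ltn_trans _ ba).
rewrite (bigD1 (Ordinal jP)) //= big1 ?addr0; last first.
  move=> i ij; rewrite ifN ?mulr0//; apply: contraNneq ij => h.
  apply/eqP/val_inj => /=; have := ltn_ord i; lia.
have -> : (a.-1 - (a - b.+1) == b)%N by apply/eqP; lia.
rewrite rmorphM rmorphM /= fmorphV /= rmorph_nat !rmorphXn /= -exprM.
by field.
Qed.

Lemma binomial_subX (x y : R[i]) n :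
  (x - y) ^+ n = \sum_(q < n.+1) 'C(n, q)%:R * (- y) ^+ (n - q) * x ^+ q.
Proof.
rewrite addrC exprDn; apply: eq_bigr => q _.
by rewrite -mulr_natl mulrA.
Qed.

Lemma shifted_monomial_transform (z e : R[i]) n l : normc z <= r ->
  cintegrable plane (fun p => chiD (toC p) *
    ((toC p - e) ^+ n * ((toC p)^* - e^*) ^+ l / (toC p - z))) /\
  cint plane (fun p => chiD (toC p) *
    ((toC p - e) ^+ n * ((toC p)^* - e^*) ^+ l / (toC p - z))) =
  (pi : R)%:C * (-1 / l.+1%:R * (z^* - e^*) ^+ l.+1 * (z - e) ^+ n +
                 1 / l.+1%:R * C2 r z e l.+1 n.+1).
Proof.
move=> zr.
pose T (p : nat) (q : nat) : R[i] := 'C(n, q)%:R * (- e) ^+ (n - q) *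
  ('C(l, p)%:R * (- e^*) ^+ (l - p)).
have E : (fun p => chiD (toC p) *
    ((toC p - e) ^+ n * ((toC p)^* - e^*) ^+ l / (toC p - z))) =
  (fun w => \sum_(q < n.+1) \sum_(p < l.+1) T p q *
     (chiD (toC w) * (toC w ^+ q * (toC w)^* ^+ p / (toC w - z)))).
  apply/funext => w; rewrite !binomial_subX mulr_suml mulr_suml mulr_sumr.
  apply: eq_bigr => q _; rewrite mulr_sumr mulr_suml mulr_sumr.
  by apply: eq_bigr => p _; rewrite /T; ring.
have ii q p : cintegrable plane (fun w =>
    chiD (toC w) * (toC w ^+ q * (toC w)^* ^+ p / (toC w - z))).
  apply: (chi_div_integrable (phi := fun w => w ^+ q * w^* ^+ p)
    (K := r ^+ q * r ^+ p) r0).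
  - exact: measurable_itv.
  - by [].
  - exact: zr.
  - by apply: cmeasurableM; [exact: cmeasurable_toCX|exact: cmeasurable_toCJX].
  - by move=> w /chiD_le; exact: normc_monomial_le.
rewrite E; split.
  by apply: cintegrable_sum => q; apply: cintegrable_sum => p; exact: cintegrableZ.
rewrite cint_sum; last first.
  by move=> q; apply: cintegrable_sum => p; exact: cintegrableZ.
rewrite (eq_bigr (fun q : 'I_n.+1 => \sum_(p < l.+1) T p q * (- (pi : R)%:C / p.+1%:R *
    (z ^+ q * z^* ^+ p.+1 -
     (if (p < q)%N then (r%:C) ^+ (2 * p.+1) * z ^+ (q - p.+1) else 0))))); last first.
  move=> q _; rewrite cint_sum; last by move=> p; exact: cintegrableZ.
  by apply: eq_bigr => p _; rewrite cintZ// monomial_transform.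
pose U (p : nat) (q : nat) : R[i] := 'C(n, q)%:R * (- e) ^+ (n - q) *
  ('C(l.+1, p)%:R * (- e^*) ^+ (l.+1 - p)).
have C2E : C2 r z e l.+1 n.+1 = \sum_(q < n.+1) \sum_(p < l.+2) U p q *
    (if (p <= q)%N then (r%:C) ^+ (2 * p) * z ^+ (q - p) else 0).
  rewrite /C2 big_mkord exchange_big /=; apply: eq_bigr => p _.
  rewrite big_mkord [LHS]big_mkcond; apply: eq_bigr => q _.
  by rewrite /U /=; case: ifP => _; ring.
have prodE : (z^* - e^*) ^+ l.+1 * (z - e) ^+ n =
    \sum_(q < n.+1) \sum_(p < l.+2) U p q * (z ^+ q * z^* ^+ p).
  rewrite !binomial_subX mulr_suml exchange_big /=; apply: eq_bigr => p _.
  by rewrite mulr_sumr; apply: eq_bigr => q _; rewrite /U; ring.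
rewrite -mulrA prodE C2E !mulr_sumr -big_split /= mulr_sumr; apply: eq_bigr => q _.
rewrite !mulr_sumr -big_split /= mulr_sumr [in RHS]big_ord_recl /=.
rewrite [X in X + _](_ : _ = 0) ?add0r; last first.
  by rewrite muln0 subn0 !expr0; ring.
apply: eq_bigr => p _; rewrite /bump /= !add1n /T /U subSS.
have : (l.+1 * 'C(l, p) = p.+1 * 'C(l.+1, p.+1))%N by rewrite mul_bin_diag.
move=> /(congr1 (fun k => k%:R : R[i])); rewrite !natrM => binE.
have l1 : l.+1%:R != 0 :> R[i] by rewrite pnatr_eq0.
have p1 : p.+1%:R != 0 :> R[i] by rewrite pnatr_eq0.
have -> : 'C(l.+1, p.+1)%:R = l.+1%:R * 'C(l, p)%:R / p.+1%:R :> R[i].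
  by rewrite binE mulrAC divff ?mul1r.
by case: ifP => _; field; rewrite !nat1r p1 l1.
Qed.

Lemma conj_transform (e : R[i]) k : normc e <= r ->
  cintegrable plane (fun p => chiD (toC p) * (toC p ^+ k / ((toC p)^* - e^*))) /\
  cint plane (fun p => chiD (toC p) * (toC p ^+ k / ((toC p)^* - e^*))) =
  - (pi : R)%:C * (e ^+ k.+1 / k.+1%:R).
Proof.
move=> er.
have i0 : cintegrable plane (fun p => chiD (toC p) * ((toC p)^* ^+ k / (toC p - e))).
  apply: (chi_div_integrable (phi := fun w => w^* ^+ k) (K := r ^+ k) r0).
  - exact: measurable_itv.
  - by [].
  - exact: er.
  - exact: cmeasurable_toCJX.
  - by move=> w /chiD_le wr; rewrite normcX normc_conj lerXn2r ?nnegrE ?normc_ge0 ?(ltW r0).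
have E : (fun p => chiD (toC p) * (toC p ^+ k / ((toC p)^* - e^*))) =
    (fun p => (chiD (toC p) * ((toC p)^* ^+ k / (toC p - e)))^*).
  apply/funext => p; rewrite rmorphM /= conj_chi rmorphM /= fmorphV /= rmorphXn /=.
  by rewrite [(toC p)^*^*]conjCK rmorphB.
rewrite E; split.
  have [i1 i2] := i0; split.
    by under eq_fun do rewrite Re_conjc.
  by under eq_fun do rewrite Im_conjc; exact: rintegrableN.
rewrite cint_conj// disk_conj_power// rmorphM rmorphN /= rmorphM /= fmorphV /= rmorphXn /=.
rewrite [e^*^*]conjCK conjC_nat; congr (- _ * _).
by apply/eqP; rewrite eq_complex /= oppr0 !eqxx.
Qed.

Lemma div_kernel_transform (z e : R[i]) n : normc z <= r -> normc e <= r ->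
  normc z != normc e ->
  cintegrable plane (fun p => chiD (toC p) *
    ((toC p - e) ^+ n / (toC p - z) / ((toC p)^* - e^*))) /\
  cint plane (fun p => chiD (toC p) *
    ((toC p - e) ^+ n / (toC p - z) / ((toC p)^* - e^*))) =
  (pi : R)%:C * (C1 z e n.+1 +
     (z - e) ^+ n * Ln (((r ^+ 2)%:C - z * e^*) / (normc (z - e) ^+ 2)%:C)).
Proof.
move=> zr er zne; have ze : z != e by apply: contraNneq zne => ->.
have ig : cintegrable plane (fun p => chiD (toC p) *
    ((toC p - z)^-1 * ((toC p)^* - e^*)^-1)).
  apply: (cintegrable_le _ (inv_inv_integrable r0 zr er ze)).
    apply: cmeasurableM; first exact: cmeasurable_chiD.
    apply: cmeasurableM; apply: cmeasurableV; first exact: cmeasurable_toC_sub.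
    apply: cmeasurableB; last exact: cmeasurable_cst.
    by apply: cmeasurable_conj; exact: cmeasurable_toC.
  move=> p; rewrite normcM normcM !normcV -rmorphB normc_conj.
  apply: ler_wpM2r; first by rewrite mulr_ge0 ?invr_ge0 ?normc_ge0.
  exact: chi_bound.
pose c j : R[i] := 'C(n, j)%:R * (- e) ^+ j.
pose G p := (z - e) ^+ n * (chiD (toC p) * ((toC p - z)^-1 * ((toC p)^* - e^*)^-1)) +
  \sum_(j < n.+1) \sum_(i < n - j) c j * z ^+ i *
    (chiD (toC p) * (toC p ^+ ((n - j).-1 - i) / ((toC p)^* - e^*))).
have iG : cintegrable plane G.
  apply: cintegrableD; first exact: cintegrableZ.
  apply: cintegrable_sum => j; apply: cintegrable_sum => i; apply: cintegrableZ.
  by case: (conj_transform ((n - j).-1 - i) er).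
have mF : cmeasurable (fun p => chiD (toC p) *
    ((toC p - e) ^+ n / (toC p - z) / ((toC p)^* - e^*))).
  apply: cmeasurableM; first exact: cmeasurable_chiD.
  apply: cmeasurableM.
    apply: cmeasurableM; last by apply: cmeasurableV; exact: cmeasurable_toC_sub.
    by apply: cmeasurableX; exact: cmeasurable_toC_sub.
  apply: cmeasurableV; apply: cmeasurableB; last exact: cmeasurable_cst.
  by apply: cmeasurable_conj; exact: cmeasurable_toC.
have binE (x : R[i]) : (x - e) ^+ n = \sum_(j < n.+1) c j * x ^+ (n - j).
  rewrite exprDn; apply: eq_bigr => j _; rewrite /c -mulr_natl; ring.
split.
  apply: (cintegrable_le mF (rintegrableZ ((2 * r) ^+ n) (inv_inv_integrable r0 zr er ze))).
  move=> p; have [->|cD] := eqVneq (chiD (toC p)) 0.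
    rewrite mul0r normc0 mulr_ge0 ?exprn_ge0 ?mulr_ge0 ?invr_ge0 ?normc_ge0 ?inD_ge0//.
    exact: ltW.
  rewrite -mulrA mulrCA normcM; apply: ler_pM; rewrite ?normc_ge0//.
    rewrite normcX lerXn2r ?nnegrE ?normc_ge0 ?mulr_ge0 ?(ltW r0)//.
    rewrite (le_trans (normcB _ _))// mulr_natl mulr2n lerD//.
    exact: chiD_le.
  rewrite normcM normcM !normcV -rmorphB normc_conj.
  apply: ler_wpM2r; first by rewrite mulr_ge0 ?invr_ge0 ?normc_ge0.
  exact: chi_bound.
have -> : cint plane (fun p => chiD (toC p) *
    ((toC p - e) ^+ n / (toC p - z) / ((toC p)^* - e^*))) = cint plane G.
  apply: (@cint_ae_eq _ _ _ _ (sqmod @^-1` [set normc z ^+ 2])).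
  - by apply: measurable_sqmod_preimage; exact: measurable_set1.
  - exact: (measure_circle (sqr_ge0 _)).
  - exact: mF.
  - exact: (cintegrable_measurable iG).
  move=> p /= pz; have wz : toC p - z != 0.
    by rewrite subr_eq0; apply/eqP => h; apply: pz; rewrite sqmodE h.
  rewrite /G !binE; set X := ((toC p)^* - e^*)^-1.
  transitivity (\sum_(j < n.+1) chiD (toC p) * X * c j * (toC p ^+ (n - j) / (toC p - z))).
    rewrite !mulr_suml mulr_sumr; apply: eq_bigr => j _; ring.
  rewrite mulr_suml -big_split /=; apply: eq_bigr => j _.
  have := subrXX (toC p) z (n - j); set S := \sum_(i < n - j) _ => SE.
  have -> : \sum_(i < n - j) c j * z ^+ i *
      (chiD (toC p) * (toC p ^+ ((n - j).-1 - i) * X)) = chiD (toC p) * X * c j * S.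
    by rewrite /S mulr_sumr; apply: eq_bigr => i _; ring.
  have -> : toC p ^+ (n - j) = z ^+ (n - j) + (toC p - z) * S by rewrite -SE; ring.
  by field.
rewrite cintD; [|exact: cintegrableZ|]; last first.
  apply: cintegrable_sum => j; apply: cintegrable_sum => i; apply: cintegrableZ.
  by case: (conj_transform ((n - j).-1 - i) er).
rewrite cintZ// log_kernel// mulrDr addrC mulrCA; congr (_ + _).
rewrite cint_sum; last first.
  move=> j; apply: cintegrable_sum => i; apply: cintegrableZ.
  by case: (conj_transform ((n - j).-1 - i) er).
have iC j i : cintegrable plane (fun p => c j * z ^+ i *
    (chiD (toC p) * (toC p ^+ ((n - j).-1 - i) / ((toC p)^* - e^*)))).
  by apply: cintegrableZ; case: (conj_transform ((n - j).-1 - i) er).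
rewrite (eq_bigr (fun j : 'I_n.+1 => \sum_(i < n - j) c j * z ^+ i *
   (- (pi : R)%:C * (e ^+ ((n - j).-1 - i).+1 / ((n - j).-1 - i).+1%:R)))); last first.
  move=> j _; rewrite cint_sum//; apply: eq_bigr => i _.
  have [h1 h2] := conj_transform ((n - j).-1 - i) er.
  by rewrite cintZ// h2.
have -> : C1 z e n.+1 = \sum_(j < n.+1) \sum_(1 <= l < (n - j).+1)
    (- e ^+ l / l%:R) * (c j * z ^+ (n - j - l)).
  rewrite /C1; pose F l j := - e ^+ l / l%:R * (c j * z ^+ (n - j - l)).
  transitivity (\sum_(1 <= l < n.+1) \sum_(0 <= j < n.+1)
      (if (j + l < n.+1)%N then F l j else 0)).
    apply: eq_big_nat => l /andP[l1 ln]; rewrite mulr_sumr.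
    rewrite (big_nat_widen _ _ n.+1) ?leq_subr//= [LHS]big_mkcond.
    apply: eq_big_nat => j _.
    have -> : (j < n.+1 - l)%N = (j + l < n.+1)%N by lia.
    by case: ifP => _ //; rewrite /F /c; ring.
  rewrite exchange_big_nat /= big_mkord; apply: eq_bigr => j _.
  rewrite [RHS](big_nat_widen _ _ n.+1) ?ltnS ?leq_subr//= [RHS]big_mkcond.
  apply: eq_big_nat => l _; have jn := ltn_ord j.
  by have -> : (l < (n - j).+1)%N = (j + l < n.+1)%N by lia.
rewrite mulr_sumr; apply: eq_bigr => j _.
rewrite big_add1 big_mkord mulr_sumr (reindex_inj rev_ord_inj) /=; apply: eq_bigr => i _.
have ij := ltn_ord i.
have -> : ((n - j).-1 - (n - j - i.+1))%N = i by lia.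
by rewrite subnS; ring.
Qed.

(** Expanding [(w^* - z^* )^m] around [e^*], only the constant term keeps the
    antiholomorphic pole at [e]. *)
Lemma kernel_integral (z e : R[i]) m n : normc z <= r -> normc e <= r ->
  normc z != normc e ->
  cint plane (fun p => chiD (toC p) *
    (((toC p)^* - z^*) ^+ m * (toC p - e) ^+ n / (toC p - z) / ((toC p)^* - e^*))) =
  (pi : R)%:C * C3 r z e m.+1 n.+1.
Proof.
move=> zr er zne.
have [i0 e0] := div_kernel_transform n zr er zne.
pose c l : R[i] := 'C(m, l)%:R * (e^* - z^*) ^+ (m - l).
pose S l p := c l.+1 * (chiD (toC p) *
    ((toC p - e) ^+ n * ((toC p)^* - e^*) ^+ l / (toC p - z))).
have iS l : cintegrable plane (S l).
  by apply: cintegrableZ; case: (shifted_monomial_transform e n l zr).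
pose G p := c 0%N * (chiD (toC p) *
    ((toC p - e) ^+ n / (toC p - z) / ((toC p)^* - e^*))) + \sum_(l < m) S l p.
have iG : cintegrable plane G.
  by apply: cintegrableD; [exact: cintegrableZ|exact: cintegrable_sum].
have mc : cmeasurable (fun p => (toC p)^*).
  by apply: cmeasurable_conj; exact: cmeasurable_toC.
have ms (u : R[i]) : cmeasurable (fun p => (toC p)^* - u).
  by apply: cmeasurableB => //; exact: cmeasurable_cst.
have -> : cint plane (fun p => chiD (toC p) *
    (((toC p)^* - z^*) ^+ m * (toC p - e) ^+ n / (toC p - z) / ((toC p)^* - e^*))) =
    cint plane G.
  apply: (@cint_ae_eq _ _ _ _ (sqmod @^-1` [set normc e ^+ 2])).
  - by apply: measurable_sqmod_preimage; exact: measurable_set1.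
  - exact: (measure_circle (sqr_ge0 _)).
  - apply: cmeasurableM; first exact: cmeasurable_chiD.
    apply: cmeasurableM; last by apply: cmeasurableV; exact: ms.
    apply: cmeasurableM; last by apply: cmeasurableV; exact: cmeasurable_toC_sub.
    by apply: cmeasurableM; apply: cmeasurableX; [exact: ms|exact: cmeasurable_toC_sub].
  - exact: (cintegrable_measurable iG).
  move=> p /= pe; have we : (toC p)^* - e^* != 0.
    rewrite -rmorphB conjC_eq0 subr_eq0; apply/eqP => h; apply: pe.
    by rewrite sqmodE h.
  have -> : ((toC p)^* - z^*) ^+ m =
      \sum_(l < m.+1) c l * ((toC p)^* - e^*) ^+ l.
    rewrite (_ : (toC p)^* - z^* = (e^* - z^*) + ((toC p)^* - e^*)); last by ring.
    by rewrite exprDn; apply: eq_bigr => l _; rewrite /c -mulr_natl mulrA.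
  rewrite big_ord_recl /= expr0 mulr1 /G /S !mulrDl mulrDr; congr (_ + _); first by ring.
  rewrite !mulr_suml mulr_sumr; apply: eq_bigr => l _.
  rewrite /bump /= add1n (exprS ((toC p)^* - e^*)).
  by move: (_^-1) => Y; field.
rewrite cintD; [|exact: cintegrableZ|exact: cintegrable_sum].
rewrite cintZ// e0 cint_sum// /C3 /= [RHS]mulrDr; congr (_ + _).
  by rewrite /c bin0 subn0 mul1r mulrCA.
rewrite big_add1 /= big_mkord mulr_sumr; apply: eq_bigr => l _.
have [il el] := shifted_monomial_transform e n l zr.
by rewrite /S cintZ// el /c; ring.
Qed.

Lemma iterate_kernel_step (z e : R[i]) m : normc z <= r -> normc e <= r -> z != e ->
  cint plane (fun p => chiD (toC p) *
    ((toC p - z)^-1 * (((toC p)^* - e^*) ^+ m / (toC p - e)))) =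
  - (pi : R)%:C * ((z^* - e^*) ^+ m.+1 / m.+1%:R / (z - e)).
Proof.
move=> zr er ze; have ze0 : z - e != 0 by rewrite subr_eq0.
have [iz ez] := shifted_monomial_transform e 0 m zr.
have [ie ee] := shifted_monomial_transform e 0 m er.
have iG := cintegrableZ (z - e)^-1 (cintegrableB iz ie).
have mc : cmeasurable (fun p => (toC p)^*).
  by apply: cmeasurable_conj; exact: cmeasurable_toC.
have -> : cint plane (fun p => chiD (toC p) *
    ((toC p - z)^-1 * (((toC p)^* - e^*) ^+ m / (toC p - e)))) =
    cint plane (fun p => (z - e)^-1 *
     (chiD (toC p) * ((toC p - e) ^+ 0 * ((toC p)^* - e^*) ^+ m / (toC p - z)) -
      chiD (toC p) * ((toC p - e) ^+ 0 * ((toC p)^* - e^*) ^+ m / (toC p - e)))).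
  apply: (@cint_ae_eq _ _ _ _ (sqmod @^-1` [set normc e ^+ 2] `|`
    sqmod @^-1` [set normc z ^+ 2])).
  - by apply: measurableU; apply: measurable_sqmod_preimage; exact: measurable_set1.
  - have mC (c : R) : measurable (sqmod @^-1` [set c]).
      by apply: measurable_sqmod_preimage; exact: measurable_set1.
    apply: etrans (measureU0 (mC _) (mC _) (measure_circle (sqr_ge0 _))) _.
    exact: (measure_circle (sqr_ge0 _)).
  - apply: cmeasurableM; first exact: cmeasurable_chiD.
    apply: cmeasurableM; first by apply: cmeasurableV; exact: cmeasurable_toC_sub.
    apply: cmeasurableM; last by apply: cmeasurableV; exact: cmeasurable_toC_sub.
    by apply: cmeasurableX; apply: cmeasurableB => //; exact: cmeasurable_cst.
  - exact: (cintegrable_measurable iG).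
  move=> p /= /not_orP[pe pz]; rewrite expr0 !mul1r.
  have we : toC p - e != 0.
    by rewrite subr_eq0; apply/eqP => h; apply: pe; rewrite sqmodE h.
  have wz : toC p - z != 0.
    by rewrite subr_eq0; apply/eqP => h; apply: pz; rewrite sqmodE h.
  by field; rewrite wz we ze0.
rewrite cintZ; last exact: cintegrableB.
rewrite cintB// ez ee !expr0 subrr expr0n /= !(mulr0, mul0r, mulr1, add0r).
have -> : C2 r z e m.+1 1 = C2 r e e m.+1 1.
  rewrite /C2; apply: eq_bigr => p _; rewrite big_mkcond [RHS]big_mkcond !big_nat1.
  by rewrite sub0n !expr0.
by field; rewrite ze0 nat1r pnatr_eq0.
Qed.

End KernelFormula.

(** * Measurability of Hoelder functions on the bidisk *)

Section HolderMeasurable.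
Variable R : realType.

(** The function is the infimum over a countable dense set of the translates of
    its own modulus of continuity. *)
Lemma measurable_dense_modulus d (X : measurableType d) (A : set X)
    (phi : X -> R) (dist : X -> X -> R) (e : nat -> X) :
  (forall n, A (e n)) ->
  (forall n, measurable_fun A (fun x => dist x (e n))) ->
  (forall x y, A x -> A y -> `|phi x - phi y| <= dist x y) ->
  (forall x eps, A x -> 0 < eps -> exists n, dist x (e n) < eps) ->
  measurable_fun A phi.
Proof.
move=> Ae md lip dense.
pose h n x := phi (e n) + dist x (e n).
have lb x : A x -> lbound (range (h ^~ x)) (phi x).
  move=> Ax _ [n _ <-]; rewrite /h -lerBlDl.
  by apply: le_trans (lip _ _ Ax (Ae n)); exact: ler_norm.
have hlb x : A x -> has_lbound (range (h ^~ x)).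
  by move=> Ax; exists (phi x); exact: lb.
have := @measurable_fun_infs _ _ R A h 0 hlb.
have mh n : measurable_fun A (h n).
  by apply: measurable_funD; [exact: measurable_cst|exact: md].
move=> /(_ mh); apply: eq_measurable_fun => x /set_mem Ax.
have -> : infs (h ^~ x) 0 = inf (range (h ^~ x)).
  rewrite /infs /=; congr inf.
  by apply/seteqP; split => y [n] => [_ <-|_ <-]; exists n.
have rne : range (h ^~ x) !=set0 by exists (h 0%N x), 0%N.
apply/eqP; rewrite eq_le; apply/andP; split; last exact: lb_le_inf (lb x Ax).
apply/ler_addgt0Pr => eps e0.
have [n dn] := dense x (eps / 2) Ax (divr_gt0 e0 (ltr0Sn _ 1)).
have : inf (range (h ^~ x)) <= h n x by apply: ge_inf; [exact: hlb|exists n].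
move=> /le_trans; apply; rewrite /h.
have := lip _ _ (Ae n) Ax; rewrite distrC => l1.
have := lip _ _ Ax (Ae n); rewrite ler_norml => /andP[l2 _].
lra.
Qed.

Variable r : R.
Hypothesis r0 : 0 < r.

Definition retract (q : R[i]) : R[i] :=
  if normc q <= r then q else (r / normc q)%:C * q.

Definition rational_point (n : nat) : R[i] :=
  if unpickle n is Some (a, b) then retract (ratr a +i* ratr b) else 0.

Lemma retract_disk q : normc (retract q) <= r.
Proof.
rewrite /retract; case: (leP (normc q) r) => // rq; have q0 : 0 < normc q := lt_trans r0 rq.
by rewrite normcM normc_real ger0_norm ?divr_ge0 ?(ltW r0) ?(ltW q0)// divfK ?gt_eqF.
Qed.

Lemma rational_point_disk n : normc (rational_point n) <= r.
Proof.
rewrite /rational_point; case: unpickle => [[a b]|]; first exact: retract_disk.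
by rewrite normc0 ltW.
Qed.

Lemma retract_dist w q : normc w <= r -> normc (w - retract q) <= 2 * normc (w - q).
Proof.
move=> wr; rewrite /retract; case: (leP (normc q) r) => rq.
  by rewrite ler_peMl ?normc_ge0// ler1n.
have q0 : 0 < normc q := lt_trans r0 rq.
rewrite mulr_natl mulr2n (le_trans (normc_dist_triangle _ q _))// lerD2l.
have -> : q - (r / normc q)%:C * q = (1 - r / normc q)%:C * q.
  by rewrite rmorphB /= mulrBl mul1r.
rewrite normcM normc_real ger0_norm; last by rewrite subr_ge0 ler_pdivrMr// mul1r ltW.
rewrite mulrBl mul1r divfK ?gt_eqF//.
have := normc_dist_triangle q w 0; rewrite !subr0 (normc_distC q w) => h.
by rewrite lerBlDr (le_trans h)// lerD2l.
Qed.

Lemma rational_point_dense w eps : normc w <= r -> 0 < eps ->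
  exists n, normc (w - rational_point n) < eps.
Proof.
move=> wr e0; have e4 : 0 < eps / 4 by rewrite divr_gt0.
have near x : exists a : rat, `|x - ratr a| < eps / 4.
  have /rat_in_itvoo[a] : x - eps / 4 < x + eps / 4 by lra.
  rewrite in_itv /= => /andP[h1 h2]; exists a.
  by rewrite ltr_distl; apply/andP; split; lra.
have [a ha] := near (Re w); have [b hb] := near (Im w).
exists (pickle (a, b)); rewrite /rational_point pickleK.
apply: (le_lt_trans (retract_dist _ wr)).
have := normc_le_ReIm (w - (ratr a +i* ratr b)).
rewrite Re_addc Im_addc Re_oppc Im_oppc /= => h.
by apply: (le_lt_trans (ler_wpM2l _ h)) => //; lra.
Qed.

End HolderMeasurable.

(** * Integral operators in one coordinate *)

Section CoordinateOperators.
Variables (R : realType) (r : R) (n : nat) (alpha : R).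
Hypotheses (r0 : 0 < r) (alpha0 : 0 < alpha).
Local Notation mu := (@lebesgue_measure R).
Local Notation TR := (measurableTypeR R).
Local Notation RR := (TR * TR)%type.
Local Notation plane := (@plane R).
Local Notation toC := (@toC R).
Local Notation DD := (`[0%R, (r ^+ 2)%R]%classic : set TR).
Local Notation chiD := (chi DD).
Local Notation pt := ('I_n -> R[i]).
Local Notation upd z j w := [eta z with j |-> w].
Implicit Types (f : pt -> R[i]) (z : pt).

Lemma chiDE w : chiD w = (normc w <= r)%R%:R.
Proof.
rewrite /chi; congr (nat_of_bool _)%:R; apply/idP/idP => [/set_mem|h].
  by rewrite /= in_itv /= sqr_ge0 ler_sqr ?nnegrE ?normc_ge0 ?(ltW r0).
by apply/mem_set; rewrite /= in_itv /= sqr_ge0 ler_sqr ?nnegrE ?normc_ge0 ?(ltW r0).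
Qed.

Lemma upd_id z j w : upd z j w j = w. Proof. by rewrite /= eqxx. Qed.

Lemma upd_neq z j k w : k != j -> upd z j w k = z k.
Proof. by move=> kj; rewrite /= (negbTE kj). Qed.

Lemma upd_upd z j w u : upd (upd z j w) j u = upd z j u :> pt.
Proof. by apply/funext => i /=; case: eqP. Qed.

Lemma updC z j k w u : j != k -> upd (upd z j w) k u = upd (upd z k u) j w :> pt.
Proof.
move=> jk; apply/funext => i /=; case: eqVneq => [->|//].
by rewrite eq_sym (negbTE jk).
Qed.

Lemma polydisk_upd z j w : polydisk r z -> normc w <= r -> polydisk r (upd z j w).
Proof. by move=> zD wr i; rewrite /disk /=; case: eqP => // _; exact: zD. Qed.

(** Bounded and Hoelder continuous in each variable separately. *)
Definition nice f := exists M H : R, [/\ 0 <= M, 0 <= H,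
  (forall z, polydisk r z -> normc (f z) <= M) &
  (forall z j w, polydisk r z -> normc w <= r ->
    normc (f z - f (upd z j w)) <= H * normc (z j - w) `^ alpha)].

Lemma powR_small (H eps : R) : 0 <= H -> 0 < eps ->
  exists2 d, 0 < d & forall x, 0 <= x -> x < d -> H * x `^ alpha < eps.
Proof.
move=> H0 e0; have H1 : 0 < H + 1 by rewrite ltr_wpDl.
exists ((eps / (H + 1)) `^ alpha^-1); first by rewrite powR_gt0// divr_gt0.
move=> x x0 xd; have : x `^ alpha < eps / (H + 1).
  have a0 : alpha != 0 by rewrite gt_eqF.
  have -> : eps / (H + 1) = ((eps / (H + 1)) `^ alpha^-1) `^ alpha.
    by rewrite -powRrM mulVf// powRr1// divr_ge0 ?(ltW e0) ?(ltW H1).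
  by apply: gt0_ltr_powR => //; rewrite nnegrE ?powR_ge0.
rewrite ltr_pdivlMr// mulrC; apply: le_lt_trans.
by rewrite ler_wpM2r ?powR_ge0// lerDl.
Qed.

Lemma measurable_modulus (H : R) (u : R[i]) :
  measurable_fun setT (fun p : RR => H * normc (toC p - u) `^ alpha).
Proof.
apply: measurable_funM; first exact: measurable_cst.
apply: (measurableT_comp (@measurable_powR R alpha)).
by apply: measurable_normc; exact: cmeasurable_toC_sub.
Qed.

Lemma slice2_measurable f z j k : nice f -> polydisk r z ->
  cmeasurable (fun q : RR * RR => chiD (toC q.1) * chiD (toC q.2) *
    f (upd (upd z j (toC q.1)) k (toC q.2))).
Proof.
move=> [M [H [M0 H0 fM fH]]] zD.
pose A : set (RR * RR) := [set q | normc (toC q.1) <= r /\ normc (toC q.2) <= r].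
pose dist (q q' : RR * RR) : R := H * normc (toC q.1 - toC q'.1) `^ alpha +
  H * normc (toC q.2 - toC q'.2) `^ alpha.
pose phi (q : RR * RR) := f (upd (upd z j (toC q.1)) k (toC q.2)).
pose e m : RR * RR := if unpickle m is Some (a, b)
  then (ofC (rational_point r a), ofC (rational_point r b))
  else (ofC (rational_point r 0), ofC (rational_point r 0)).
have Ae m : A (e m).
  by rewrite /A /e /=; case: unpickle => [[a b]|] /=; rewrite !toC_ofC !rational_point_disk.
have md m : measurable_fun setT (fun q => dist q (e m)).
  apply: measurable_funD.
    exact: (measurableT_comp (measurable_modulus H _) measurable_fst).
  exact: (measurableT_comp (measurable_modulus H _) measurable_snd).
have lip q q' : A q -> A q' -> normc (phi q - phi q') <= dist q q'.
  move=> [q1 q2] [q1' q2']; rewrite /dist [leRHS]addrC.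
  apply: (le_trans (normc_dist_triangle _
    (f (upd (upd z j (toC q.1)) k (toC q'.2))) _)).
  apply: lerD.
    have := fH (upd (upd z j (toC q.1)) k (toC q.2)) k (toC q'.2).
    rewrite upd_upd upd_id; apply => //.
    by do 2 apply: polydisk_upd => //.
  rewrite /phi; have [<-|jk] := eqVneq j k.
    by rewrite !upd_upd subrr normc0 mulr_ge0 ?powR_ge0.
  rewrite !(updC _ _ _ jk).
  have := fH (upd (upd z k (toC q'.2)) j (toC q.1)) j (toC q'.1).
  rewrite upd_upd upd_id; apply => //.
  by do 2 apply: polydisk_upd => //.
have dense q eps : A q -> 0 < eps -> exists m, dist q (e m) < eps.
  move=> [q1 q2] e0; have [d d0 dP] := powR_small H0 (divr_gt0 e0 (ltr0Sn _ 1)).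
  have [a ha] := rational_point_dense r0 q1 d0.
  have [b hb] := rational_point_dense r0 q2 d0.
  exists (pickle (a, b)); rewrite /dist /e pickleK /= !toC_ofC.
  have := dP _ (normc_ge0 _) ha; have := dP _ (normc_ge0 _) hb; lra.
have mA : measurable A.
  have mD : measurable [set p : RR | normc (toC p) <= r].
    have -> : [set p : RR | normc (toC p) <= r] = (fun p => normc (toC p)) @^-1` `]-oo, r].
      by apply/seteqP; split => p /=; rewrite in_itv.
    rewrite -[X in measurable X]setTI; apply: measurable_normc => //.
    exact: cmeasurable_toC.
  have -> : A = fst @^-1` [set p | normc (toC p) <= r] `&`
      snd @^-1` [set p | normc (toC p) <= r] by [].
  apply: measurableI; rewrite -[X in measurable X]setTI.
    exact: measurable_fst.
  exact: measurable_snd.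
have part (P : R[i] -> R) : (forall x y, P x - P y = P (x - y)) ->
    (forall x, `|P x| <= normc x) ->
    measurable_fun setT (fun q => if q \in A then P (phi q) else 0).
  move=> PB Pn.
  have mP : measurable_fun A (fun q => P (phi q)).
    apply: (measurable_dense_modulus (dist := dist) (e := e)) => //.
    - by move=> m; apply: measurable_funTS; exact: md.
    - by move=> q q' Aq Aq'; rewrite PB (le_trans (Pn _))// lip.
  have := (measurable_restrictT (fun q => P (phi q)) mA).1 mP.
  by congr measurable_fun; apply/funext => q; rewrite patchE.
have E q : chiD (toC q.1) * chiD (toC q.2) * phi q = if q \in A then phi q else 0.
  rewrite !chiDE; case: ifPn => [/set_mem[-> ->]|]; first by rewrite !mul1r.
  rewrite notin_setE /A /= => /not_andP[/negP/negbTE->|/negP/negbTE->].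
    by rewrite !mul0r.
  by rewrite mulr0 mul0r.
split.
  under eq_fun do rewrite -/(phi _) E (fun_if (@complex.Re R)).
  by apply: part; [move=> x y; rewrite Re_addc Re_oppc|exact: normr_Re_le].
under eq_fun do rewrite -/(phi _) E (fun_if (@complex.Im R)).
by apply: part; [move=> x y; rewrite Im_addc Im_oppc|exact: normr_Im_le].
Qed.

End CoordinateOperators.

(** * Weakly singular integral operators on the disk *)

Lemma rintegrable_prod (R : realType) d1 d2 (X : measurableType d1)
    (Y : measurableType d2) (m1 : {sigma_finite_measure set X -> \bar R})
    (m2 : {sigma_finite_measure set Y -> \bar R}) (a : X -> R) (b : X * Y -> R) (B : R) :
  rintegrable m1 a -> (forall x, 0 <= a x) ->
  measurable_fun setT b -> (forall q, 0 <= b q) ->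
  (forall x, a x != 0 -> rintegrable m2 (fun y => b (x, y)) /\
     \int[m2]_y b (x, y) <= B) ->
  rintegrable (m1 \x m2)%E (fun q => a q.1 * b q).
Proof.
move=> ia a0 mb b0 bB; have ma := rintegrable_measurable ia.
have mab : measurable_fun setT (fun q : X * Y => a q.1 * b q).
  by apply: measurable_funM => //; exact: (measurableT_comp ma measurable_fst).
have mabE : measurable_fun setT (EFin \o (fun q : X * Y => a q.1 * b q)).
  exact/measurable_EFinP.
apply/(integrable12ltyP m1 m2 mabE) => /=.
have iaB : rintegrable m1 (fun x => B * a x) by exact: rintegrableZ.
have /integrableP[_] := iaB; apply: le_lt_trans.
apply: ge0_le_integral => //.
- by move=> x _; apply: integral_ge0 => y _; rewrite lee_fin.
- apply: (measurable_fun_fubini_tonelli_F (fun q : X * Y => (`|a q.1 * b q|)%:E)).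
  exact: (measurableT_comp (@abse_measurable R setT) mabE).
  by move=> q; rewrite lee_fin.
- by apply: (measurableT_comp (@abse_measurable R setT)); exact: measurable_int iaB.
move=> x _ /=; have [ax|ax] := eqVneq (a x) 0.
  rewrite ax; under eq_integral do rewrite mul0r normr0.
  by rewrite integral0 lee_fin.
have [ib iB] := bB _ ax.
under eq_integral do rewrite ger0_norm ?mulr_ge0//.
rewrite (_ : (\int[m2]_y _)%E = (\int[m2]_y (a x * b (x, y)))%R%:E); last first.
  by rewrite fineK//; apply: integrable_fin_num => //; exact: rintegrableZ.
rewrite lee_fin RintegralZl// mulrC (le_trans _ (ler_norm _))//.
by rewrite ler_wpM2r.
Qed.

Section DiskOperators.
Variables (R : realType) (r : R).
Hypothesis r0 : 0 < r.
Local Notation mu := (@lebesgue_measure R).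
Local Notation TR := (measurableTypeR R).
Local Notation RR := (TR * TR)%type.
Local Notation plane := (@plane R).
Local Notation toC := (@toC R).
Local Notation DD := (`[0%R, (r ^+ 2)%R]%classic : set TR).
Local Notation chiD := (chi DD).
Local Notation inD := (inD r).
Implicit Types (g h : R[i] -> R[i]) (k : R[i] -> R[i] -> R[i]).

Lemma chiD_normc p : normc (chiD (toC p)) = inD p.
Proof. by rewrite chiDE// normc_nat. Qed.

Lemma chiD_eq1 w : normc w <= r -> chiD w = 1.
Proof. by move=> wr; rewrite chiDE// wr. Qed.

Lemma chiD_eq w (x y : R[i]) : (normc w <= r -> x = y) -> chiD w * x = chiD w * y.
Proof.
by rewrite chiDE//; case: leP => [_ ->//|_ _]; rewrite !mul0r.
Qed.

(** Bounded measurable functions on the disk. *)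
Definition admissible g := cmeasurable (fun p => chiD (toC p) * g (toC p)) /\
  exists M, forall w, normc w <= r -> normc (g w) <= M.

Definition weakly_singular k :=
  cmeasurable (fun q : RR * RR => k (toC q.1) (toC q.2)) /\
  exists2 K, 0 <= K & forall z w, normc z <= r -> normc w <= r ->
    normc (k z w) <= K * (normc (w - z))^-1.

Definition diskop k g (z : R[i]) : R[i] := - (pi^-1 : R)%:C *
  cint plane (fun p => chiD (toC p) * (k z (toC p) * g (toC p))).

Lemma eq_diskop k l g h z : (forall w, normc w <= r -> k z w * g w = l z w * h w) ->
  diskop k g z = diskop l h z.
Proof.
by move=> gh; congr (_ * _); apply: eq_cint => p; apply: chiD_eq => /gh ->.
Qed.

Lemma cmeasurable_slice k z : weakly_singular k -> cmeasurable (fun p => k z (toC p)).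
Proof.
move=> [mk _]; rewrite -(toC_ofC z).
exact: (cmeasurable_comp (pair1_measurable (ofC z)) mk).
Qed.

Lemma bound_ge0 g M : (forall w, normc w <= r -> normc (g w) <= M) -> 0 <= M.
Proof.
by move=> gM; apply: le_trans (gM 0 _); rewrite ?normc_ge0// normc0 ltW.
Qed.

(* The product is written with the indicator duplicated, as it is idempotent. *)
Lemma cmeasurable_kernelM k g z : weakly_singular k -> admissible g ->
  cmeasurable (fun p => chiD (toC p) * (k z (toC p) * g (toC p))).
Proof.
move=> wk [mg _].
rewrite (_ : (fun p => _) = fun p => k z (toC p) * (chiD (toC p) * g (toC p))).
  by apply: cmeasurableM => //; exact: cmeasurable_slice.
by apply/funext => p; rewrite mulrCA.
Qed.

Lemma diskop_integrable k g z : weakly_singular k -> admissible g -> normc z <= r ->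
  cintegrable plane (fun p => chiD (toC p) * (k z (toC p) * g (toC p))).
Proof.
move=> wk ag zr; have [_ [K K0 kK]] := wk; have [_ [M gM]] := ag.
have [B _ /(_ _ zr)[iB _]] := inv_integrable r0.
apply: (cintegrable_le _ (rintegrableZ (K * M) iB)); first exact: cmeasurable_kernelM.
move=> p; have [->|/(chiD_le r0) wr] := eqVneq (chiD (toC p)) 0.
  by rewrite mul0r normc0 !mulr_ge0 ?(bound_ge0 gM) ?inD_ge0 ?invr_ge0 ?normc_ge0.
rewrite !normcM chiD_normc [leRHS]mulrCA; apply: ler_wpM2l; first exact: inD_ge0.
rewrite mulrAC; apply: ler_pM; rewrite ?normc_ge0//; last exact: gM.
exact: kK.
Qed.

Lemma diskopB k g h z : weakly_singular k -> admissible g -> admissible h ->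
  normc z <= r -> diskop k (fun w => g w - h w) z = diskop k g z - diskop k h z.
Proof.
move=> wk ag ah zr; rewrite /diskop -mulrBr -cintB; [|exact: diskop_integrable..].
by congr (_ * _); apply: eq_cint => p; rewrite !mulrBr.
Qed.

Lemma normc_Npi_inv : normc (- (pi^-1 : R)%:C) = pi^-1.
Proof. by rewrite normcN normc_real ger0_norm ?invr_ge0 ?pi_ge0. Qed.

Lemma diskop_bounded k : weakly_singular k -> exists2 C, 0 <= C &
  forall g M, admissible g -> (forall w, normc w <= r -> normc (g w) <= M) ->
  forall z, normc z <= r -> normc (diskop k g z) <= C * M.
Proof.
move=> wk; have [_ [K K0 kK]] := wk; have [B B0 BP] := inv_integrable r0.
have pi0 : 0 <= (pi : R)^-1 by rewrite invr_ge0 pi_ge0.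
exists (pi^-1 * (2 * (K * B))); first by rewrite !mulr_ge0.
move=> g M ag gM z zr; have [iB leB] := BP _ zr.
have M0 := bound_ge0 gM.
rewrite normcM normc_Npi_inv -mulrA; apply: ler_wpM2l => //.
apply: (le_trans (normc_cint_le (diskop_integrable wk ag zr)
  (rintegrableZ (K * M) iB) _)).
  move=> p; have [->|/(chiD_le r0) wr] := eqVneq (chiD (toC p)) 0.
    by rewrite mul0r normc0 !mulr_ge0 ?inD_ge0 ?invr_ge0 ?normc_ge0.
  rewrite !normcM chiD_normc [leRHS]mulrCA; apply: ler_wpM2l; first exact: inD_ge0.
  rewrite mulrAC; apply: ler_pM; rewrite ?normc_ge0//; last exact: gM.
  exact: kK.
rewrite -mulrA; apply: ler_wpM2l => //.
rewrite RintegralZl// mulrAC; apply: ler_wpM2r => //; exact: ler_wpM2l.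
Qed.

(** Integrability of the composed kernels, uniformly in the intermediate point. *)
Lemma pair_integrable (a : RR -> R) k g : rintegrable plane a -> (forall p, 0 <= a p) ->
  (forall p, a p != 0 -> normc (toC p) <= r) -> weakly_singular k -> admissible g ->
  forall c : RR -> R[i], cmeasurable c -> (forall p, normc (c p) <= a p) ->
  cintegrable (plane \x plane)%E (fun q : RR * RR =>
    c q.1 * (chiD (toC q.2) * (k (toC q.1) (toC q.2) * g (toC q.2)))).
Proof.
move=> ia a0 aD [mk [K K0 kK]] [mg [M gM]] c mc ca; have M0 := bound_ge0 gM.
have [B B0 BP] := inv_integrable r0.
have m1 : measurable_fun setT (fun q : RR * RR => inD q.2 * (normc (toC q.2 - toC q.1))^-1).
  apply: measurable_funM.
    exact: (measurableT_comp (measurable_inD r0) measurable_snd).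
  apply: measurable_invr; apply: measurable_normc; apply: cmeasurableB.
    exact: (cmeasurable_comp measurable_snd (cmeasurable_toC R)).
  exact: (cmeasurable_comp measurable_fst (cmeasurable_toC R)).
have ib : rintegrable (plane \x plane)%E (fun q : RR * RR =>
    a q.1 * (inD q.2 * (normc (toC q.2 - toC q.1))^-1)).
  apply: (rintegrable_prod (B := B)) => //.
    by move=> q; rewrite mulr_ge0 ?inD_ge0 ?invr_ge0 ?normc_ge0.
  by move=> p /aD/BP.
apply: (cintegrable_le _ (rintegrableZ (K * M) ib)).
  rewrite (_ : (fun q => _) = fun q : RR * RR => c q.1 * (k (toC q.1) (toC q.2) *
    (chiD (toC q.2) * g (toC q.2)))); last first.
    by apply/funext => q; congr (_ * _); rewrite mulrCA.
  apply: cmeasurableM; first exact: (cmeasurable_comp measurable_fst mc).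
  apply: cmeasurableM => //.
  exact: (cmeasurable_comp measurable_snd mg).
move=> q; have R0 : 0 <= K * M * (a q.1 * (inD q.2 * (normc (toC q.2 - toC q.1))^-1)).
  by rewrite !mulr_ge0 ?inD_ge0 ?invr_ge0 ?normc_ge0.
have [->|/(chiD_le r0) wr] := eqVneq (chiD (toC q.2)) 0.
  by rewrite mul0r mulr0 normc0.
have [z0|/aD zr] := eqVneq (a q.1) 0.
  have : normc (c q.1) <= 0 by rewrite -z0.
  by rewrite le_eqVlt ltNge normc_ge0 orbF normc_eq0 => /eqP ->; rewrite mul0r normc0.
rewrite !normcM chiD_normc.
have -> : K * M * (a q.1 * (inD q.2 * (normc (toC q.2 - toC q.1))^-1)) =
  a q.1 * (inD q.2 * ((K * (normc (toC q.2 - toC q.1))^-1) * M)) by ring.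
apply: ler_pM; rewrite ?mulr_ge0 ?normc_ge0 ?inD_ge0//.
apply: ler_wpM2l; first exact: inD_ge0.
by apply: ler_pM; rewrite ?normc_ge0 ?gM ?kK.
Qed.

Lemma diskop_admissible k g : weakly_singular k -> admissible g ->
  admissible (diskop k g).
Proof.
move=> wk ag; have [C C0 CP] := diskop_bounded wk; have [_ [M gM]] := ag.
split; last by exists (C * M) => w wr; exact: (CP g M).
have aD p : inD p != 0 -> normc (toC p) <= r.
  by rewrite /(inD _); case: (normc (toC p) <= r) => //=; rewrite eqxx.
have ch p : normc (chiD (toC p)) <= inD p by rewrite chiD_normc.
have [m _ _] := cint_fubini (pair_integrable (rintegrable_inD r0) (inD_ge0 r) aD wk ag
  (cmeasurable_chiD r) ch).
rewrite (_ : (fun p => _) = fun p => - (pi^-1 : R)%:C * cint plane (fun y =>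
  chiD (toC p) * (chiD (toC y) * (k (toC p) (toC y) * g (toC y))))).
  by apply: cmeasurableM => //; exact: cmeasurable_cst.
apply/funext => p; rewrite /diskop mulrCA; congr (_ * _); rewrite chiDE//.
case: (leP _ r) => pr; last by rewrite mul0r -[LHS](cint0 plane); apply: eq_cint => y; rewrite mul0r.
by rewrite mul1r; apply: eq_cint => y; rewrite mul1r.
Qed.

End DiskOperators.

Section KernelMeasurability.
Variables (R : realType) (r : R).
Hypothesis r0 : 0 < r.
Local Notation TR := (measurableTypeR R).
Local Notation RR := (TR * TR)%type.
Local Notation plane := (@plane R).
Local Notation toC := (@toC R).
Local Notation DD := (`[0%R, (r ^+ 2)%R]%classic : set TR).
Local Notation chiD := (chi DD).

(* The dispatch is on the syntax, as failing unifications are costly here. *)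
Ltac cmeas := lazymatch goal with
  | |- cmeasurable (fun _ => ?c) => exact: cmeasurable_cst
  | |- cmeasurable (fun p => @?a p + @?b p) => apply: cmeasurableD; cmeas
  | |- cmeasurable (fun p => @?a p * @?b p) => apply: cmeasurableM; cmeas
  | |- cmeasurable (fun p => - @?a p) => apply: cmeasurableN; cmeas
  | |- cmeasurable (fun p => @?a p ^+ _) => apply: cmeasurableX; cmeas
  | |- cmeasurable (fun p => (@?a p)^*%R) => apply: cmeasurable_conj; cmeas
  | |- cmeasurable (fun p => \sum_(_ <- _ | _) _) => apply: cmeasurable_sum => ?; cmeas
  | |- _ => try exact: cmeasurable_toC
  end.

Lemma Re_log_argument (a b : R[i]) : normc a <= r -> normc b <= r -> a != b ->
  0 < Re (((r ^+ 2)%:C - a * b^*) / (normc (a - b) ^+ 2)%:C).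
Proof.
move=> ar br ab; have d0 : 0 < normc (a - b) by rewrite normc_gt0 subr_eq0.
pose c : R := (normc (a - b) ^+ 2)^-1; pose w : R[i] := (r ^+ 2)%:C - a * b^*.
suff h : 0 < Re (c%:C * w).
  move: h; congr (0 < Re _); rewrite mulrC; congr (_ * _).
  by rewrite -fmorphV.
have -> : Re (c%:C * w) = c * Re w by rewrite (Re_mulc c%:C w) /= mul0r subr0.
rewrite mulr_gt0 ?invr_gt0 ?exprn_gt0//.
move: (normc_sqr (a - b)) (normc_sqr a) (normc_sqr b).
have : normc a ^+ 2 <= r ^+ 2 by rewrite ler_sqr ?nnegrE ?normc_ge0// ltW.
have : normc b ^+ 2 <= r ^+ 2 by rewrite ler_sqr ?nnegrE ?normc_ge0// ltW.
have : 0 < normc (a - b) ^+ 2 by rewrite exprn_gt0.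
rewrite !(Re_addc, Im_addc, Re_oppc, Im_oppc, Re_mulc, Re_conjc, Im_conjc) /=.
by lra.
Qed.

Lemma cmeasurable_C3 z m n : normc z <= r ->
  cmeasurable (fun p => chiD (toC p) * C3 r z (toC p) m n).
Proof.
move=> zr.
pose w p : R[i] := ((r ^+ 2)%:C - z * (toC p)^*) / (normc (z - toC p) ^+ 2)%:C.
pose L p : R[i] := ln (normc (w p)) +i* atan (Im (w p) / Re (w p)).
have mw : cmeasurable w.
  apply: cmeasurableM; first by cmeas.
  apply: cmeasurableV; apply: cmeasurable_real; apply: measurable_funX.
  by apply: measurable_normc; cmeas.
have mL : cmeasurable L.
  split => /=.
    by apply: (measurableT_comp (@measurable_ln R)); exact: measurable_normc.
  apply: (measurableT_comp (continuous_measurable_fun (@continuous_atan R))).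
  by case: mw => m1 m2; apply: measurable_funM => //; exact: measurable_invr.
pose C3L p : R[i] := ((toC p)^* - z^*) ^+ m.-1 *
    (C1 z (toC p) n + (z - toC p) ^+ n.-1 * L p)
  + \sum_(1 <= l < m) 'C(m.-1, l)%:R * ((toC p)^* - z^*) ^+ (m.-1 - l) *
      (-1 / l%:R * (z^* - (toC p)^*) ^+ l * (z - toC p) ^+ n.-1
       + 1 / l%:R * C2 r z (toC p) l n).
have mC3L : cmeasurable C3L.
  rewrite /C3L /C1 /C2; cmeas; exact: mL.
have mz : measurable [set ofC z : RR].
  rewrite (_ : [set _] = [set (ofC z).1] `*` [set (ofC z).2]).
    by apply: measurableX; exact: measurable_set1.
  by apply/seteqP; split => -[x y] /= [-> ->].
have := cmeasurable_patch mz
  (cmeasurable_cst RR (chiD z * C3 r z z m n)) (cmeasurableM (cmeasurable_chiD r) mC3L).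
congr cmeasurable; apply/funext => p; case: ifPn => [/set_mem /= ->|].
  by rewrite toC_ofC.
rewrite notin_setE /= => pz; apply: chiD_eq => // pr; rewrite /C3L /C3.
have zp : z != toC p.
  by apply/eqP => zp; apply: pz; rewrite zp; case: (p).
by rewrite LnE// Re_log_argument.
Qed.

End KernelMeasurability.

(** * Composition of the one-variable operators *)

Section DiskComposition.
Variables (R : realType) (r : R).
Hypothesis r0 : 0 < r.
Local Notation TR := (measurableTypeR R).
Local Notation RR := (TR * TR)%type.
Local Notation plane := (@plane R).
Local Notation toC := (@toC R).
Local Notation DD := (`[0%R, (r ^+ 2)%R]%classic : set TR).
Local Notation chiD := (chi DD).
Local Notation inD := (inD r).
Local Notation pic := (- (pi^-1 : R)%:C).
Local Notation diskop := (diskop r).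
Local Notation admissible := (admissible r).
Local Notation weakly_singular := (weakly_singular r).
Implicit Types (g h : R[i] -> R[i]) (k : R[i] -> R[i] -> R[i]).

Lemma singular_pair_integrable k l (z e : R[i]) : weakly_singular k ->
  weakly_singular l -> normc z <= r -> normc e <= r -> z != e ->
  cintegrable plane (fun p => chiD (toC p) * (k z (toC p) * l (toC p) e)).
Proof.
move=> wk wl zr er ze; have [_ [K K0 kK]] := wk; have [ml [L L0 lL]] := wl.
apply: (cintegrable_le _ (rintegrableZ (K * L) (inv_inv_integrable r0 zr er ze))).
  apply: cmeasurableM; first exact: cmeasurable_chiD.
  apply: cmeasurableM; first exact: cmeasurable_slice wk.
  rewrite -(toC_ofC e); exact: (cmeasurable_comp (pair2_measurable (ofC e)) ml).
move=> p; have [->|/(chiD_le r0) pr] := eqVneq (chiD (toC p)) 0.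
  by rewrite mul0r normc0 !mulr_ge0 ?inD_ge0 ?invr_ge0 ?normc_ge0.
rewrite !normcM chiD_normc// [leRHS]mulrCA; apply: ler_wpM2l; first exact: inD_ge0.
rewrite mulrACA; apply: ler_pM; rewrite ?normc_ge0//; first exact: kK.
by rewrite [normc (toC p - e)]normc_distC; exact: lL.
Qed.

(** By Fubini, the composite has kernel the integral of the product of the
    kernels; that integral only needs to be known off a circle. *)
Lemma diskop_comp k l (m : R[i] -> R[i]) g z : weakly_singular k -> weakly_singular l ->
  admissible g -> normc z <= r -> cmeasurable (fun p => chiD (toC p) * m (toC p)) ->
  (forall e, normc e <= r -> normc z != normc e ->
     pic * cint plane (fun p => chiD (toC p) * (k z (toC p) * l (toC p) e)) = m e) ->
  cintegrable plane (fun p => chiD (toC p) * (m (toC p) * g (toC p))) /\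
  diskop k (diskop l g) z =
    pic * cint plane (fun p => chiD (toC p) * (m (toC p) * g (toC p))).
Proof.
move=> wk wl ag zr mm klm.
have [_ [K K0 kK]] := wk; have [mg [M gM]] := ag.
have [B _ /(_ _ zr)[iB _]] := inv_integrable r0.
pose a p := (pi^-1 * K) * (inD p * (normc (toC p - z))^-1).
have pi0 : 0 <= (pi : R)^-1 by rewrite invr_ge0 pi_ge0.
have ia : rintegrable plane a by exact: rintegrableZ.
have a0 p : 0 <= a p by rewrite !mulr_ge0 ?inD_ge0 ?invr_ge0 ?normc_ge0 ?pi_ge0.
have aD p : a p != 0 -> normc (toC p) <= r.
  by rewrite /a /(inD _); case: (normc (toC p) <= r) => //=; rewrite mul0r mulr0 eqxx.
pose c p := pic * (chiD (toC p) * k z (toC p)).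
have mc : cmeasurable c.
  apply: cmeasurableM; first exact: cmeasurable_cst.
  by apply: cmeasurableM; [exact: cmeasurable_chiD|exact: cmeasurable_slice wk].
have ca p : normc (c p) <= a p.
  rewrite /c /a; have [->|/(chiD_le r0) pr] := eqVneq (chiD (toC p)) 0.
    by rewrite mul0r mulr0 normc0 !mulr_ge0 ?inD_ge0 ?invr_ge0 ?normc_ge0 ?pi_ge0.
  rewrite !normcM normc_Npi_inv chiD_normc// -mulrA; apply: ler_wpM2l => //.
  by rewrite [leRHS]mulrCA; apply: ler_wpM2l; rewrite ?inD_ge0// kK.
have [_ iG eG] := cint_fubini (pair_integrable r0 ia a0 aD wl ag mc ca).
pose N : set RR := sqmod (R := R) @^-1` [set normc z ^+ 2].
have mN : measurable N by exact: measurable_sqmod_preimage.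
have N0 : plane N = 0%E by exact: (measure_circle (sqr_ge0 _)).
have mmg : cmeasurable (fun p => chiD (toC p) * (m (toC p) * g (toC p))).
  rewrite (_ : (fun p => _) = fun p => (chiD (toC p) * m (toC p)) *
    (chiD (toC p) * g (toC p))); first exact: cmeasurableM.
  apply/funext => p; rewrite -mulrA; apply: (chiD_eq r0) => pr.
  by rewrite (chiD_eq1 r0 pr) mul1r.
pose G y := cint plane (fun x => c x * (chiD (toC y) * (l (toC x) (toC y) * g (toC y)))).
have Gm y : ~ N y -> G y = chiD (toC y) * (m (toC y) * g (toC y)).
  move=> Ny; rewrite /G; case: (leP (normc (toC y)) r) => yr; last first.
    have -> : chiD (toC y) = 0 by rewrite (chiDE r0) leNgt yr.
    by rewrite !mul0r -[RHS](cint0 plane); apply: eq_cint => x; rewrite mul0r mulr0.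
  have ne : normc z != normc (toC y).
    apply/eqP => zy; apply: Ny.
    have h : sqmod y = normc z ^+ 2 by rewrite sqmodE zy.
    exact: h.
  have zy : z != toC y by apply: contraNneq ne => ->.
  rewrite (chiD_eq1 r0 yr) mul1r -(klm _ yr ne) -mulrA [cint _ _ * _]mulrC.
  have i := singular_pair_integrable wk wl zr yr zy.
  rewrite -cintZ; last exact: i.
  rewrite -cintZ; last exact: cintegrableZ.
  by apply: eq_cint => x; rewrite /c; ring.
split; first exact: cintegrable_ae_eq mN N0 iG mmg Gm.
transitivity (pic * cint plane G); last first.
  congr (_ * _); exact: (cint_ae_eq mN N0 (cintegrable_measurable iG) mmg Gm).
rewrite /(diskop _ _ _) /G; congr (_ * _); rewrite -eG; apply: eq_cint => x.
case: (leP (normc (toC x)) r) => xr; last first.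
  have x0 : chiD (toC x) = 0 by rewrite (chiDE r0) leNgt xr.
  rewrite x0 mul0r -[LHS](cint0 plane); apply: eq_cint => y.
  by rewrite /c x0 mul0r mulr0 mul0r.
have i := diskop_integrable r0 wl ag xr.
rewrite (chiD_eq1 r0 xr) mul1r mulrCA mulrA -cintZ; last exact: i.
by apply: eq_cint => y; rewrite /c /= (chiD_eq1 r0 xr) mul1r.
Qed.

End DiskComposition.

(** * Iterates in one variable *)

Section DiskIterates.
Variables (R : realType) (r : R).
Hypothesis r0 : 0 < r.
Local Notation TR := (measurableTypeR R).
Local Notation RR := (TR * TR)%type.
Local Notation plane := (@plane R).
Local Notation toC := (@toC R).
Local Notation DD := (`[0%R, (r ^+ 2)%R]%classic : set TR).
Local Notation chiD := (chi DD).
Local Notation pic := (- (pi^-1 : R)%:C).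
Local Notation diskop := (diskop r).
Local Notation admissible := (admissible r).
Local Notation weakly_singular := (weakly_singular r).
Implicit Types (g h : R[i] -> R[i]) (k : R[i] -> R[i] -> R[i]).

(** The kernel of the iterate of order [m.+1] of the Cauchy transform. *)
Definition powker m (z w : R[i]) := (z^* - w^*) ^+ m / m`!%:R / (w - z).

Definition conjker k z w : R[i] := (k z w)^*.

Lemma natC_neq0 n : (0 < n)%N -> (n%:R : R[i]) != 0.
Proof. by rewrite pnatr_eq0 lt0n. Qed.

Lemma pic_pi : (pi^-1 : R)%:C * (pi : R)%:C = 1.
Proof. by rewrite -rmorphM /= mulVf// gt_eqF// pi_gt0. Qed.

Lemma conj_powkerE n (z w : R[i]) :
  conjker (powker n) z w = (z - w) ^+ n / n`!%:R / (w^* - z^*).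
Proof.
rewrite /conjker /powker !rmorphM /= !fmorphV /= rmorphXn /= !rmorphB /= rmorph_nat.
by rewrite ![_^*^*]conjCK.
Qed.

Lemma powker_singular m : weakly_singular (powker m).
Proof.
split.
  have m1 : cmeasurable (fun q : RR * RR => toC q.1).
    exact: (cmeasurable_comp measurable_fst (cmeasurable_toC R)).
  have m2 : cmeasurable (fun q : RR * RR => toC q.2).
    exact: (cmeasurable_comp measurable_snd (cmeasurable_toC R)).
  apply: cmeasurableM; last by apply: cmeasurableV; exact: cmeasurableB.
  apply: cmeasurableM; last exact: cmeasurable_cst.
  apply: cmeasurableX; apply: cmeasurableB; exact: cmeasurable_conj.
exists ((2 * r) ^+ m); first by rewrite exprn_ge0// mulr_ge0// ltW.
move=> z w zr wr; rewrite /powker !normcM !normcV normcX normc_nat.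
apply: ler_wpM2r; first by rewrite invr_ge0 normc_ge0.
rewrite ler_pdivrMr ?ltr0n ?fact_gt0//.
have h : normc (z^* - w^*) ^+ m <= (2 * r) ^+ m.
  apply: lerXn2r; rewrite ?nnegrE ?normc_ge0 ?mulr_ge0 ?(ltW r0)//.
  by rewrite (le_trans (normcB _ _))// !normc_conj mulr_natl mulr2n lerD.
apply: le_trans h _; rewrite ler_peMr ?exprn_ge0 ?mulr_ge0 ?(ltW r0)//.
by rewrite ler1n fact_gt0.
Qed.

Lemma conjker_singular k : weakly_singular k -> weakly_singular (conjker k).
Proof.
move=> [mk [K K0 kK]]; split; first exact: cmeasurable_conj.
by exists K => // z w zr wr; rewrite /conjker normc_conj kK.
Qed.

Lemma chiD_conj w : (chiD w)^* = chiD w.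
Proof. by rewrite (chiDE r0); case: (_ <= _); rewrite ?conjC1 ?conjC0. Qed.

Lemma admissible_conj g : admissible g -> admissible (fun w => (g w)^*).
Proof.
move=> [mg [M gM]]; split; last by exists M => w wr; rewrite normc_conj gM.
rewrite (_ : (fun p => _) = fun p => (chiD (toC p) * g (toC p))^*).
  exact: cmeasurable_conj.
by apply/funext => p; rewrite rmorphM /= chiD_conj.
Qed.

Lemma diskop_conjker k g z : weakly_singular k -> admissible g -> normc z <= r ->
  diskop (conjker k) g z = (diskop k (fun w => (g w)^*) z)^*.
Proof.
move=> wk ag zr; rewrite /(diskop _ _ _) rmorphM /= rmorphN /=.
rewrite -cint_conj; last first.
  have h := diskop_integrable r0 wk (admissible_conj ag) zr. exact: h.
congr (_ * _); first by congr (- _); apply/eqP; rewrite eq_complex /= oppr0 !eqxx.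
apply: eq_cint => p; rewrite !rmorphM /= chiD_conj; congr (_ * (_ * _)).
by apply/esym; exact: conjCK.
Qed.

Lemma iter_admissible k m g : weakly_singular k -> admissible g ->
  admissible (iter m (diskop k) g).
Proof. by move=> wk ag; elim: m => //= m IH; exact: diskop_admissible. Qed.

Lemma powker_step m (z e : R[i]) : normc z <= r -> normc e <= r -> z != e ->
  pic * cint plane (fun p => chiD (toC p) * (powker 0 z (toC p) * powker m (toC p) e)) =
  powker m.+1 z e.
Proof.
move=> zr er ze.
have i := singular_pair_integrable r0 (powker_singular 0) (powker_singular m) zr er ze.
have ez : e - z != 0 by rewrite subr_eq0 eq_sym.
have ze' : z - e != 0 by rewrite subr_eq0.
have m0 := natC_neq0 (fact_gt0 m).
have pi0 : (pi : R)%:C != 0.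
  by rewrite -normc_eq0 normc_real normr_eq0 gt_eqF// pi_gt0.
have := iterate_kernel_step r0 m zr er ze.
rewrite (_ : (fun p => _) = fun p => - m`!%:R *
    (chiD (toC p) * (powker 0 z (toC p) * powker m (toC p) e))); last first.
  apply/funext => p; rewrite /powker expr0 fact0 divr1 mul1r.
  rewrite -[e - toC p]opprB invrN; set u := (toC p - e)^-1.
  by set v := (toC p - z)^-1; field.
rewrite cintZ; last exact: i.
set X := cint _ _ => EX.
have -> : X = (pi : R)%:C * ((z^* - e^*) ^+ m.+1 / m.+1%:R / (z - e) / m`!%:R).
  apply: (mulfI m0); apply: oppr_inj; rewrite -mulNr EX; field.
  by rewrite m0 ze' nat1r pnatr_eq0.
rewrite mulNr mulrA pic_pi mul1r /powker factS natrM.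
have -> : e - z = - (z - e) by rewrite opprB.
by field; rewrite ze' m0 nat1r pnatr_eq0.
Qed.

Lemma iter_powker m g z : admissible g -> normc z <= r ->
  iter m.+1 (diskop (powker 0)) g z = diskop (powker m) g z.
Proof.
move=> ag; elim: m z => [//|m IH] z zr.
transitivity (diskop (powker 0) (diskop (powker m) g) z).
  by apply: (eq_diskop r0) => w wr; rewrite -IH.
have mm : cmeasurable (fun p => chiD (toC p) * powker m.+1 z (toC p)).
  apply: cmeasurableM; first exact: cmeasurable_chiD.
  exact: (cmeasurable_slice z (powker_singular m.+1)).
have K e : normc e <= r -> normc z != normc e ->
    pic * cint plane (fun p => chiD (toC p) *
      (powker 0 z (toC p) * powker m (toC p) e)) = powker m.+1 z e.
  by move=> er ze; apply: powker_step => //; apply: contraNneq ze => ->.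
by case: (diskop_comp r0 (powker_singular 0) (powker_singular m) ag zr mm K).
Qed.

Lemma iter_conj_powker m g z : admissible g -> normc z <= r ->
  iter m.+1 (diskop (conjker (powker 0))) g z = diskop (conjker (powker m)) g z.
Proof.
move=> ag zr; rewrite (diskop_conjker (powker_singular m) ag zr).
have ac := admissible_conj ag; rewrite -(iter_powker m ac zr).
have w0 := powker_singular 0; have wc := conjker_singular w0.
elim: m z zr => [|m IH] z zr; first exact: (diskop_conjker w0 ag zr).
rewrite iterS (diskop_conjker w0 (iter_admissible m.+1 wc ag) zr).
apply: (congr1 (fun x : R[i] => x^*)); apply: (eq_diskop r0) => w wr.
by rewrite (IH _ wr) [_^*^*]conjCK.
Qed.

(** The formula in one variable. *)
Lemma iter_formula m n g z : admissible g -> normc z <= r ->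
  cintegrable plane (fun p => chiD (toC p) * (C3 r z (toC p) m.+1 n.+1 * g (toC p))) /\
  iter m.+1 (diskop (powker 0)) (iter n.+1 (diskop (conjker (powker 0))) g) z =
  pic * ((-1) ^+ m / ((m`!)%:R * n`!%:R) *
    cint plane (fun p => chiD (toC p) * (C3 r z (toC p) m.+1 n.+1 * g (toC p)))).
Proof.
move=> ag zr; pose q : R[i] := (-1) ^+ m / ((m`!)%:R * n`!%:R).
have m0 := natC_neq0 (fact_gt0 m); have n0 := natC_neq0 (fact_gt0 n).
have q0 : q != 0 by rewrite mulf_neq0 ?invr_eq0 ?mulf_neq0// signr_eq0.
have wp := powker_singular m; have wc := conjker_singular (powker_singular n).
have wc0 := conjker_singular (powker_singular 0).
pose c3 e := q * C3 r z e m.+1 n.+1.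
have mm : cmeasurable (fun p => chiD (toC p) * c3 (toC p)).
  rewrite (_ : (fun p => _) = fun p => q * (chiD (toC p) * C3 r z (toC p) m.+1 n.+1)).
    apply: cmeasurableM; first exact: cmeasurable_cst.
    exact: cmeasurable_C3.
  by apply/funext => p; rewrite mulrCA.
have K e : normc e <= r -> normc z != normc e ->
    pic * cint plane (fun p => chiD (toC p) *
      (powker m z (toC p) * conjker (powker n) (toC p) e)) = c3 e.
  move=> er ze; have ze' : z != e by apply: contraNneq ze => ->.
  have i := singular_pair_integrable r0 wp wc zr er ze'.
  have := kernel_integral r0 m n zr er ze.
  have q'0 : - q^-1 != 0 by rewrite oppr_eq0 invr_eq0.
  rewrite (_ : (fun p => _) = fun p => - q^-1 *
     (chiD (toC p) * (powker m z (toC p) * conjker (powker n) (toC p) e))); last first.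
    apply/funext => p; rewrite conj_powkerE /powker /q.
    have -> : (z^* - (toC p)^*) ^+ m = (-1) ^+ m * ((toC p)^* - z^*) ^+ m.
      by rewrite -exprNn opprB.
    rewrite -[e^* - _]opprB invrN.
    set u := (toC p - z)^-1; set v := ((toC p)^* - e^*)^-1.
    have s0 : (-1) ^+ m != 0 :> R[i] by rewrite signr_eq0.
    by field; rewrite s0 m0 n0.
  rewrite cintZ; last exact: i.
  set X := cint _ _ => EX; apply: (mulfI q'0).
  by rewrite mulrCA EX /c3 !mulNr (mulKf q0) mulrA pic_pi mul1r.
have [iG eG] := diskop_comp r0 wp wc ag zr mm K.
split.
  have := cintegrableZ q^-1 iG; congr (cintegrable _ _); apply/funext => p.
  by rewrite /c3 mulrCA -(mulrA q) mulKf.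
have ac := iter_admissible n.+1 wc0 ag.
rewrite (iter_powker m ac zr) -cintZ; last first.
  have := cintegrableZ q^-1 iG; congr (cintegrable _ _); apply/funext => p.
  by rewrite /c3 mulrCA -(mulrA q) mulKf.
transitivity (diskop (powker m) (diskop (conjker (powker n)) g) z).
  by apply: (eq_diskop r0) => w wr; rewrite (iter_conj_powker n ag wr).
rewrite eG; congr (_ * _); apply: eq_cint => p; rewrite /c3 -/q.
by set X := C3 _ _ _ _ _; ring.
Qed.

End DiskIterates.

(** * Hoelder continuity *)

Section HoelderKernel.
Variables (R : realType) (r alpha : R).
Hypotheses (r0 : 0 < r) (alpha0 : 0 < alpha) (alpha1 : alpha < 1).
Local Notation TR := (measurableTypeR R).
Local Notation RR := (TR * TR)%type.
Local Notation plane := (@plane R).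
Local Notation toC := (@toC R).
Local Notation DD := (`[0%R, (r ^+ 2)%R]%classic : set TR).
Local Notation chiD := (chi DD).
Local Notation inD := (inD r).
Local Notation pic := (- (pi^-1 : R)%:C).
Local Notation diskop := (diskop r).
Local Notation admissible := (admissible r).
Local Notation weakly_singular := (weakly_singular r).
Local Notation sing a := ((a `^ (1 + alpha))^-1).
Implicit Types (g h : R[i] -> R[i]) (k : R[i] -> R[i] -> R[i]).

Lemma div_le_sing (a b d : R) : 0 < a -> a <= b -> 0 <= d -> d <= a + b ->
  d * (a^-1 * b^-1) <= 2 * d `^ alpha * sing a.
Proof.
move=> a0 ab d0 dab; have b0 : 0 < b by exact: lt_le_trans ab.
have [->|dn0] := eqVneq d 0.
  by rewrite mul0r mulr_ge0 ?invr_ge0 ?powR_ge0// mulr_ge0 ?powR_ge0.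
have dgt0 : 0 < d by rewrite lt_neqAle eq_sym dn0.
have a1 : 0 <= 1 - alpha by rewrite subr_ge0 ltW.
have d2 : d <= 2 * b by lra.
have h : d `^ (1 - alpha) * a `^ alpha <= 2 * b.
  have -> : 2 * b = (2 * b) `^ (1 - alpha) * (2 * b) `^ alpha.
    rewrite -powRD ?subrK ?powRr1 ?mulr_ge0 ?(ltW b0)//.
    by apply/implyP => _; rewrite mulf_neq0 ?gt_eqF.
  apply: ler_pM; rewrite ?powR_ge0//; apply: ge0_ler_powR;
    rewrite ?nnegrE ?mulr_ge0 ?(ltW alpha0) ?(ltW a0) ?(ltW b0)//; lra.
have dE : d = d `^ alpha * d `^ (1 - alpha).
  rewrite -powRD; first by rewrite addrC subrK powRr1.
  by apply/implyP => _; exact: dn0.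
have aE : a `^ (1 + alpha) = a * a `^ alpha.
  rewrite powRD; first by rewrite powRr1 ?(ltW a0).
  by apply/implyP => _; rewrite gt_eqF.
have ap : 0 < a `^ alpha by rewrite powR_gt0.
rewrite {1}dE aE -mulrA [2 * _]mulrC -mulrA; apply: ler_wpM2l; first exact: powR_ge0.
rewrite !invfM; set A := a `^ alpha in h ap *; set E := d `^ _ in h *.
rewrite mulrCA [leRHS]mulrCA; apply: ler_wpM2l; first by rewrite invr_ge0 ltW.
by rewrite ler_pdivrMr// mulrAC ler_pdivlMr.
Qed.

Lemma cauchy_difference (z z' w : R[i]) :
  normc ((w - z)^-1 - (w - z')^-1) <= 2 * normc (z - z') `^ alpha *
    (sing (normc (w - z)) + sing (normc (w - z'))).
Proof.
have s0 x : 0 <= sing x by rewrite invr_ge0 powR_ge0.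
have p0 : 1 + alpha != 0 by rewrite gt_eqF// addr_gt0.
have diag (x y : R[i]) : normc ((x - y)^-1) <= 2 * normc (x - y) `^ alpha *
    sing (normc (x - y)).
  have [->|xy] := eqVneq x y; first by rewrite subrr invr0 normc0 !mulr_ge0 ?powR_ge0.
  have n0 : 0 < normc (x - y) by rewrite normc_gt0 subr_eq0.
  rewrite normcV powRD; last by apply/implyP => _; rewrite gt_eqF.
  rewrite powRr1 ?normc_ge0// invfM mulrCA -mulrA divff ?mulr1; last first.
    by rewrite gt_eqF// powR_gt0.
  by rewrite mulrC ler_pMl ?invr_gt0// ler1n.
have [->|wz] := eqVneq w z.
  rewrite subrr invr0 sub0r normcN normc0 (powR0 p0) invr0 add0r; exact: diag.
have [->|wz'] := eqVneq w z'.
  rewrite subrr invr0 subr0 normc0 (powR0 p0) invr0 addr0 (normc_distC z); exact: diag.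
have a0 : 0 < normc (w - z) by rewrite normc_gt0 subr_eq0.
have b0 : 0 < normc (w - z') by rewrite normc_gt0 subr_eq0.
have -> : (w - z)^-1 - (w - z')^-1 = (z - z') * ((w - z)^-1 * (w - z')^-1).
  by field; rewrite !subr_eq0 wz wz'.
rewrite !normcM !normcV; set d := normc (z - z').
have d0 : 0 <= d by exact: normc_ge0.
have dab : d <= normc (w - z) + normc (w - z').
  by rewrite /d (normc_distC w z) normc_dist_triangle.
have q0 : 0 <= 2 * d `^ alpha by rewrite mulr_ge0 ?powR_ge0.
case: (leP (normc (w - z)) (normc (w - z'))) => [ab|/ltW ba].
  apply: le_trans (div_le_sing a0 ab d0 dab) _.
  by apply: ler_wpM2l => //; rewrite lerDl.
rewrite addrC in dab; rewrite [_^-1 * _]mulrC.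
apply: le_trans (div_le_sing b0 ba d0 dab) _.
by apply: ler_wpM2l => //; rewrite lerDr.
Qed.

Definition hoelder_kernel k := weakly_singular k /\ forall z z' w,
  normc (k z w - k z' w) <= 2 * normc (z - z') `^ alpha *
    (sing (normc (w - z)) + sing (normc (w - z'))).

Lemma hoelder_powker : hoelder_kernel (powker (R := R) 0).
Proof.
split; first exact: powker_singular.
by move=> z z' w; rewrite /powker !expr0 fact0 divr1 !mul1r cauchy_difference.
Qed.

Lemma hoelder_conjker k : hoelder_kernel k -> hoelder_kernel (conjker k).
Proof.
move=> [wk kk]; split; first exact: conjker_singular.
by move=> z z' w; rewrite /conjker -rmorphB normc_conj kk.
Qed.

Lemma diskop_hoelder k : hoelder_kernel k -> exists2 C, 0 <= C &
  forall g M, admissible g -> (forall w, normc w <= r -> normc (g w) <= M) ->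
  forall z z', normc z <= r -> normc z' <= r ->
  normc (diskop k g z - diskop k g z') <= C * M * normc (z - z') `^ alpha.
Proof.
move=> [wk kk]; have s2 : 0 < 1 + alpha < 2 by rewrite addr_gt0//= -[ltRHS]natr1 addrC ltrD2r.
have [B B0 BP] := sing_integrable r0 s2.
have pi0 : 0 <= (pi : R)^-1 by rewrite invr_ge0 pi_ge0.
exists (pi^-1 * (2 * (2 * (B + B)))); first by rewrite !mulr_ge0 ?addr_ge0.
move=> g M ag gM z z' zr z'r; have M0 := bound_ge0 r0 gM.
have [iz lez] := BP _ zr; have [iz' lez'] := BP _ z'r.
have i := diskop_integrable r0 wk ag zr; have i' := diskop_integrable r0 wk ag z'r.
rewrite /(diskop _ _ _) -mulrBr -(cintB i i') normcM normc_Npi_inv.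
pose d := normc (z - z') `^ alpha; have d0 : 0 <= d by exact: powR_ge0.
have ib := rintegrableZ (2 * d * M) (rintegrableD iz iz').
have s0 (x : R) : 0 <= sing x by rewrite invr_ge0 powR_ge0.
rewrite -!mulrA; apply: ler_wpM2l => //.
apply: (le_trans (normc_cint_le (cintegrableB i i') ib _)).
  move=> p; rewrite -!mulrBr -mulrBl; have [->|/(chiD_le r0) pr] := eqVneq (chiD (toC p)) 0.
    by rewrite mul0r normc0 mulr_ge0 ?addr_ge0 ?mulr_ge0 ?inD_ge0.
  rewrite !normcM (chiD_normc r0) -mulrDr [leRHS]mulrCA; apply: ler_wpM2l.
    exact: inD_ge0.
  by rewrite mulrAC; apply: ler_pM; rewrite ?normc_ge0 ?gM// kk.
apply: ler_wpM2l => //; rewrite RintegralZl//; last exact: rintegrableD.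
rewrite RintegralD// -/d.
have -> : 2 * ((B + B) * (M * d)) = 2 * d * M * (B + B) by ring.
by apply: ler_wpM2l; rewrite ?mulr_ge0// lerD.
Qed.

End HoelderKernel.

(** * The operators in several variables *)

Section CoordinateOps.
Variables (R : realType) (r alpha : R) (n : nat).
Hypotheses (r0 : 0 < r) (alpha0 : 0 < alpha) (alpha1 : alpha < 1).
Local Notation TR := (measurableTypeR R).
Local Notation RR := (TR * TR)%type.
Local Notation plane := (@plane R).
Local Notation toC := (@toC R).
Local Notation DD := (`[0%R, (r ^+ 2)%R]%classic : set TR).
Local Notation chiD := (chi DD).
Local Notation inD := (inD r).
Local Notation pic := (- (pi^-1 : R)%:C).
Local Notation diskop := (diskop r).
Local Notation admissible := (admissible r).
Local Notation weakly_singular := (weakly_singular r).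
Local Notation hoelder_kernel := (hoelder_kernel r alpha).
Local Notation pt := ('I_n -> R[i]).
Local Notation upd z j w := [eta z with j |-> w].
Local Notation nice := (nice r alpha).
Implicit Types (f g : pt -> R[i]) (z : pt) (k : R[i] -> R[i] -> R[i]).

Definition coordop k (j : 'I_n) f : pt -> R[i] :=
  fun z => diskop k (fun w => f (upd z j w)) (z j).

Lemma nice_admissible f z j : nice f -> polydisk r z ->
  admissible (fun w => f (upd z j w)).
Proof.
move=> nf zD; have [M [H [M0 H0 fM fH]]] := nf.
split; last by exists M => w wr; apply: fM; exact: polydisk_upd.
have m := slice2_measurable r0 alpha0 j j nf zD.
have := cmeasurable_comp (pair1_measurable (ofC (0 : R[i]))) m.
congr cmeasurable; apply/funext => p /=.
rewrite toC_ofC upd_upd (chiD_eq1 r0) ?mul1r//.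
by rewrite normc0 ltW.
Qed.

Lemma eq_coordop k j f g z : polydisk r z ->
  (forall y, polydisk r y -> f y = g y) -> coordop k j f z = coordop k j g z.
Proof.
move=> zD fg; apply: (eq_diskop r0) => w wr; congr (_ * _); apply: fg.
exact: polydisk_upd.
Qed.

Lemma coordopB k j f g z : weakly_singular k -> nice f -> nice g -> polydisk r z ->
  coordop k j (fun y => f y - g y) z = coordop k j f z - coordop k j g z.
Proof.
move=> wk nf ng zD; apply: (diskopB r0 wk); [exact: nice_admissible..|exact: zD].
Qed.

(** Partial evaluation in another variable commutes with the operator. *)
Lemma coordop_upd k j i f z w : i != j ->
  coordop k j f (upd z i w) = coordop k j (fun y => f (upd y i w)) z.
Proof.
move=> ij; have ji : j != i by rewrite eq_sym.
have E : upd z i w j = z j by exact: upd_neq.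
rewrite /coordop E.
suff -> : (fun u => f (upd (upd z i w) j u)) = (fun u => f (upd (upd z j u) i w)) by [].
by apply/funext => u; rewrite (updC _ _ _ ij).
Qed.

Lemma nice_upd f i w : nice f -> normc w <= r -> nice (fun y => f (upd y i w)).
Proof.
move=> [M [H [M0 H0 fM fH]]] wr; exists M, H; split => //.
  by move=> z zD; apply: fM; exact: polydisk_upd.
move=> z j u zD ur; have [->|ij] := eqVneq i j.
  by rewrite upd_upd subrr normc0 mulr_ge0 ?powR_ge0.
rewrite eq_sym in ij; rewrite updC//.
have := fH (upd z i w) j u (polydisk_upd i zD wr) ur.
by rewrite upd_neq// eq_sym.
Qed.

Lemma niceB f g : nice f -> nice g -> nice (fun y => f y - g y).
Proof.
move=> [M [H [M0 H0 fM fH]]] [M' [H' [M0' H0' gM gH]]]; exists (M + M'), (H + H').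
split; rewrite ?addr_ge0//.
  by move=> z zD; rewrite (le_trans (normcB _ _))// lerD ?fM ?gM.
move=> z j w zD wr; 
have -> : f z - g z - (f (upd z j w) - g (upd z j w)) =
    f z - f (upd z j w) - (g z - g (upd z j w)) by ring.
by rewrite (le_trans (normcB _ _))// mulrDl lerD ?fH ?gH.
Qed.

Lemma coordop_bounded k j : weakly_singular k -> exists2 C, 0 <= C &
  forall f M z, nice f -> polydisk r z ->
    (forall w, normc w <= r -> normc (f (upd z j w)) <= M) ->
    normc (coordop k j f z) <= C * M.
Proof.
move=> wk; have [C C0 CP] := diskop_bounded r0 wk; exists C => // f M z nf zD fM.
exact: (CP _ _ (nice_admissible j nf zD) fM _ (zD j)).
Qed.

Lemma coordop_hoelder k j : hoelder_kernel k -> exists2 C, 0 <= C &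
  forall f M z w, nice f -> polydisk r z -> normc w <= r ->
    (forall w, normc w <= r -> normc (f (upd z j w)) <= M) ->
    normc (coordop k j f z - coordop k j f (upd z j w)) <=
      C * M * normc (z j - w) `^ alpha.
Proof.
move=> hk; have [C C0 CP] := diskop_hoelder r0 alpha0 alpha1 hk.
exists C => // f M z w nf zD wr fM; rewrite /coordop upd_id.
have -> : (fun u => f (upd (upd z j w) j u)) = (fun u => f (upd z j u)).
  by apply/funext => u; rewrite upd_upd.
exact: (CP _ _ (nice_admissible j nf zD) fM _ _ (zD j) wr).
Qed.

Lemma coordop_nice k j f : hoelder_kernel k -> nice f -> nice (coordop k j f).
Proof.
move=> hk nf; have [M [H [M0 H0 fM fH]]] := nf; have [wk _] := hk.
have [C C0 CP] := coordop_bounded j wk; have [L L0 LP] := coordop_hoelder j hk.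
exists (C * M), (L * M + C * H); split; rewrite ?addr_ge0 ?mulr_ge0//.
  by move=> z zD; apply: (CP _ _ _ nf zD) => w wr; apply: fM; exact: polydisk_upd.
move=> z i w zD wr; have p0 : 0 <= normc (z i - w) `^ alpha by exact: powR_ge0.
have [->|ij] := eqVneq i j.
  apply: (@le_trans _ _ (L * M * normc (z j - w) `^ alpha)).
    by apply: (LP _ _ _ _ nf zD wr) => u ur; apply: fM; exact: polydisk_upd.
  by apply: ler_wpM2r; rewrite ?powR_ge0// lerDl mulr_ge0.
have nu := nice_upd i nf wr.
rewrite (coordop_upd _ _ _ _ ij) -(coordopB j wk nf nu zD).
apply: (@le_trans _ _ (C * (H * normc (z i - w) `^ alpha))).
  apply: (CP _ _ _ (niceB nf nu) zD) => u ur; have := fH (upd z j u) i w (polydisk_upd j zD ur) wr.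
  by rewrite upd_neq.
by rewrite mulrA; apply: ler_wpM2r => //; rewrite lerDr mulr_ge0.
Qed.

(** Fubini. *)
Lemma coordopC k l i j f z : weakly_singular k -> weakly_singular l -> i != j ->
  nice f -> polydisk r z ->
  coordop k i (coordop l j f) z = coordop l j (coordop k i f) z.
Proof.
move=> wk wl ij nf zD; have ji : j != i by rewrite eq_sym.
have [_ [K K0 kK]] := wk; have [_ [L L0 lL]] := wl.
have [M [H [M0 H0 fM fH]]] := nf.
have [B _ BP] := inv_integrable r0.
have [ia _] := BP _ (zD i); have [ib lb] := BP _ (zD j).
pose F (q : RR * RR) := chiD (toC q.1) * chiD (toC q.2) *
  (k (z i) (toC q.1) * l (z j) (toC q.2) * f (upd (upd z i (toC q.1)) j (toC q.2))).
have iF : cintegrable (plane \x plane)%E F.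
  have mb : measurable_fun setT (fun q : RR * RR =>
      inD q.2 * (normc (toC q.2 - z j))^-1).
    have m := rintegrable_measurable ib.
    exact: (measurableT_comp m measurable_snd).
  have i2 := rintegrable_prod ia (fun p => mulr_ge0 (inD_ge0 r p) _) mb
    (fun q => mulr_ge0 (inD_ge0 r q.2) _) (fun _ _ => conj ib lb).
  have {i2} i2 : rintegrable (plane \x plane)%E (fun q : RR * RR =>
     inD q.1 * (normc (toC q.1 - z i))^-1 * (inD q.2 * (normc (toC q.2 - z j))^-1)).
    by apply: i2 => ?; rewrite invr_ge0 normc_ge0.
  apply: (cintegrable_le _ (rintegrableZ (K * L * M) i2)).
    rewrite (_ : F = fun q => k (z i) (toC q.1) * l (z j) (toC q.2) *
      (chiD (toC q.1) * chiD (toC q.2) * f (upd (upd z i (toC q.1)) j (toC q.2)))).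
      apply: cmeasurableM; last exact: slice2_measurable nf zD.
      apply: cmeasurableM.
        exact: (cmeasurable_comp measurable_fst (cmeasurable_slice (z i) wk)).
      exact: (cmeasurable_comp measurable_snd (cmeasurable_slice (z j) wl)).
    by apply/funext => q; rewrite /F mulrCA.
  move=> q; rewrite /F.
  have R0 : 0 <= K * L * M * (inD q.1 * (normc (toC q.1 - z i))^-1 *
      (inD q.2 * (normc (toC q.2 - z j))^-1)).
    by rewrite !mulr_ge0 ?inD_ge0 ?invr_ge0 ?normc_ge0.
  have [->|/(chiD_le r0) p1] := eqVneq (chiD (toC q.1)) 0.
    by rewrite !mul0r normc0.
  have [->|/(chiD_le r0) p2] := eqVneq (chiD (toC q.2)) 0.
    by rewrite mulr0 !mul0r normc0.
  rewrite !normcM !(chiD_normc r0).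
  have -> : K * L * M * (inD q.1 * (normc (toC q.1 - z i))^-1 *
      (inD q.2 * (normc (toC q.2 - z j))^-1)) = inD q.1 * inD q.2 *
    (K * (normc (toC q.1 - z i))^-1 * (L * (normc (toC q.2 - z j))^-1) * M) by ring.
  apply: ler_wpM2l; first by rewrite mulr_ge0 ?inD_ge0.
  apply: ler_pM; rewrite ?mulr_ge0 ?normc_ge0//.
    by apply: ler_pM; rewrite ?normc_ge0//; [exact: kK (zD i) _|exact: lL (zD j) _].
  by apply: fM; do 2 apply: polydisk_upd => //.
have [_ _ eF] := cint_fubini (cintegrableZ pic iF).
have zjx w : upd z i w j = z j by exact: upd_neq.
have ziy w : upd z j w i = z i by exact: upd_neq.
have E1 : coordop k i (coordop l j f) z =
    pic * cint plane (fun x => cint plane (fun y => pic * F (x, y))).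
  rewrite /coordop /(diskop _ _ _); congr (_ * _); apply: eq_cint => x.
  rewrite zjx; case: (leP (normc (toC x)) r) => xr; last first.
    have x0 : chiD (toC x) = 0 by rewrite (chiDE r0) leNgt xr.
    rewrite x0 mul0r -[LHS](cint0 plane); apply: eq_cint => y.
    by rewrite /F /= x0 !mul0r mulr0.
  have xD := polydisk_upd i zD xr.
  have iy := diskop_integrable r0 wl (nice_admissible j nf xD) (zD j).
  rewrite (chiD_eq1 r0 xr) mul1r mulrA -(cintZ _ iy); apply: eq_cint => y.
  by rewrite /F /= (chiD_eq1 r0 xr); ring.
have E2 : coordop l j (coordop k i f) z =
    pic * cint plane (fun y => cint plane (fun x => pic * F (x, y))).
  rewrite /coordop /(diskop _ _ _); congr (_ * _); apply: eq_cint => y.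
  rewrite ziy; case: (leP (normc (toC y)) r) => yr; last first.
    have y0 : chiD (toC y) = 0 by rewrite (chiDE r0) leNgt yr.
    rewrite y0 mul0r -[LHS](cint0 plane); apply: eq_cint => x.
    by rewrite /F /= y0 mulr0 !mul0r mulr0.
  have yD := polydisk_upd j zD yr.
  have ix := diskop_integrable r0 wk (nice_admissible i nf yD) (zD i).
  rewrite (chiD_eq1 r0 yr) mul1r mulrA -(cintZ _ ix); apply: eq_cint => x.
  by rewrite /F /= (chiD_eq1 r0 yr) (updC z _ _ ji); ring.
exact: (etrans E1 (etrans (congr1 (fun x => pic * x) eF) (esym E2))).
Qed.

End CoordinateOps.

Section TransformsAsDiskOperators.
Variables (R : realType) (r : R) (n : nat).
Hypothesis r0 : 0 < r.
Local Notation TR := (measurableTypeR R).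
Local Notation RR := (TR * TR)%type.
Local Notation plane := (@plane R).
Local Notation toC := (@toC R).
Local Notation DD := (`[0%R, (r ^+ 2)%R]%classic : set TR).
Local Notation chiD := (chi DD).
Implicit Types (f : ('I_n -> R[i]) -> R[i]).

Lemma diskintE (g : R[i] -> R[i]) :
  diskint r g = 2%:R * 'i%C * cint plane (fun p => chiD (toC p) * g (toC p)).
Proof.
rewrite /diskint; congr (_ * _); rewrite /cint.
have E (P : R[i] -> R) : P 0 = 0 ->
    \int[(lebesgue_measure \x lebesgue_measure)%E]_(p in [set p : R * R | disk r (p.1 +i* p.2)])
      P (g (p.1 +i* p.2)) = \int[plane]_p P (chiD (toC p) * g (toC p)).
  move=> P0; rewrite Rintegral_mkcond; congr fine; apply: eq_integral => p _.
  congr (_%:E); rewrite patchE (chiDE r0); case: ifPn => [/set_mem|].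
    by rewrite /disk /= => pr; rewrite pr mul1r.
  by rewrite notin_setE /disk /= => /negP/negbTE ->; rewrite mul0r P0.
by congr Complex; exact: E.
Qed.

Lemma twopiiE : twopii R = 2%:R * 'i%C * (pi : R)%:C.
Proof. by rewrite /twopii mulrAC. Qed.

Lemma pi_neq0 : (pi : R)%:C != 0.
Proof. by rewrite -normc_eq0 normc_real normr_eq0 gt_eqF// pi_gt0. Qed.

Lemma ImC_neq0 : 'i%C != 0 :> R[i].
Proof. by rewrite eq_complex /= oner_eq0 andbF. Qed.

Lemma diskint_scaled (g : R[i] -> R[i]) : -1 / twopii R * diskint r g =
  - (pi^-1 : R)%:C * cint plane (fun p => chiD (toC p) * g (toC p)).
Proof.
rewrite diskintE twopiiE mulrA; congr (_ * _).
have -> : (pi^-1 : R)%:C = ((pi : R)%:C)^-1.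
  by apply: (mulIf pi_neq0); rewrite pic_pi mulVf// pi_neq0.
have H (P I : R[i]) : P != 0 -> I != 0 -> -1 / (2%:R * I * P) * (2%:R * I) = - P^-1.
  by move=> P0 I0; field; rewrite ?P0 ?I0.
exact: (H _ _ pi_neq0 ImC_neq0).
Qed.

Lemma T_coordop j f : T r j f = coordop r (powker 0) j f.
Proof.
apply/funext => z; rewrite /T diskint_scaled; congr (_ * _); apply: eq_cint => p.
by rewrite /powker expr0 fact0 divr1 mul1r [_^-1 * _]mulrC.
Qed.

Lemma Tbar_coordop j f : Tbar r j f = coordop r (conjker (powker 0)) j f.
Proof.
apply/funext => z; rewrite /Tbar diskint_scaled; congr (_ * _); apply: eq_cint => p.
by rewrite conj_powkerE expr0 fact0 divr1 mul1r [_^-1 * _]mulrC.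
Qed.

Lemma iter_coordop k j m f z :
  iter m (coordop r k j) f z =
  iter m (diskop r k) (fun w => f [eta z with j |-> w]) (z j).
Proof.
elim: m z => [|m IH] z /=.
  by congr f; apply/funext => i /=; case: eqP => [->|].
have E : (fun w => iter m (coordop r k j) f [eta z with j |-> w]) =
    iter m (diskop r k) (fun w => f [eta z with j |-> w]).
  apply/funext => w; rewrite IH upd_id.
  suff -> : (fun u => f [eta [eta z with j |-> w] with j |-> u]) =
    (fun u => f [eta z with j |-> u]) by [].
  by apply/funext => u; rewrite upd_upd.
by rewrite {1}/coordop E.
Qed.

End TransformsAsDiskOperators.

(** * The classes of mixed Hoelder functions *)

Section MixedDifferences.
Variables (R : realType) (r alpha : R) (n : nat).
Hypotheses (r0 : 0 < r) (alpha0 : 0 < alpha) (alpha1 : alpha < 1).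
Local Notation pt := ('I_n -> R[i]).
Local Notation upd z j w := [eta z with j |-> w].
Local Notation nice := (nice r alpha).
Local Notation coordop := (coordop r).
Local Notation hoelder_kernel := (hoelder_kernel r alpha).
Implicit Types (f g : pt -> R[i]) (z : pt) (s : seq 'I_n) (k : R[i] -> R[i] -> R[i]).

(** [Deltas] as an operator on functions. *)
Definition diff z' s f : pt -> R[i] := foldl (fun F i => Delta z' i F) f s.

Lemma DeltaC z' i j f : i != j -> Delta z' i (Delta z' j f) = Delta z' j (Delta z' i f).
Proof.
by move=> ij; apply/funext => z; rewrite /Delta (updC _ _ _ ij); ring.
Qed.

Lemma diff_Delta z' s j f : j \notin s ->
  diff z' s (Delta z' j f) = Delta z' j (diff z' s f).
Proof.
rewrite /diff; elim: s f => //= i s IH f; rewrite inE negb_or => /andP[ji js].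
by rewrite -IH// DeltaC// eq_sym.
Qed.

Lemma diff_split z' s1 s2 j f : j \notin s2 ->
  diff z' (s1 ++ j :: s2) f = Delta z' j (diff z' (s1 ++ s2) f).
Proof. by move=> js; rewrite /diff !foldl_cat /= -/(diff z' s2 _) diff_Delta. Qed.

Lemma eq_diff z' s f g : polydisk r z' -> (forall z, polydisk r z -> f z = g z) ->
  forall z, polydisk r z -> diff z' s f z = diff z' s g z.
Proof.
move=> z'D; rewrite /diff; elim: s f g => [//|i s IH] f g fg z zD /=.
apply: IH => // y yD; rewrite /Delta fg// fg//.
by apply: polydisk_upd => //; exact: z'D.
Qed.

Lemma nice_diff z' s f : polydisk r z' -> nice f -> nice (diff z' s f).
Proof.
move=> z'D; rewrite /diff; elim: s f => [//|i s IH] f nf /=.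
by apply: IH; apply: niceB => //; apply: nice_upd => //; exact: z'D.
Qed.

Lemma diff_coordop k j z' s f : hoelder_kernel k -> polydisk r z' -> nice f ->
  j \notin s -> forall z, polydisk r z ->
  diff z' s (coordop k j f) z = coordop k j (diff z' s f) z.
Proof.
move=> hk z'D; have [wk _] := hk.
rewrite /diff; elim: s f => [//|i s IH] f nf.
rewrite inE negb_or => /andP[ji js] z zD /=.
have ij : i != j by rewrite eq_sym.
have nu : nice (fun y => f (upd y i (z' i))) by apply: nice_upd => //; exact: z'D.
rewrite -IH//; last exact: niceB.
apply: (eq_diff s z'D) => // y yD.
rewrite /Delta coordop_upd; last exact: ij.
by rewrite (coordopB r0 alpha0 j wk nf nu yD).
Qed.

(** Boundedness of the mixed differences of [f] in the variables of [s]. *)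
Definition mixed_bound s f (K : R) := forall z z', polydisk r z -> polydisk r z' ->
  (forall i, i \in s -> z i != z' i) ->
  normc (diff z' s f z) <= K * \prod_(i <- s) normc (z i - z' i) `^ alpha.

Lemma prod_powR_gt0 s z z' : (forall i, i \in s -> z i != z' i) ->
  0 < \prod_(i <- s) normc (z i - z' i) `^ alpha.
Proof.
move=> zz'; rewrite big_seq; apply: prodr_gt0 => i /zz' h.
by rewrite powR_gt0// normc_gt0 subr_eq0.
Qed.

Lemma normc_delta s f z z' : (forall i, i \in s -> z i != z' i) ->
  normc (delta alpha s f z z') =
  normc (diff z' s f z) / \prod_(i <- s) normc (z i - z' i) `^ alpha.
Proof.
move=> /prod_powR_gt0 p0; rewrite /delta normcM normcV normc_real gtr0_norm//.
Qed.

Lemma CalphaP f : Calpha r alpha f <->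
  forall s, uniq s -> exists2 K, 0 <= K & mixed_bound s f K.
Proof.
pose S s := ereal_sup [set x | exists z z', [/\ polydisk r z, polydisk r z',
  (forall i, i \in s -> z i != z' i) & x = (normc (delta alpha s f z z'))%:E]].
split=> [hf s us|hf k _].
  have sn : (size s <= n)%N by rewrite -[leqRHS]card_ord -(card_uniqP us) max_card.
  have hS : (S s < +oo)%E.
    apply: le_lt_trans (hf _ sn).
    exact: (@le_bigmax_cond _ _ _ -oo%E (in_tuple s) (fun t => uniq t) (fun t => S t) us).
  exists `|fine (S s)| => // z z' zD z'D zz'.
  rewrite -ler_pdivrMr; last exact: prod_powR_gt0.
  rewrite -normc_delta; last exact: zz'.
  have : ((normc (delta alpha s f z z'))%:E <= S s)%E.
    by apply: ereal_sup_ubound; exists z, z'.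
  case: (S s) hS => [x _|//|_]; last by rewrite leeNy_eq.
  by rewrite lee_fin => h; apply: le_trans h (ler_norm _).
apply/bigmax_ltP; split; first by [].
move=> t ut; have [K _ KP] := hf _ ut.
apply: (@le_lt_trans _ _ K%:E); last exact: ltry.
apply: ub_ereal_sup => _ [z [z' [zD z'D zz' ->]]]; rewrite lee_fin normc_delta//.
by rewrite ler_pdivrMr ?prod_powR_gt0//; exact: KP.
Qed.

Lemma Calpha_nice f : Calpha r alpha f -> nice f.
Proof.
move=> /CalphaP hf; have [M M0 MP] := hf [::] isT.
have h j : exists K, 0 <= K /\ mixed_bound [:: j] f K.
  by have [K K0 KP] := hf [:: j] isT; exists K.
have [K KP] := choice h.
exists M, (\sum_j K j); split => //.
- by apply: sumr_ge0 => j _; case: (KP j).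
- move=> z zD; have := MP z z zD zD; rewrite big_nil mulr1 /diff /=; apply => //.
move=> z j w zD wr; have Kj : K j <= \sum_i K i.
  by rewrite (bigD1 j)//= lerDl; apply: sumr_ge0 => i _; case: (KP i).
apply: (@le_trans _ _ (K j * normc (z j - w) `^ alpha)); last first.
  by apply: ler_wpM2r => //; exact: powR_ge0.
have [K0 h2] := KP j; have [<-|zw] := eqVneq (z j) w.
  have -> : upd z j (z j) = z :> pt by apply/funext => i /=; case: eqP => [->|].
  by rewrite subrr normc0 mulr_ge0 ?powR_ge0.
have := h2 z (upd z j w) zD (polydisk_upd j zD wr).
have -> : diff (upd z j w) [:: j] f z = f z - f (upd z j w).
  by rewrite /diff [LHS]/= /Delta upd_id.
rewrite big_seq1 upd_id; apply => i; rewrite inE => /eqP ->.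
by rewrite upd_id.
Qed.

Lemma coordop_Calpha k j f : hoelder_kernel k -> Calpha r alpha f ->
  Calpha r alpha (coordop k j f).
Proof.
move=> hk cf; have nf := Calpha_nice cf; have [wk _] := hk.
have [C C0 CP] := coordop_bounded r0 alpha0 j wk.
have [L L0 LP] := coordop_hoelder r0 alpha0 alpha1 j hk.
have bound (s : seq 'I_n) K z z' w : j \notin s -> mixed_bound s f K ->
    polydisk r z -> polydisk r z' -> (forall i, i \in s -> z i != z' i) -> normc w <= r ->
    normc (diff z' s f (upd z j w)) <= K * \prod_(i <- s) normc (z i - z' i) `^ alpha.
  move=> js KP zD z'D zz' wr.
  have E i : i \in s -> upd z j w i = z i.
    by move=> ins; apply: upd_neq; apply: contraNneq js => <-.
  have -> : \prod_(i <- s) normc (z i - z' i) `^ alpha =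
      \prod_(i <- s) normc (upd z j w i - z' i) `^ alpha.
    by rewrite big_seq [RHS]big_seq; apply: eq_bigr => i /E ->.
  apply: KP => //; first exact: polydisk_upd.
  by move=> i ins; rewrite E//; exact: zz'.
apply/CalphaP => s us; have [js|js] := boolP (j \in s); last first.
  have [K K0 KP] := (CalphaP f).1 cf _ us.
  exists (C * K); first exact: mulr_ge0.
  move=> z z' zD z'D zz'; rewrite (diff_coordop hk z'D nf js zD) -mulrA.
  apply: (CP _ _ _ (nice_diff s z'D nf) zD) => w wr; exact: bound.
case/splitPr: js us => s1 s2; rewrite cat_uniq /= negb_or => /and3P[u1 /andP[j1 u12] /andP[j2 u2]].
pose t := s1 ++ s2; have jt : j \notin t by rewrite mem_cat negb_or j1.
have ut : uniq t by rewrite cat_uniq u1 u12.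
have [K K0 KP] := (CalphaP f).1 cf _ ut.
exists (L * K); first exact: mulr_ge0.
move=> z z' zD z'D zz'.
have zt i : i \in t -> z i != z' i.
  by move=> it; apply: zz'; move: it; rewrite !mem_cat inE => /orP[->//|->]; rewrite !orbT.
rewrite diff_split// -/t {1}/Delta.
have z'jD := polydisk_upd j zD (z'D j).
rewrite (diff_coordop hk z'D nf jt zD) (diff_coordop hk z'D nf jt z'jD).
have -> : \prod_(i <- s1 ++ j :: s2) normc (z i - z' i) `^ alpha =
    normc (z j - z' j) `^ alpha * \prod_(i <- t) normc (z i - z' i) `^ alpha.
  by rewrite /t !big_cat big_cons /= mulrCA.
rewrite [X in _ <= _ * X]mulrC mulrA -[L * K * _]mulrA.
apply: (LP _ _ _ _ (nice_diff t z'D nf) zD (z'D j)) => w wr; exact: bound.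
Qed.

End MixedDifferences.

(** * Rearranging the iterated operators *)

Section CommutingOperators.
Variables (R : realType) (r alpha : R) (n : nat).
Local Notation pt := ('I_n -> R[i]).
Local Notation nice := (nice r alpha).
Implicit Types (f g : pt -> R[i]) (U V W : (pt -> R[i]) -> pt -> R[i]).

Definition eq_on_polydisk f g := forall z, polydisk r z -> f z = g z.

Definition local_op U := (forall f, nice f -> nice (U f)) /\
  (forall f g, eq_on_polydisk f g -> eq_on_polydisk (U f) (U g)).

Definition commuting U V := forall f, nice f -> eq_on_polydisk (U (V f)) (V (U f)).

Lemma eq_on_trans f g h : eq_on_polydisk f g -> eq_on_polydisk g h -> eq_on_polydisk f h.
Proof. by move=> fg gh z zD; rewrite fg// gh. Qed.

Lemma commuting_sym U V : commuting U V -> commuting V U.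
Proof. by move=> uv f nf z zD; rewrite uv. Qed.

Lemma local_iter U m : local_op U -> local_op (iter m U).
Proof.
move=> [u1 u2]; split; first by move=> f nf; elim: m => //= m IH; exact: u1.
by move=> f g fg; elim: m => //= m IH; exact: u2.
Qed.

Lemma commuting_iter U V m : local_op U -> local_op V -> commuting U V ->
  commuting (iter m U) V.
Proof.
move=> lU lV uv f nf; elim: m => [z _ //|m IH] /=.
apply: eq_on_trans (lU.2 _ _ IH) _; apply: uv.
exact: (local_iter m lU).1.
Qed.

Lemma local_foldr (I : Type) (W : I -> (pt -> R[i]) -> pt -> R[i]) s :
  (forall i, local_op (W i)) -> local_op (fun f => foldr W f s).
Proof.
move=> lW; split; first by move=> f nf; elim: s => //= i s IH; exact: (lW i).1.
by move=> f g fg; elim: s => //= i s IH; exact: (lW i).2.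
Qed.

Lemma commuting_foldr (I : eqType) U (W : I -> (pt -> R[i]) -> pt -> R[i]) s :
  local_op U -> (forall i, local_op (W i)) ->
  (forall i, i \in s -> commuting U (W i)) -> commuting U (fun f => foldr W f s).
Proof.
move=> lU lW; elim: s => [|i s IH] uW f nf /=; first by [].
apply: eq_on_trans (uW i (mem_head _ _) _ _) _.
  exact: (local_foldr s lW).1.
apply: (lW i).2; apply: IH => // j js; apply: uW; rewrite inE js orbT //.
Qed.

Lemma foldr_foldl (I : eqType) (A B : I -> (pt -> R[i]) -> pt -> R[i]) s f :
  (forall i, local_op (A i)) -> (forall i, local_op (B i)) ->
  (forall i j, i != j -> commuting (A i) (A j)) ->
  (forall i j, i != j -> commuting (A i) (B j)) ->
  (forall i j, i != j -> commuting (B i) (B j)) ->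
  uniq s -> nice f ->
  eq_on_polydisk (foldr A (foldr B f s) s) (foldl (fun g j => A j (B j g)) f s).
Proof.
move=> lA lB AA AB BB; elim: s f => [//|j s IH] f /= /andP[js us] nf.
have ne i : i \in s -> j != i by move=> ins; apply: contraNneq js => ->.
have lFA := local_foldr s lA; have lFB := local_foldr s lB.
have cAA := commuting_foldr (lA j) lA (fun i ins => AA _ _ (ne i ins)).
have cAB := commuting_foldr (lA j) lB (fun i ins => AB _ _ (ne i ins)).
have cBB := commuting_foldr (lB j) lB (fun i ins => BB _ _ (ne i ins)).
have nB := (lB j).1 _ nf.
apply: eq_on_trans; last exact: IH us ((lA j).1 _ nB).
apply: eq_on_trans ((lA j).2 _ _ (lFA.2 _ _ (cBB _ nf))) _.
apply: eq_on_trans (cAA _ (lFB.1 _ nB)) _.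
exact: (lFA.2 _ _ (cAB _ nB)).
Qed.

End CommutingOperators.

Section Assembly.
Variables (R : realType) (r alpha : R) (n : nat).
Hypotheses (r0 : 0 < r) (alpha0 : 0 < alpha) (alpha1 : alpha < 1).
Variables (mu nu : 'I_n -> nat).
Hypotheses (mu0 : forall j, (0 < mu j)%N) (nu0 : forall j, (0 < nu j)%N).
Local Notation pt := ('I_n -> R[i]).
Local Notation upd z j w := [eta z with j |-> w].
Local Notation nice := (nice r alpha).
Implicit Types (f g : pt -> R[i]).

Let A (j : 'I_n) f := iter (mu j) (T r j) f.
Let B (j : 'I_n) f := iter (nu j) (Tbar r j) f.

Lemma T_coordopE j : @T R r n j = coordop r (powker 0) j.
Proof. by apply/funext => f; exact: T_coordop. Qed.

Lemma Tbar_coordopE j : @Tbar R r n j = coordop r (conjker (powker 0)) j.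
Proof. by apply/funext => f; exact: Tbar_coordop. Qed.

Let hp : hoelder_kernel r alpha (powker (R := R) 0) := hoelder_powker r0 alpha0 alpha1.
Let hc : hoelder_kernel r alpha (conjker (powker (R := R) 0)) := hoelder_conjker hp.

Lemma local_coordop k j : hoelder_kernel r alpha k -> local_op r alpha (coordop (n := n) r k j).
Proof.
move=> hk; split; first by move=> f; exact: coordop_nice.
by move=> f g fg z zD; exact: eq_coordop.
Qed.

Lemma commuting_coordop k l i j : hoelder_kernel r alpha k -> hoelder_kernel r alpha l ->
  i != j -> commuting r alpha (coordop (n := n) r k i) (coordop r l j).
Proof. by move=> [wk _] [wl _] ij f nf z zD; exact: (coordopC r0 alpha0 wk wl ij nf zD). Qed.

Lemma commuting_iters k l i j a b : hoelder_kernel r alpha k -> hoelder_kernel r alpha l ->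
  i != j -> commuting r alpha (iter a (coordop (n := n) r k i)) (iter b (coordop r l j)).
Proof.
move=> hk hl ij; have lk := local_coordop i hk; have ll := local_coordop j hl.
have c := commuting_sym (commuting_coordop hk hl ij).
have c' : commuting r alpha (coordop r k i) (iter b (coordop r l j)).
  apply: commuting_sym; exact: commuting_iter ll lk c.
exact: commuting_iter lk (local_iter b ll) c'.
Qed.

Definition coord_factor j : R[i] :=
  (-1) ^+ mu j / (((mu j).-1)`!%:R * ((nu j).-1)`!%:R * twopii R).

Lemma coord_formula j f (y : pt) (c zj : R[i]) : nice f -> polydisk r y -> normc zj <= r ->
  coord_factor j * diskint r (fun w => c * (C3 r zj w (mu j) (nu j) * f (upd y j w))) =
  c * A j (B j f) (upd y j zj).
Proof.
move=> nf yD zr; have ag := nice_admissible r0 alpha0 j nf yD.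
rewrite /A /B /coord_factor T_coordopE Tbar_coordopE iter_coordop upd_id.
case: (mu j) (mu0 j) (nu j) (nu0 j) => [h|m _ [h|k _]]; [by []..|].
have [iC eC] := iter_formula r0 m k ag zr.
rewrite (_ : (fun w => iter k.+1 _ f _) =
    iter k.+1 (diskop r (conjker (powker 0))) (fun w => f (upd y j w))); last first.
  apply/funext => w; rewrite iter_coordop upd_id upd_upd.
  suff -> : (fun u => f (upd (upd y j w) j u)) = (fun u => f (upd y j u)) by [].
  by apply/funext => u; rewrite upd_upd.
rewrite eC diskintE//.
rewrite (_ : (fun p => _ * (c * _)) = fun p => c * (chi `[0%R, (r ^+ 2)%R]%classic (toC p) *
    (C3 r zj (toC p) m.+1 k.+1 * f (upd y j (toC p))))); last first.
  by apply/funext => p; rewrite mulrCA.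
rewrite (cintZ _ iC) twopiiE.
have -> : (pi^-1 : R)%:C = ((pi : R)%:C)^-1.
  by apply: (mulIf (pi_neq0 R)); rewrite pic_pi mulVf// pi_neq0.
have m0 := natC_neq0 R (fact_gt0 m); have k0 := natC_neq0 R (fact_gt0 k).
have H (P I M N S X d : R[i]) : P != 0 -> I != 0 -> M != 0 -> N != 0 ->
    -1 * S / (M * N * (2%:R * I * P)) * (2%:R * I * (d * X)) =
    d * (- P^-1 * (S / (M * N) * X)).
  by move=> P0 I0 M0 N0; field; rewrite ?P0 ?I0 ?M0 ?N0.
by rewrite exprS; exact: (H _ _ _ _ _ _ _ (pi_neq0 R) (ImC_neq0 R) m0 k0).
Qed.

Lemma coord_factor_neq0 j : coord_factor j != 0.
Proof.
rewrite /coord_factor mulf_neq0 ?signr_eq0// invr_eq0 twopiiE.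
by rewrite !mulf_neq0 ?natC_neq0 ?fact_gt0 ?pi_neq0 ?ImC_neq0.
Qed.

Lemma eq_diskint (g h : R[i] -> R[i]) : (forall w : R[i], normc w <= r -> g w = h w) ->
  diskint r g = diskint r h.
Proof.
move=> gh; rewrite !(diskintE r0); congr (_ * _); apply: eq_cint => p.
exact: (chiD_eq r0 (gh _)).
Qed.

(** The coordinates in [s] have already been integrated out, and evaluated at [z]. *)
Definition substitute (z : pt) (s : seq 'I_n) (y : pt) : pt :=
  fun i => if i \in s then z i else y i.

Lemma fold_formula (z : pt) (t s : seq 'I_n) f F (a : R[i]) : polydisk r z ->
  uniq t -> (forall j, j \in t -> j \notin s) -> nice f ->
  (forall y, polydisk r y -> F y =
     a * (\prod_(i <- t) C3 r (z i) (y i) (mu i) (nu i)) * f (substitute z s y)) ->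
  forall y, polydisk r y ->
  (\prod_(j <- t) coord_factor j) *
    foldl (fun F j z => diskint r (fun w => F (upd z j w))) F t y =
  a * foldl (fun g j => A j (B j g)) f t (substitute z (catrev t s) y).
Proof.
move=> zD; elim: t s f F a => [|j t IH] s f F a ut ts nf FE y yD.
  by rewrite big_nil mul1r /= FE// big_nil mulr1.
have /andP[jt ut'] : (j \notin t) && uniq t := ut.
have js : j \notin s by apply: ts; exact: mem_head.
have e0 := coord_factor_neq0 j.
rewrite big_cons -mulrA /=.
have lA : local_op r alpha (A j) by rewrite /A T_coordopE; apply: local_iter; exact: local_coordop.
have lB : local_op r alpha (B j).
  by rewrite /B Tbar_coordopE; apply: local_iter; exact: local_coordop.
pose F1 y := diskint r (fun w => F (upd y j w)).
have F1E x : polydisk r x -> F1 x = a / coord_factor j *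
    (\prod_(i <- t) C3 r (z i) (x i) (mu i) (nu i)) *
    A j (B j f) (substitute z (j :: s) x).
  move=> xD; pose c := a * \prod_(i <- t) C3 r (z i) (x i) (mu i) (nu i).
  pose sx := substitute z s x.
  have sD : polydisk r sx.
    by move=> i; rewrite /sx /substitute; case: ifP => _; [exact: zD|exact: xD].
  have -> : substitute z (j :: s) x = upd sx j (z j).
    apply/funext => i; rewrite /sx /substitute /= inE.
    by case: eqVneq => [->|].
  have H (e b p X : R[i]) : e != 0 -> e * (b / e * p * X) = b * p * X.
    by move=> en0; field.
  apply: (mulfI e0); rewrite (H _ _ _ _ e0) -/c.
  rewrite -(coord_formula j c nf sD (zD j)); congr (_ * _).
  apply: eq_diskint => w wr; have wD := polydisk_upd j xD wr.
  rewrite (FE _ wD) big_cons upd_id.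
  have -> : \prod_(i <- t) C3 r (z i) (upd x j w i) (mu i) (nu i) =
      \prod_(i <- t) C3 r (z i) (x i) (mu i) (nu i).
    apply: eq_big_seq => i it; congr (C3 _ _ _ _ _).
    have ij : i != j by apply: contraNneq jt => <-.
    exact: upd_neq.
  have -> : substitute z s (upd x j w) = upd sx j w.
    apply/funext => i; rewrite /sx /substitute /=.
    by case: eqVneq => [->|_]; rewrite ?(negbTE js).
  by rewrite /c; ring.
have ts' i : i \in t -> i \notin j :: s.
  move=> it; rewrite inE negb_or ts ?inE ?it ?orbT// andbT.
  by apply: contraNneq jt => <-.
rewrite (IH (j :: s) (A j (B j f)) F1 _ ut' ts' (lA.1 _ (lB.1 _ nf)) F1E y yD).
by rewrite mulrA [coord_factor j * _]mulrC divfK.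
Qed.

Lemma C8E : C8 R mu nu = \prod_j coord_factor j.
Proof.
rewrite /C8 /coord_factor; move: (twopii R) => t.
by rewrite prodf_div !big_split /= prodrXr prodr_const card_ord !natr_prod.
Qed.

Lemma foldl_polydiskint (z : pt) f : polydisk r z -> nice f ->
  C8 R mu nu * polydiskint r (fun eta =>
    (\prod_(j < n) C3 r (z j) (eta j) (mu j) (nu j)) * f eta) =
  foldl (fun g j => A j (B j g)) f (enum 'I_n) z.
Proof.
move=> zD nf; rewrite C8E -big_enum /polydiskint.
have D0 : polydisk r (fun _ : 'I_n => 0 : R[i]).
  by move=> i; change (normc (0 : R[i]) <= r); rewrite normc0 ltW.
rewrite (fold_formula (s := [::]) (a := 1) zD (enum_uniq _) _ nf _ D0) //.
  rewrite mul1r; congr (foldl _ _ _ _); apply/funext => i.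
  by rewrite /substitute catrevE cats0 mem_rev mem_enum.
by move=> y _; rewrite mul1r -big_enum.
Qed.

Lemma oppow_formula f : nice f -> forall z, polydisk r z ->
  oppow (T r) mu (oppow (Tbar r) nu f) z =
  foldl (fun g j => A j (B j g)) f (enum 'I_n) z.
Proof.
move=> nf; rewrite /oppow.
have AE j : A j = iter (mu j) (coordop r (powker 0) j) by rewrite /A T_coordopE.
have BE j : B j = iter (nu j) (coordop r (conjker (powker 0)) j).
  by rewrite /B Tbar_coordopE.
apply: (@foldr_foldl R r alpha n _ A B) (enum_uniq _) nf.
- by move=> j; rewrite AE; apply: local_iter; exact: local_coordop.
- by move=> j; rewrite BE; apply: local_iter; exact: local_coordop.
- by move=> i j ij; rewrite !AE; exact: commuting_iters.
- by move=> i j ij; rewrite AE BE; exact: commuting_iters.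
- by move=> i j ij; rewrite !BE; exact: commuting_iters.
Qed.

Lemma oppow_Calpha (S : 'I_n -> (pt -> R[i]) -> pt -> R[i]) (m : 'I_n -> nat) f :
  (forall j g, Calpha r alpha g -> Calpha r alpha (S j g)) ->
  Calpha r alpha f -> Calpha r alpha (oppow S m f).
Proof.
move=> SC cf; rewrite /oppow; elim: (enum 'I_n) => //= j s IH.
by elim: (m j) => //= k; exact: SC.
Qed.

End Assembly.

Theorem corollary3p3 (R : realType) (r alpha : R) (n : nat)
  (hr : 0 < r) (halpha0 : 0 < alpha) (halpha1 : alpha < 1) (hn : (0 < n)%N)
  (f : ('I_n -> R[i]) -> R[i]) (hf : Calpha r alpha f)
  (mu nu : 'I_n -> nat)
  (hmu : forall j, (0 < mu j)%N) (hnu : forall j, (0 < nu j)%N) :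
  Calpha r alpha (oppow (T r) mu (oppow (Tbar r) nu f)) /\
  forall z : 'I_n -> R[i], polydisk r z ->
    oppow (T r) mu (oppow (Tbar r) nu f) z =
    C8 R mu nu *
    polydiskint r (fun eta =>
      (\prod_(j < n) C3 r (z j) (eta j) (mu j) (nu j)) * f eta).
Proof.
have hp := hoelder_powker hr halpha0 halpha1.
have nf := Calpha_nice hf.
split.
  apply: oppow_Calpha => [j g cg|]; first by rewrite T_coordop//; exact: coordop_Calpha.
  apply: oppow_Calpha => // j g cg.
  by rewrite Tbar_coordop//; apply: coordop_Calpha => //; exact: hoelder_conjker.
move=> z zD; rewrite (foldl_polydiskint hr halpha0 halpha1 hmu hnu zD nf).
exact: (oppow_formula hr halpha0 halpha1).
Qed.
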